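(* Let $R$ be a finite ring and let $S\subseteq U(R)$ be a non-empty subset with $S^{-1}\subseteq S$ such that $\widetilde{\gamma}(\Gamma(R,S))=k>0$. Then $|R|\leq 32k$. In particular, for any positive integer $k$, the number (up to isomorphism) of finite rings $R$ such that $\widetilde{\gamma}(\Gamma(R,S))=k$ for some non-empty $S\subseteq U(R)$ with $S^{-1}\subseteq S$ is finite.
   Context: All rings are commutative with non-zero identity. $U(R)$ is the group of units of $R$, and $S^{-1}=\{s^{-1}\mid s\in S\}$. For a non-empty subset $S\subseteq U(R)$ with $S^{-1}\subseteq S$, $\Gamma(R,S)$ denotes the simple graph with vertex set $R$ in which two distinct vertices $x,y$ are adjacent if and only if there exists $s\in S$ with $x+sy\in U(R)$. The nonorientable genus (crosscap number) $\widetilde{\gamma}(\Gamma)$ of a finite simple graph $\Gamma$ is the minimum non-negative integer $k$ such that $\Gamma$ can be embedded in the sphere with $k$ crosscaps (the case $k=0$ being the sphere itself). *)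

(* Defs.v *)
From HB Require Import structures.
From mathcomp Require Import all_boot all_order all_algebra.
From mathcomp Require Import all_classical all_reals all_analysis.
From mathcomp Require Import ring lra.
Import Order.TTheory GRing.Theory Num.Theory.
Import numFieldNormedType.Exports.

Set Implicit Arguments.
Unset Strict Implicit.
Unset Printing Implicit Defensive.

Local Open Scope classical_set_scope.
Local Open Scope ring_scope.

Section Surface.
Variable K : realType.

Definition sphere : topologicalType := one_point_compactification (K * K)%type.

(* The discs of radius 1 centred at (3i, 0) are pairwise disjoint, also after
   taking closures; the distance below is the Euclidean one, whereas the
   library norm on K * K is the sup norm. *)
Definition sqdist (i : nat) (p : K * K) : K :=
  (p.1 - (3 * i)%:R) ^+ 2 + p.2 ^+ 2.

(* reflection through (3i, 0), i.e. the antipodal map of the i-th circle *)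
Definition antipode (i : nat) (p : K * K) : K * K :=
  ((6 * i)%:R - p.1, - p.2).

Variable k : nat.

Definition holed_sphere : set sphere :=
  [set x : sphere | forall (i : 'I_k) (p : K * K), x = Some p -> 1 <= sqdist i p].

Definition glued (x y : holed_sphere) : Prop :=
  x = y \/ exists (i : 'I_k) (p : K * K),
    [/\ sqdist i p = 1, set_val x = Some p & set_val y = Some (antipode i p)].

Definition gluedb : rel holed_sphere := fun x y => `[< glued x y >].

Lemma sqdist_antipode i p : sqdist i (antipode i p) = sqdist i p.
Proof. by rewrite /sqdist /antipode /= !natrM; ring. Qed.

Lemma antipodeK i : involutive (antipode i).
Proof. by case=> a b; rewrite /antipode /= opprK; congr (_, _); ring. Qed.

Lemma circles_disjoint i j p : sqdist i p = 1 -> sqdist j p = 1 -> i = j.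
Proof.
have aux (a b : nat) : (a < b)%N -> sqdist a p = 1 -> sqdist b p = 1 -> False.
  move=> ab; have : (a%:R + 1 <= b%:R :> K) by rewrite natr1 ler_nat.
  rewrite /sqdist !natrM => hab ha hb.
  have : p.1 - 3 * a%:R <= 1 by nra.
  have : - 1 <= p.1 - 3 * b%:R by nra.
  by lra.
move=> hi hj; case: (ltngtP i j) => // h; first by case: (aux _ _ h hi hj).
by case: (aux _ _ h hj hi).
Qed.

Lemma gluedb_refl : reflexive gluedb.
Proof. by move=> x; apply/asboolP; left. Qed.

Lemma glued_sym x y : glued x y -> glued y x.
Proof.
case=> [->|[i [p [hp ex ey]]]]; first by left.
by right; exists i, (antipode i p); rewrite sqdist_antipode antipodeK.
Qed.

Lemma gluedb_sym : symmetric gluedb.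
Proof. by move=> x y; apply/asboolP/asboolP; exact: glued_sym. Qed.

Lemma gluedb_trans : transitive gluedb.
Proof.
move=> y x z /asboolP xy /asboolP yz; apply/asboolP.
case: xy yz => [->//|[i [p [hp ex ey]]]] [<-|[j [q [hq ey' ez]]]].
  by right; exists i, p.
move: ey'; rewrite ey => -[eq]; rewrite -{}eq in hq ez.
have ij : i = j.
  by apply: val_inj; apply: circles_disjoint hq; rewrite sqdist_antipode.
by left; apply: val_inj; rewrite -!set_valE ex ez -ij antipodeK.
Qed.

Canonical glued_equiv := EquivRel gluedb gluedb_refl gluedb_sym gluedb_trans.

Definition sphere_with_crosscaps : topologicalType :=
  quotient_topology {eq_quot glued_equiv}%qT.

End Surface.

(* A topological embedding of the graph (V, e), e symmetric and irreflexive, in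
   X: the vertices are sent to distinct points and each edge uv to an arc from
   f u to f v, arcs meeting vertices and other arcs only at common endpoints.
   Since e is a relation, each arc is given with both of its orientations. *)
Definition embeds_in (K : realType) (V : finType) (e : rel V)
    (X : topologicalType) : Prop :=
  exists (f : V -> X) (g : V -> V -> K -> X),
  [/\ injective f,
      (forall u v, e u v ->
        [/\ {within `[0, 1], continuous (g u v)}, g u v 0 = f u, g u v 1 = f v
          & forall t, t \in `[0, 1] -> g v u t = g u v (1 - t)]),
      (forall u v w t, e u v -> t \in `]0, 1[ -> g u v t <> f w)
    & (forall u v u' v' t t', e u v -> e u' v' ->
        t \in `]0, 1[ -> t' \in `]0, 1[ -> g u v t = g u' v' t' ->
        [/\ u = u', v = v' & t = t'] \/ [/\ u = v', v = u' & t = 1 - t'])].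

Definition crosscap_number_is (K : realType) (V : finType) (e : rel V)
    (k : nat) : Prop :=
  embeds_in K e (sphere_with_crosscaps K k) /\
  forall j, embeds_in K e (sphere_with_crosscaps K j) -> (k <= j)%N.

Definition Gamma (R : finComUnitRingType) (S : {set R}) : rel R :=
  fun x y => (x != y) && [exists s in S, x + s * y \is a GRing.unit].

Definition admissible (R : finComUnitRingType) (S : {set R}) : Prop :=
  [/\ S != finset.set0, {in S, forall s, s \is a GRing.unit}
    & {in S, forall s, s^-1 \in S}].

Lemma Gamma_irreflexive (R : finComUnitRingType) (S : {set R}) :
  irreflexive (Gamma S).
Proof. by move=> x; rewrite /Gamma eqxx. Qed.

Lemma Gamma_symmetric (R : finComUnitRingType) (S : {set R}) :
  admissible S -> symmetric (Gamma S).
Proof.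
case=> _ Su Sinv; suff imp x y : Gamma S x y -> Gamma S y x.
  by move=> x y; apply/idP/idP; exact: imp.
case/andP=> xy /existsP[s /andP[sS us]]; rewrite /Gamma eq_sym xy /=.
apply/existsP; exists s^-1; rewrite Sinv //= -(unitrMr _ (Su s sS)).
by rewrite mulrDr (mulVKr (Su s sS)) addrC.
Qed.

Definition ring_isomorphic (R R' : finComUnitRingType) : Prop :=
  exists phi : {rmorphism R -> R'}, bijective phi.

(* Main.v *)
From HB Require Import structures.
Require Import Defs.
From mathcomp Require Import all_boot all_order all_algebra.
From mathcomp Require Import all_classical all_reals all_analysis.
From mathcomp Require Import ring lra zify.

(** Both halves rest on the inequality.  The key topological fact is that a graph
    embedded in the sphere with [k] crosscaps contains at most [k] pairwise
    disjoint subdivisions of the complete bipartite graph on three and three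
    vertices; this replaces the genus formula.

    To see it, each edge is approximated by a polygonal line in the plane, where
    a passage through a crosscap is drawn as a diameter of its disc.  At a
    suitable scale, two edges without common end cross in the plane only through
    pairs of diameters of the same disc, so their crossing parity is the dot
    product of the vectors in [F_2 ^ k] that count passages through crosscaps
    ([drawing_of_embedding]).  On the other hand, closed polygons cross evenly,
    while in any drawing of the complete bipartite graph the crossings of
    independent edges add up to an odd number.  Hence 4-cycles in different
    copies have orthogonal vectors, while every copy has two 4-cycles whose
    vectors have odd product; such dual families are independent, so there are
    at most [k] copies ([k33_packing_le]).

    It remains to find one such subdivision for every 32 elements of the ring,
    unless the graph is planar.  For [s] in [S], the elements [x] and [y] are
    joined as soon as [x + s * y] is a unit, which is decided at the primitive
    idempotents, that is in the residue fields of the local factors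
    ([unit_places]).  A small non-planar bipartite core, which involves the
    nilradical and at most two residue fields, is repeated over all values of
    the other coordinates; the two sides of a copy are kept disjoint by a
    matching in one further residue field, which leaves at least a third of the
    ring for each side ([core_count]).  For rings with more than 32 elements this
    works if the nilradical has at least three elements, if it has two elements
    and some residue field has at least three, and, for products of fields, if
    some factor has at least five elements or two factors have at least three.
    A single large field is treated greedily ([card_field]), and a factor with
    four elements together with a multiplier other than one directly
    ([card_residue4]).  In the remaining rings with more than 32 elements all
    components of the graph are subgraphs of the cube or of the complete
    bipartite graph on three and three vertices minus an edge; disjoint copies
    of these are drawn in the plane with straight edges
    ([embeds_in_of_drawing]), so that the crosscap number is zero.

    Finally, a ring of bounded cardinality is determined up to isomorphism by
    its tables of addition and multiplication, of which there are finitely many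
    ([finitely_many_rings]). *)

Import Order.TTheory GRing.Theory Num.Theory.
Import numFieldNormedType.Exports.

Set Implicit Arguments.
Unset Strict Implicit.
Unset Printing Implicit Defensive.

Local Open Scope classical_set_scope.
Local Open Scope ring_scope.

(** * Crossing parity of plane segments *)

Section PlaneCrossing.
Variable K : realFieldType.
Implicit Types (p q r u v w : K * K) (s t : (K * K) * (K * K)).

Definition lexle p q := (p.1 < q.1) || ((p.1 == q.1) && (p.2 <= q.2)).

Definition orient p q r :=
  (q.1 - p.1) * (r.2 - p.2) - (q.2 - p.2) * (r.1 - p.1).

Definition lerp s (a : K) : K * K :=
  (s.1.1 + a * (s.2.1 - s.1.1), s.1.2 + a * (s.2.2 - s.1.2)).

Definition flip s := (s.2, s.1).

Definition covers w s := lexle s.1 w (+) lexle s.2 w.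

Definition below w s :=
  if lexle s.1 s.2 then orient s.1 s.2 w < 0 else orient s.2 s.1 w < 0.

(** Whether the upward vertical ray from [w] meets [s], after an
    infinitesimal rotation that makes all abscissas distinct. *)
Definition raycross w s := covers w s && below w s.

(** The boundary of the vertical strip above [s] consists of [s] and of the
    rays above its ends, so [t] crosses [s] as often, modulo 2, as its ends
    lie above [s], plus the number of crossings of [t] with those rays.  Taking
    this as the definition makes the parity add up to a function of the ends
    alone when [s] and [t] run through two polygonal lines. *)
Definition crossing s t :=
  raycross s.1 t (+) raycross s.2 t
  (+) (raycross t.1 s (+) covers t.1 s) (+) (raycross t.2 s (+) covers t.2 s).

Lemma lexle_refl p : lexle p p.
Proof. by rewrite /lexle eqxx lexx orbT. Qed.

Lemma lexle_total p q : lexle p q || lexle q p.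
Proof.
by rewrite /lexle; case: ltgtP => //= _; exact: le_total.
Qed.

Lemma lexle_trans : transitive lexle.
Proof.
move=> q p r; rewrite /lexle => /orP[h1|/andP[/eqP-> h1]] /orP[h2|/andP[/eqP<- h2]].
- by rewrite (lt_trans h1 h2).
- by rewrite h1.
- by rewrite h2.
- by rewrite eqxx (le_trans h1 h2) orbT.
Qed.

Lemma lexle_anti p q : lexle p q -> lexle q p -> p = q.
Proof.
case: p q => [a b] [c d]; rewrite /lexle /=.
case: (ltgtP a c) => //= -> h1 h2; congr (_, _).
by apply/eqP; rewrite eq_le h1.
Qed.

Lemma lexle_tournament p q : p <> q -> lexle p q (+) lexle q p.
Proof.
move=> pq; have := lexle_total p q; case: (boolP (lexle p q)) => //= h _.
by apply/negP => /(lexle_anti h).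
Qed.

Lemma raycross_flip w s : raycross w (flip s) = raycross w s.
Proof.
have [e|/eqP ne] := eqVneq s.1 s.2; first by rewrite /raycross /covers /= e !addbb.
rewrite /raycross /covers /below /= [X in X && _]addbC; congr (_ && _).
by have := lexle_tournament ne; case: (lexle s.1 s.2); case: (lexle s.2 s.1).
Qed.

Lemma covers_flip w s : covers w (flip s) = covers w s.
Proof. exact: addbC. Qed.

Lemma crossing_flipl s t : crossing (flip s) t = crossing s t.
Proof. by rewrite /crossing !raycross_flip !covers_flip [raycross (flip s).1 t (+) _]addbC. Qed.

Lemma crossing_flipr s t : crossing s (flip t) = crossing s t.
Proof. by rewrite /crossing !raycross_flip addbAC. Qed.

(** The difference of both sides only compares the four ends with each other. *)
Lemma crossingC s t :
  s.1 <> t.1 -> s.1 <> t.2 -> s.2 <> t.1 -> s.2 <> t.2 ->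
  crossing s t = crossing t s.
Proof.
move=> /lexle_tournament h1 /lexle_tournament h2 /lexle_tournament h3 /lexle_tournament h4.
rewrite /crossing /covers; move: h1 h2 h3 h4.
move: (raycross s.1 t) (raycross s.2 t) (raycross t.1 s) (raycross t.2 s).
by do 4!case; do 4![case: (lexle _ _); case: (lexle _ _)].
Qed.

Lemma lerp0 s : lerp s 0 = s.1.
Proof. by rewrite /lerp !mul0r !addr0 -surjective_pairing. Qed.

Lemma lerp1 s : lerp s 1 = s.2.
Proof. by rewrite /lerp !mul1r !subrKC -surjective_pairing. Qed.

Lemma lerp_flip s a : lerp (flip s) a = lerp s (1 - a).
Proof. by rewrite /lerp /=; congr (_, _); ring. Qed.

Definition disjoint_segments s t :=
  forall a b, 0 <= a <= 1 -> 0 <= b <= 1 -> lerp s a <> lerp t b.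

Lemma disjoint_segments_flipl s t :
  disjoint_segments s t -> disjoint_segments (flip s) t.
Proof. by move=> h a b ha hb; rewrite lerp_flip; apply: h => //; lra. Qed.

Lemma disjoint_segmentsC s t : disjoint_segments s t -> disjoint_segments t s.
Proof. by move=> h a b ha hb e; exact: (h b a hb ha (esym e)). Qed.

Lemma collinear_between p q r :
  lexle p r -> lexle r q -> p <> q -> orient p q r = 0 ->
  exists2 a, 0 <= a <= 1 & lerp (p, q) a = r.
Proof.
case: p q r => [p1 p2] [q1 q2] [r1 r2]; rewrite /lexle /orient /lerp /=.
move=> hpr hrq ne e.
have h1 : p1 <= r1 by case/orP: hpr => [/ltW//|/andP[/eqP->]].
have h2 : r1 <= q1 by case/orP: hrq => [/ltW//|/andP[/eqP->]].
have [lt|ge] := ltP p1 q1.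
  exists ((r1 - p1) / (q1 - p1)).
    by rewrite divr_ge0 ?subr_ge0 ?ler_pdivrMr ?subr_gt0 ?mul1r ?lerB //= (le_trans h1).
  congr (_, _); first by field; lra.
  apply: (mulIf (x := q1 - p1)); first by lra.
  have -> : (p2 + (r1 - p1) / (q1 - p1) * (q2 - p2)) * (q1 - p1)
    = p2 * (q1 - p1) + (r1 - p1) * (q2 - p2) by field; lra.
  by lra.
have ? : p1 = r1 by lra. have ? : r1 = q1 by lra. subst.
rewrite ltxx eqxx /= in hpr hrq.
have lt : p2 < q2.
  by rewrite lt_neqAle (le_trans hpr hrq) andbT; apply/eqP => E; apply: ne; rewrite E.
exists ((r2 - p2) / (q2 - p2)).
  by rewrite divr_ge0 ?subr_ge0 ?ler_pdivrMr ?subr_gt0 ?mul1r ?lerB // ltW.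
by congr (_, _); [ring|field; lra].
Qed.

(** If the ends of [t] lie weakly on both sides of the line of [s], that line
    meets [t], and lexicographic convexity puts the meeting point on [s]. *)
Lemma nested_meet s t :
  lexle s.1 t.1 -> lexle t.1 t.2 -> lexle t.2 s.2 -> s.1 <> s.2 ->
  orient s.1 s.2 t.1 * orient s.1 s.2 t.2 <= 0 -> ~ disjoint_segments s t.
Proof.
move=> h1 h2 h3 ne le D.
have on x : lexle s.1 x -> lexle x s.2 -> orient s.1 s.2 x = 0 ->
    (exists2 b, 0 <= b <= 1 & lerp t b = x) -> False.
  move=> l1 l2 ox [b hb eb]; have [a ha ea] := collinear_between l1 l2 ne ox.
  by apply: (D a b ha hb); rewrite eb -ea -surjective_pairing.
set A := orient _ _ t.1 in le; set B := orient _ _ t.2 in le.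
have [A0|A0] := eqVneq A 0.
  apply: (on t.1) => //; first exact: (lexle_trans h2).
  by exists 0; rewrite ?lerp0 // lexx ler01.
have AB : A - B != 0.
  apply/eqP => /subr0_eq E; move/eqP: A0; apply; apply/eqP.
  by rewrite -sqrf_eq0 eq_le sqr_ge0 expr2 {2}E le.
have hb : 0 <= A / (A - B) <= 1.
  clear -le AB A0; clearbody A B.
  have [P|N] := ltP 0 (A - B).
    by rewrite ler_pdivlMr // ler_pdivrMr // mul0r mul1r; apply/andP; split; nra.
  have N' : 0 < B - A by rewrite lt_neqAle; apply/andP; split; [rewrite eq_sym subr_eq0 eq_sym -subr_eq0|lra].
  have -> : A / (A - B) = - A / (B - A) by field; rewrite AB /=; lra.
  by rewrite ler_pdivlMr // ler_pdivrMr // mul0r mul1r; apply/andP; split; nra.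
have mono b : 0 <= b <= 1 -> lexle t.1 (lerp t b) && lexle (lerp t b) t.2.
  move=> hb'; move: h2; rewrite /lexle /lerp /=.
  case/orP => [lt|/andP[/eqP e le2]].
    have [->|b0] := eqVneq b 0; first by rewrite !mul0r !addr0 eqxx lexx lt orbT.
    have [->|b1] := eqVneq b 1; first by rewrite !mul1r !subrKC eqxx lexx lt orbT.
    have : 0 < b < 1 by move: hb'; rewrite le_eqVlt eq_sym (negbTE b0) le_eqVlt (negbTE b1).
    by move=> ?; apply/andP; split; apply/orP; left; nra.
  by rewrite e subrr mulr0 addr0 eqxx ltxx /=; apply/andP; split; nra.
have /andP[m1 m2] := mono _ hb.
apply: (on (lerp t (A / (A - B)))).
- exact: (lexle_trans h1).
- exact: (lexle_trans m2).
- have -> : orient s.1 s.2 (lerp t (A / (A - B)))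
      = A + A / (A - B) * (B - A) by rewrite /A /B /orient /lerp /=; ring.
  by field.
- by exists (A / (A - B)).
Qed.

Lemma same_sign_fractions (al ga mu : K) : 0 <= ga * al ->
  (0 <= al -> 0 <= ga -> 0 <= mu) -> (al <= 0 -> ga <= 0 -> mu <= 0) ->
  let d := al + mu + ga in
  (d = 0 /\ al = 0) \/
  [/\ d != 0, 0 <= (al + mu) / d <= 1 & 0 <= al / d <= 1].
Proof.
move=> sg mp mn d.
have same : [/\ 0 <= al, 0 <= ga & 0 <= mu] \/ [/\ al <= 0, ga <= 0 & mu <= 0].
  have [Pa|Na] := leP 0 al; have [Pg|Ng] := leP 0 ga.
  - by left; split=> //; exact: mp.
  - have A0 : al = 0 by nra.
    by right; split; [lra|lra|apply: mn; lra].
  - have G0 : ga = 0 by nra.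
    by right; split; [lra|lra|apply: mn; lra].
  - by right; split; [lra|lra|apply: mn; lra].
have rg x y : d = x + y -> d != 0 -> (0 <= x /\ 0 <= y) \/ (x <= 0 /\ y <= 0) ->
    0 <= x / d <= 1.
  move: d => d' dxy d0 [[hx hy]|[hx hy]].
    have dp : 0 < d' by rewrite lt_neqAle eq_sym d0 /= dxy addr_ge0.
    by rewrite ler_pdivlMr // ler_pdivrMr // mul0r mul1r hx dxy lerDl.
  have dn : 0 < - d' by rewrite oppr_gt0 lt_neqAle d0 /= dxy; lra.
  have -> : x / d' = (- x) / (- d') by rewrite invrN mulrNN.
  rewrite ler_pdivlMr // ler_pdivrMr // mul0r mul1r oppr_ge0 hx lerN2 dxy.
  by rewrite gerDl.
have [d0|d0] := eqVneq d 0; [left|right].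
  by split=> //; move: d0; rewrite /d; case: same => -[? ? ?]; lra.
split=> //.
- by apply: (rg _ ga) => //; case: same => -[? ? ?]; [left|right]; split=> //; lra.
- apply: (rg _ (mu + ga)) => //; first by rewrite /d addrA.
  by case: same => -[? ? ?]; [left|right]; split=> //; lra.
Qed.

(** Write the four points in lexicographic order as p, p + a, p + a + b and
    p + a + b + c: all slopes are finite after an infinitesimal rotation, and
    the slopes of a, b, c are monotonic, so the two diagonals meet. *)
Lemma interleaved_meet s t :
  lexle s.1 t.1 -> lexle t.1 s.2 -> lexle s.2 t.2 ->
  s.1 <> t.1 -> t.1 <> s.2 -> s.2 <> t.2 ->
  0 <= orient t.1 t.2 s.2 * orient s.1 s.2 t.1 -> ~ disjoint_segments s t.
Proof.
case: s t => [p p'] [q q'] /= h1 h2 h3 n1 n2 n3 sg D.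
have np : p <> p' by move=> E; apply: n1; apply: lexle_anti => //; rewrite E.
pose a := (q.1 - p.1, q.2 - p.2); pose b := (p'.1 - q.1, p'.2 - q.2).
pose c := (q'.1 - p'.1, q'.2 - p'.2).
have pos (x y : K * K) : lexle x y -> x <> y ->
    (0 < y.1 - x.1) \/ (y.1 - x.1 = 0 /\ 0 < y.2 - x.2).
  case: x y => [x1 x2] [y1 y2]; rewrite /lexle /= => /orP[?|/andP[/eqP -> le]] ne.
    by left; lra.
  right; split; first by ring.
  by rewrite subr_gt0 lt_neqAle le andbT; apply/eqP => E; apply: ne; rewrite E.
have pa : (0 < a.1) \/ (a.1 = 0 /\ 0 < a.2) := pos _ _ h1 n1.
have pb : (0 < b.1) \/ (b.1 = 0 /\ 0 < b.2) := pos _ _ h2 n2.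
have pc : (0 < c.1) \/ (c.1 = 0 /\ 0 < c.2) := pos _ _ h3 n3.
pose al := a.1 * b.2 - a.2 * b.1; pose ga := b.1 * c.2 - b.2 * c.1.
pose mu := a.1 * c.2 - a.2 * c.1.
have ea : orient p p' q = - al by rewrite /orient /al /a /b /=; ring.
have eg : orient q q' p' = - ga by rewrite /orient /ga /b /c /=; ring.
have pl1 : al * c.1 + ga * a.1 = mu * b.1 by rewrite /al /ga /mu; ring.
have {}sg : 0 <= ga * al by move: sg; rewrite ea eg; nra.
have a1 : 0 <= a.1 by case: pa => [/ltW|[->]].
have c1 : 0 <= c.1 by case: pc => [/ltW|[->]].
have muP : (0 <= al -> 0 <= ga -> 0 <= mu) /\ (al <= 0 -> ga <= 0 -> mu <= 0).
  case: pb => [b1|[b1 b2]].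
    split=> ? ?.
      have : 0 <= mu * b.1 by rewrite -pl1 addr_ge0 ?mulr_ge0.
      by rewrite pmulr_lge0.
    have : mu * b.1 <= 0 by rewrite -pl1; nra.
    by rewrite pmulr_lle0.
  rewrite /al /ga /mu b1 !mulr0 !mul0r !subr0 !sub0r.
  split=> h1' h2'.
    have c0 : c.1 = 0 by apply/eqP; rewrite eq_le c1 andbT; nra.
    case: pc => [|[_ c2]]; first by lra.
    by rewrite c0 mulr0 subr0 mulr_ge0 // ltW.
  have a0 : a.1 = 0 by apply/eqP; rewrite eq_le a1 andbT; nra.
  case: pa => [|[_ a2]]; first by lra.
  by rewrite a0 mul0r sub0r; nra.
have [[_ al0]|[d0 h1' h2']] := same_sign_fractions sg muP.1 muP.2.
  have [x hx ex] := collinear_between h1 h2 np (etrans ea (etrans (congr1 -%R al0) (oppr0 _))).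
  by apply: (D x 0 hx); rewrite ?lexx ?ler01 // ex lerp0.
set d := al + mu + ga in d0 h1' h2'.
apply: (D _ _ h1' h2'); rewrite /lerp /=; congr (_, _).
  apply: (mulIf d0); rewrite !mulrDl.
  have E x y : x / d * y * d = x * y by field.
  by rewrite !E /d /al /ga /mu /a /b /c /=; ring.
apply: (mulIf d0); rewrite !mulrDl.
have E x y : x / d * y * d = x * y by field.
by rewrite !E /d /al /ga /mu /a /b /c /=; ring.
Qed.

(** Order the four ends lexicographically.  If the segments are apart, no
    vertical ray is met; if they are interleaved or nested, exactly two of the
    four terms of the crossing parity are relevant, and they differ only when
    two ends are separated in a way that forces the segments to meet. *)
Lemma crossing_disjoint s t : disjoint_segments s t -> crossing s t = false.
Proof.
have end_ne (x y : (K * K) * (K * K)) : disjoint_segments x y ->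
    [/\ x.1 <> y.1, x.1 <> y.2, x.2 <> y.1 & x.2 <> y.2].
  move=> D; rewrite -(lerp0 x) -(lerp0 y) -(lerp1 x) -(lerp1 y).
  by split; apply: D; rewrite ?lexx ?ler01.
wlog s12 : s / lexle s.1 s.2.
  move=> W; case/orP: (lexle_total s.1 s.2) => h; first exact: W.
  by move=> D; rewrite -crossing_flipl; apply: W => //; exact: disjoint_segments_flipl.
wlog t12 : t / lexle t.1 t.2.
  move=> W; case/orP: (lexle_total t.1 t.2) => h; first exact: W.
  move=> D; rewrite -crossing_flipr; apply: W => //.
  by apply: disjoint_segmentsC; apply: disjoint_segments_flipl; apply: disjoint_segmentsC.
wlog st : s t s12 t12 / lexle s.1 t.1.
  move=> W D; case/orP: (lexle_total s.1 t.1) => h; first exact: W.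
  have [? ? ? ?] := end_ne _ _ D.
  by rewrite crossingC //; apply: W => //; exact: disjoint_segmentsC.
move=> D; have [n1 n2 n3 n4] := end_ne _ _ D.
have not x y : lexle x y -> x <> y -> lexle y x = false.
  by move=> h ne; apply/negP => /(lexle_anti h).
rewrite /crossing /raycross /covers /below s12 t12 (not _ _ st n1).
rewrite (not _ _ (lexle_trans st t12) n2) st (lexle_trans st t12) /=.
case/orP: (lexle_total s.2 t.1) => h.
  rewrite h (lexle_trans h t12) (not _ _ h n3) (not _ _ (lexle_trans h t12) n4).
  by [].
have n3' : t.1 <> s.2 by move=> E; exact: n3 (esym E).
have n4' : t.2 <> s.2 by move=> E; exact: n4 (esym E).
rewrite h (not _ _ h n3') /=.
case/orP: (lexle_total t.2 s.2) => h'.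
  rewrite h' (not _ _ h' n4') /=.
  have ne : s.1 <> s.2.
    by move=> E; apply: n1; apply: lexle_anti => //; rewrite E.
  case: ltP => A; case: ltP => B //; exfalso;
    by apply: (nested_meet st t12 h' ne _ D); nra.
rewrite h' (not _ _ h' n4) /=.
case: ltP => A; case: ltP => B //; exfalso;
  by apply: (interleaved_meet st h h' n1 n3' n4 _ D); nra.
Qed.

(** The ends of the shorter diameter, with respect to the order, lie within the
    range of the longer one and on opposite sides of it by central symmetry. *)
Lemma crossing_diameters z u v :
  u.1 * v.2 - u.2 * v.1 != 0 ->
  crossing ((z.1 + u.1, z.2 + u.2), (z.1 - u.1, z.2 - u.2))
           ((z.1 + v.1, z.2 + v.2), (z.1 - v.1, z.2 - v.2)).
Proof.
pose dm (x : K * K) : (K * K) * (K * K) :=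
  ((z.1 + x.1, z.2 + x.2), (z.1 - x.1, z.2 - x.2)).
pose neg (x : K * K) := (- x.1, - x.2).
rewrite -/(dm u) -/(dm v).
have dmN x : dm (neg x) = flip (dm x) by rewrite /dm /flip /= !opprK.
pose o : K * K := (0, 0).
have tr x y : lexle (z.1 + x.1, z.2 + x.2) (z.1 + y.1, z.2 + y.2) = lexle x y.
  by rewrite /lexle /= ltrD2l lerD2l (inj_eq (addrI _)).
have e1 x : (dm x).1 = (z.1 + x.1, z.2 + x.2) by [].
have e2 x : (dm x).2 = (z.1 + (neg x).1, z.2 + (neg x).2) by [].
have NN x y : lexle (neg x) (neg y) = lexle y x.
  by rewrite /lexle /= ltrN2 lerN2 eqr_opp eq_sym.
have negK x : neg (neg x) = x by rewrite /neg /= !opprK -surjective_pairing.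
have o0 : neg o = o by rewrite /neg /= oppr0.
wlog up : u / lexle o u.
  move=> W; case/orP: (lexle_total o u) => h; first exact: W.
  move=> D; rewrite -crossing_flipl -dmN; apply: W; first by rewrite -o0 NN.
  by rewrite /= mulNr (mulNr u.2) opprK addrC subr_eq0 eq_sym -subr_eq0.
wlog vp : v / lexle o v.
  move=> W; case/orP: (lexle_total o v) => h; first exact: W.
  move=> D; rewrite -crossing_flipr -dmN; apply: W; first by rewrite -o0 NN.
  by rewrite /= !mulrN opprK addrC subr_eq0 eq_sym -subr_eq0.
move=> D.
have u0 : u <> o by move=> E; move: D; rewrite E /= !mul0r subrr eqxx.
have v0 : v <> o by move=> E; move: D; rewrite E /= !mulr0 subrr eqxx.
have uv : u <> v by move=> E; move: D; rewrite E mulrC subrr eqxx.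
have not x y : lexle x y -> x <> y -> lexle y x = false.
  by move=> h ne; apply/negP => /(lexle_anti h).
have nle x y : lexle o x -> lexle o y -> x <> o -> lexle x (neg y) = false.
  move=> hx hy nx; apply/negP => h; apply: nx; apply: lexle_anti => //.
  by apply: (lexle_trans h); rewrite -o0 NN.
have len x y : lexle o x -> lexle o y -> lexle (neg x) y.
  by move=> hx hy; apply: (lexle_trans _ hy); rewrite -o0 NN.
rewrite /crossing /raycross /covers /below !e1 !e2 !tr !NN.
rewrite !(nle _ _ up) // !(nle _ _ vp) // !len //.
have or x y : orient (z.1 + (neg x).1, z.2 + (neg x).2) (z.1 + x.1, z.2 + x.2)
   (z.1 + y.1, z.2 + y.2) = 2 * (x.1 * y.2 - x.2 * y.1).
  by rewrite /orient /=; ring.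
rewrite !or.
case/orP: (lexle_total u v) => h.
  rewrite h (not _ _ h uv) /=.
  by case: ltP => A; case: ltP => B //; exfalso; move/eqP: D => D; apply: D; lra.
rewrite h (not _ _ h (fun e => uv (esym e))) /=.
by case: ltP => A; case: ltP => B //; exfalso; move/eqP: D => D; apply: D; lra.
Qed.

End PlaneCrossing.

(** * Linear algebra over the field with two elements *)

Section MinorPacking.
Local Notation "0'" := (ord0 : 'I_3).
Local Notation "1'" := (@Ordinal 3 1 isT).
Local Notation "2'" := (@Ordinal 3 2 isT).

Lemma addbb0 (b : bool) : b + b = 0. Proof. exact: addbb. Qed.

(** Value on the 4-cycle through the rows [0], [i] and the columns [0], [j] of
    the complete bipartite graph on three and three vertices. *)
Definition cyc (M : zmodType) (F : 'I_3 -> 'I_3 -> M) i j :=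
  F i j + F i 0' + F 0' j + F 0' 0'.

(** On a 4-cycle every row and every column occurs twice. *)
Lemma cyc_split (f g : 'I_3 -> bool) i j : cyc (fun i j => f i + g j) i j = 0.
Proof. by rewrite /cyc; case: (f i); case: (f 0'); case: (g j); case: (g 0'). Qed.

Lemma cycD (F G : 'I_3 -> 'I_3 -> bool) i j :
  cyc (fun i j => F i j + G i j) i j = cyc F i j + cyc G i j.
Proof. by rewrite /cyc; ring. Qed.

Lemma eq_cyc (F G : 'I_3 -> 'I_3 -> bool) i j :
  (forall i j, F i j = G i j) -> cyc F i j = cyc G i j.
Proof. by move=> e; rewrite /cyc !e. Qed.

(** Both products of 4-cycles contain every independent pair of edges once;
    the pairs of edges that share an end cancel, up to the order of the pair
    where both edges lie in row [0]. *)
Lemma cyc_dependent_part (E : 'I_3 -> 'I_3 -> 'I_3 -> 'I_3 -> bool) :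
  (forall i j k l, i != k -> j != l -> E i j k l = 0) ->
  cyc (fun i j => cyc (E i j) 2' 2') 1' 1' +
  cyc (fun i j => cyc (E i j) 2' 1') 1' 2' =
  (E 0' 1' 0' 2' + E 0' 2' 0' 1') + (E 0' 0' 0' 1' + E 0' 1' 0' 0')
  + (E 0' 0' 0' 2' + E 0' 2' 0' 0').
Proof.
move=> E0; pose G i j k l := if (i != k) && (j != l) then 0 else E i j k l.
have EG i j k l : E i j k l = G i j k l.
  by rewrite /G; case: ifP => // /andP[]; exact: E0.
rewrite /cyc !EG /G /= !(add0r, addr0).
move: (E 0' 1' 0' 2') (E 0' 2' 0' 1') (E 0' 0' 0' 1') (E 0' 1' 0' 0')
 (E 0' 0' 0' 2') (E 0' 2' 0' 0') (E 1' 0' 2' 0') (E 1' 0' 0' 0')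
 (E 0' 0' 2' 0') (E 0' 0' 0' 0').
by do 10!case.
Qed.

Section Dot.
Variable k : nat.
Definition dot (u v : 'rV[bool]_k) : bool := \sum_i u 0 i * v 0 i.

Lemma dotC u v : dot u v = dot v u.
Proof. by apply: eq_bigr => i _; rewrite mulrC. Qed.

Lemma dotDl u u' v : dot (u + u') v = dot u v + dot u' v.
Proof. by rewrite /dot -big_split; apply: eq_bigr => i _; rewrite mxE mulrDl. Qed.

Lemma dotDr u v v' : dot u (v + v') = dot u v + dot u v'.
Proof. by rewrite !(dotC u) dotDl. Qed.

Lemma dot_cyc (F G : 'I_3 -> 'I_3 -> 'rV[bool]_k) i j l m :
  dot (cyc F i j) (cyc G l m) =
  cyc (fun i j => cyc (fun l m => dot (F i j) (G l m)) l m) i j.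
Proof. by rewrite /cyc !dotDl !dotDr. Qed.

(** Dual families are independent, so there are at most [k] such pairs. *)
Lemma dual_family_card (I : finType) (u w : I -> 'rV[bool]_k) :
  (forall a b, dot (u a) (w b) = (a == b)) -> (#|I| <= k)%N.
Proof.
move=> uw; pose A := \matrix_(a < #|I|, i < k) u (enum_val a) 0 i.
pose B := \matrix_(i < k, a < #|I|) w (enum_val a) 0 i.
have AB : A *m B = 1%:M.
  apply/matrixP => a b; rewrite !mxE (eq_bigr (fun i => u (enum_val a) 0 i * w (enum_val b) 0 i)).
    by rewrite [LHS]uw (inj_eq enum_val_inj); case: eqP.
  by move=> i _; rewrite !mxE.
by rewrite -(mxrank1 bool #|I|) -AB (leq_trans (mxrankM_maxr _ _)) // rank_leq_row.
Qed.
End Dot.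

(** The trace of an embedding into a sphere with [k] crosscaps in a planar
    drawing.  [ord] compares the drawn vertices, [ray w u v] counts the points
    of the drawn edge [uv] above the vertex [w], and [wt u v] the passages of
    [uv] through each crosscap; the left-hand side is the number of crossings of
    the drawings of [uv] and [u'v'], all counted modulo 2. *)
Definition drawing (V : eqType) (e : rel V) (k : nat)
    (ord : V -> V -> bool) (ray : V -> V -> V -> bool)
    (wt : V -> V -> 'rV[bool]_k) :=
  (forall u v, u != v -> ord u v + ord v u = 1) /\
  (forall u v u' v', e u v -> e u' v' ->
     u != u' -> u != v' -> v != u' -> v != v' ->
     ray u u' v' + ray v u' v' + ray u' u v + ray v' u v
     + ord u' u + ord u' v + ord v' u + ord v' v = dot (wt u v) (wt u' v')).

Section Packing.
Variables (V : eqType) (e : rel V) (k : nat).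
Variables (ord : V -> V -> bool) (ray : V -> V -> V -> bool).
Variable wt : V -> V -> 'rV[bool]_k.
Hypothesis D : drawing e ord ray wt.

Fixpoint pray w u p := if p is v :: p' then ray w u v + pray w v p' else 0.
Fixpoint pwt u p := if p is v :: p' then wt u v + pwt v p' else 0.

Lemma drawing_edge_path u v u' p : e u v -> path e u' p ->
  u \notin u' :: p -> v \notin u' :: p ->
  pray u u' p + pray v u' p + ray u' u v + ray (last u' p) u v
  + ord u' u + ord u' v + ord (last u' p) u + ord (last u' p) v
  = dot (wt u v) (pwt u' p).
Proof.
move=> uv; elim: p u' => [|v' p IH] u' /=.
  move=> _ _ _; rewrite /dot big1 => [|i _]; last by rewrite mxE mulr0.
  by move: (ray _ _ _) (ord _ _) (ord _ _); do 3!case.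
case/andP=> uv' /IH {}IH; rewrite !inE !negb_or => /and3P[a1 a2 a3] /and3P[b1 b2 b3].
rewrite dotDr -(D.2 _ _ _ _ uv uv') // -IH ?inE ?negb_or ?a2 ?b2 //.
set T := ray v' u v + ord v' u + ord v' v.
by rewrite -[LHS]addr0 -(addbb0 T) /T; ring.
Qed.

(** Crossings add up along paths, where the terms of inner vertices cancel. *)
Lemma drawing_paths u p u' p' : path e u p -> path e u' p' ->
  ~~ has (mem (u' :: p')) (u :: p) ->
  pray u u' p' + pray (last u p) u' p' + pray u' u p + pray (last u' p') u p
  + ord u' u + ord u' (last u p) + ord (last u' p') u
  + ord (last u' p') (last u p) = dot (pwt u p) (pwt u' p').
Proof.
move=> + pp'; elim: p u => [|v p IH] u.
  move=> _ _ /=; rewrite /dot big1 => [|i _]; last by rewrite mxE mul0r.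
  by move: (pray _ _ _) (ord _ _) (ord _ _); do 3!case.
move=> /andP[uv /IH{}IH] /norP[/= nu nvp].
have /norP[/= nv _] := nvp.
rewrite dotDl -(drawing_edge_path uv pp' nu nv) -IH //=.
set T := pray v u' p' + ord u' v + ord (last u' p') v.
by rewrite -[LHS]addr0 -(addbb0 T) /T; ring.
Qed.

(** In the family, the [a]-th member is a subdivision of the complete bipartite
    graph on three and three vertices [xv a i] and [yv a j], up to
    intersections of paths with a common end, which do no harm: only pairs of
    independent edges enter the parity argument. *)
Definition k33_packing (I : finType) (xv yv : I -> 'I_3 -> V)
    (pt : I -> 'I_3 -> 'I_3 -> seq V) :=
  (forall a i j, path e (xv a i) (pt a i j) /\ last (xv a i) (pt a i j) = yv a j)
  /\ forall a i j b i' j', (a != b) || (i != i') && (j != j') ->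
     ~~ has (mem (xv b i' :: pt b i' j')) (xv a i :: pt a i j).

Variables (I : finType) (xv yv : I -> 'I_3 -> V).
Variable pt : I -> 'I_3 -> 'I_3 -> seq V.
Hypothesis P : k33_packing xv yv pt.

Let Y a i j := pwt (xv a i) (pt a i j).
Let A1 a b i l m := pray (xv a i) (xv b l) (pt b l m)
  + ord (xv b l) (xv a i) + ord (yv b m) (xv a i).
Let A2 a b j l m := pray (yv a j) (xv b l) (pt b l m)
  + ord (xv b l) (yv a j) + ord (yv b m) (yv a j).
Let B1 a b l i j := pray (xv b l) (xv a i) (pt a i j).
Let B2 a b m i j := pray (yv b m) (xv a i) (pt a i j).
Let F a b i j l m := (A1 a b i l m + A2 a b j l m) + (B1 a b l i j + B2 a b m i j).

Let dotYF a b i j l m : (a != b) || (i != l) && (j != m) ->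
  dot (Y a i j) (Y b l m) = F a b i j l m.
Proof.
move=> h; have [p1 l1] := P.1 a i j; have [p2 l2] := P.1 b l m.
rewrite -(drawing_paths p1 p2 (P.2 _ _ _ _ _ _ h)) l1 l2 /F /A1 /A2 /B1 /B2; ring.
Qed.

Let cycF a b i j l m :
  cyc (fun i j => cyc (fun l m => F a b i j l m) l m) i j = 0.
Proof.
rewrite (@eq_cyc _ (fun i j => cyc (A1 a b i) l m + cyc (A2 a b j) l m)) /=.
  exact: cyc_split.
move=> i' j'; rewrite -(cycD (A1 a b i') (A2 a b j')) -[RHS]addr0.
rewrite -(cyc_split (fun l => B1 a b l i' j') (fun m => B2 a b m i' j') l m).
by rewrite -cycD.
Qed.

Lemma dot_cyc_packing_disjoint a b i j l m : a != b ->
  dot (cyc (Y a) i j) (cyc (Y b) l m) = 0.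
Proof.
move=> ab; rewrite dot_cyc -(cycF a b i j l m).
by apply: eq_cyc => i' j'; apply: eq_cyc => l' m'; rewrite dotYF ?ab.
Qed.

(** Non-planarity of the complete bipartite graph: if no crosscap were used,
    the left-hand side would vanish.  It counts the crossings of all pairs of
    independent edges.  The terms that depend on one of the edges only cancel
    along 4-cycles, and what remains compares the three vertices [yv a j] with
    each other: one odd contribution for each of the three pairs. *)
Lemma dot_cyc_packing_k33 a :
  dot (cyc (Y a) 1' 1') (cyc (Y a) 2' 2')
  + dot (cyc (Y a) 1' 2') (cyc (Y a) 2' 1') = 1.
Proof.
have ne u v : (u \notin [:: v]) = (u != v) by rewrite inE.
have yy j l : j != l -> ord (yv a j) (yv a l) + ord (yv a l) (yv a j) = 1.
  move=> jl; apply: D.1; have [_ l1] := P.1 a 0' j; have [_ l2] := P.1 a 1' l.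
  have := P.2 a 0' j a 1' l; rewrite eqxx jl => /(_ isT)/hasPn/(_ (yv a j)).
  rewrite -l1 mem_last => /(_ isT); apply: contra => /eqP ->.
  by rewrite -l2; exact: mem_last.
have xy i j : ord (xv a i) (yv a j) + ord (yv a j) (xv a i) = 1.
  apply: D.1.
  have [i' ii'] : exists i', i != i' by case: i => -[|m] hm; [exists 1'|exists 0'].
  have [j' jj'] : exists j', j' != j by case: j => -[|m] hm; [exists 1'|exists 0'].
  have [_ l1] := P.1 a i' j.
  have := P.2 a i j' a i' j; rewrite ii' jj' orbT => /(_ isT)/hasPn/(_ (xv a i)).
  rewrite inE eqxx => /(_ isT); apply: contra => /eqP ->.
  by rewrite -l1; exact: mem_last.
have FF j l : j != l -> F a a 0' j 0' l + F a a 0' l 0' j = 1.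
  move=> jl; move: (yy _ _ jl) (xy 0' j) (xy 0' l); rewrite /F /A1 /A2 /B1 /B2.
  move: (ord (xv a 0') (xv a 0')) (ord (yv a j) (yv a l)) (ord (yv a l) (yv a j))
    (ord (xv a 0') (yv a j)) (ord (yv a j) (xv a 0')) (ord (xv a 0') (yv a l))
    (ord (yv a l) (xv a 0')) => b1 b2 b3 b4 b5 b6 b7.
  set c1 := pray _ _ _; set c2 := pray _ _ _; set c3 := pray _ _ _; set c4 := pray _ _ _.
  move=> h1 h2 h3; have <- : b2 + b3 + (b4 + b5) + (b6 + b7) = 1 by rewrite h1 h2 h3.
  set T := b1 + c1 + c2 + c3 + c4.
  by rewrite -[RHS]addr0 -(addbb0 T) /T; ring.
pose E i j l m := dot (Y a i j) (Y a l m) + F a a i j l m.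
have := @cyc_dependent_part E.
have sum i j l m : cyc (fun i j => cyc (E i j) l m) i j = dot (cyc (Y a) i j) (cyc (Y a) l m).
  rewrite dot_cyc -[RHS]addr0 -(cycF a a i j l m) -cycD; apply: eq_cyc => i' j'.
  by rewrite -cycD; apply: eq_cyc.
rewrite !sum => -> => [|i j l m il jm]; last first.
  by rewrite /E dotYF ?il ?jm ?orbT // addbb0.
have EE j l : j != l -> E 0' j 0' l + E 0' l 0' j = 1.
  move=> jl; rewrite /E (dotC (Y a 0' l)) -(FF j l) //.
  set T := dot _ _; by rewrite -[RHS]addr0 -(addbb0 T); ring.
by rewrite !EE.
Qed.

(** In every member one of the two products of 4-cycles is odd, whereas
    4-cycles of different members cross evenly in the plane, hence have
    orthogonal crosscap vectors: together these form dual families. *)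
Theorem k33_packing_le : (#|I| <= k)%N.
Proof.
pose c a := dot (cyc (Y a) 1' 1') (cyc (Y a) 2' 2').
pose u a := if c a then cyc (Y a) 1' 1' else cyc (Y a) 1' 2'.
pose w a := if c a then cyc (Y a) 2' 2' else cyc (Y a) 2' 1'.
apply: (dual_family_card (u := u) (w := w)) => a b.
have [<-|ab] := eqVneq a b.
  rewrite /u /w; case: ifP => //; rewrite /c => h.
  by have := dot_cyc_packing_k33 a; rewrite h add0r.
by rewrite /u /w; case: ifP => _; case: ifP => _; rewrite dot_cyc_packing_disjoint.
Qed.

End Packing.
End MinorPacking.

(** * Polygonal lines in the plane with crosscaps *)

Section PolygonalLines.
Variables (K : realType) (k : nat).
Implicit Types (p q : K * K) (L : set (K * K)) (s : (K * K) * (K * K)).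

Definition sup_close (r : K) p q := `|p.1 - q.1| < r /\ `|p.2 - q.2| < r.

Definition in_box (B : K) p := `|p.1| < B /\ `|p.2| < B.

(** The complement of the box as a union of four half-planes, which unlike the
    complement itself are convex. *)
Definition same_side (B : K) p q :=
  [\/ B <= p.1 /\ B <= q.1, p.1 <= - B /\ q.1 <= - B,
      B <= p.2 /\ B <= q.2 | p.2 <= - B /\ q.2 <= - B].

(** A step of a polygonal approximation of a curve in the sphere with
    crosscaps, [L] being the set of the points of the plane that represent
    points of the curve: a passage through a crosscap, drawn as a diameter; a
    short segment; or, when the curve leaves a large box, a segment outside. *)
Definition step := (option 'I_k * ((K * K) * (K * K)))%type.

Definition admissible_step (r B : K) L (out : Prop) (t : step) : Prop :=
  match t.1 with
  | Some i => [/\ L t.2.1, L t.2.2, sqdist i t.2.1 = 1 & t.2.2 = antipode i t.2.1]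
  | None => [/\ L t.2.1, L t.2.2, `|t.2.2.1 - t.2.1.1| <= r / 4
               & `|t.2.2.2 - t.2.1.2| <= r / 4]
            \/ (out /\ same_side B t.2.1 t.2.2)
  end.

Lemma lerp_near s (d a : K) : 0 <= a <= 1 ->
  `|s.2.1 - s.1.1| <= d -> `|s.2.2 - s.1.2| <= d ->
  `|(lerp s a).1 - s.1.1| <= d /\ `|(lerp s a).2 - s.1.2| <= d.
Proof.
move=> /andP[a0 a1] h1 h2; rewrite /lerp /= !(addrC _ (a * _)) !addrK !normrM.
rewrite (ger0_norm a0); split; apply: le_trans (ler_wpM2r _ a1) _;
  by rewrite ?mul1r.
Qed.

Lemma short_segments_disjoint (r : K) s t : 0 < r ->
  `|s.2.1 - s.1.1| <= r / 4 -> `|s.2.2 - s.1.2| <= r / 4 ->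
  `|t.2.1 - t.1.1| <= r / 4 -> `|t.2.2 - t.1.2| <= r / 4 ->
  ~ sup_close r s.1 t.1 -> disjoint_segments s t.
Proof.
move=> r0 s1 s2 t1 t2 far a b ha hb E; apply: far.
have [] := lerp_near ha s1 s2; have [] := lerp_near hb t1 t2.
rewrite E; move: (lerp t b) => z.
rewrite /sup_close !ltr_norml !ler_norml.
by move=> /andP[? ?] /andP[? ?] /andP[? ?] /andP[? ?]; split; apply/andP; split; lra.
Qed.

Lemma unit_vector_le1 (a b : K) : a ^+ 2 + b ^+ 2 = 1 -> `|a| <= 1 /\ `|b| <= 1.
Proof.
move=> h; have := sqr_ge0 a; have := sqr_ge0 b => ? ?.
by split; rewrite -(ler_pXn2r (ltn0Sn 1)) ?nnegrE ?ler01 // -normrX ger0_norm ?sqr_ge0 // expr1n; lra.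
Qed.

(** A point of the diameter at distance at most [r / 4] from the exterior of
    the disc is sup_close to one end of the diameter. *)
Lemma near_end_of_diameter (r u1 u2 d1 d2 l : K) : 0 < r ->
  u1 ^+ 2 + u2 ^+ 2 = 1 -> `|d1| <= r / 4 -> `|d2| <= r / 4 ->
  0 <= l <= 1 -> 1 <= (l * u1 - d1) ^+ 2 + (l * u2 - d2) ^+ 2 ->
  `|l * u1 - d1 - u1| < r /\ `|l * u2 - d2 - u2| < r.
Proof.
move=> r0 u h1 h2 /andP[l0 l1] ge1; have [n1 n2] := unit_vector_le1 u.
have bound (x y c : K) : `|x| <= 1 -> `|y| <= c -> - (x * y) <= c.
  move=> hx hy; rewrite -mulNr; apply: le_trans (ler_norm _) _.
  rewrite normrM normrN; apply: le_trans hy; rewrite -[leRHS]mul1r.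
  by rewrite ler_wpM2r.
have b1 := bound _ _ _ n1 h1; have b2 := bound _ _ _ n2 h2.
have sq (d : K) : `|d| <= r / 4 -> d ^+ 2 <= (r / 4) ^+ 2.
  by move=> h; rewrite -[d ^+ 2]ger0_norm ?sqr_ge0 // normrX ler_pXn2r // nnegrE //; lra.
have q1 := sq _ h1; have q2 := sq _ h2.
have lr : 1 - r / 2 <= l.
  rewrite leNgt; apply/negP => lt.
  have E : (l * u1 - d1) ^+ 2 + (l * u2 - d2) ^+ 2 =
    l ^+ 2 * (u1 ^+ 2 + u2 ^+ 2) + 2 * (l * (- (u1 * d1))) + 2 * (l * (- (u2 * d2)))
     + d1 ^+ 2 + d2 ^+ 2 by ring.
  have m1 : l * (- (u1 * d1)) <= l * (r / 4) by rewrite ler_wpM2l.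
  have m2 : l * (- (u2 * d2)) <= l * (r / 4) by rewrite ler_wpM2l.
  move: ge1; rewrite E u mulr1 => ge1.
  have : 1 <= (l + r / 2) ^+ 2 - r ^+ 2 / 8.
    have -> : (l + r / 2) ^+ 2 - r ^+ 2 / 8
      = l ^+ 2 + 2 * (l * (r / 4)) + 2 * (l * (r / 4)) + (r / 4) ^+ 2 + (r / 4) ^+ 2 by field.
    lra.
  have : (l + r / 2) ^+ 2 < 1 by rewrite expr_lt1 //; lra.
  have : 0 < r ^+ 2 by rewrite exprn_gt0.
  by lra.
have fin (x d : K) : `|x| <= 1 -> `|d| <= r / 4 -> `|l * x - d - x| < r.
  move=> hx hd; have -> : l * x - d - x = - ((1 - l) * x + d) by ring.
  rewrite normrN; apply: le_lt_trans (ler_normD _ _) _; rewrite normrM.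
  rewrite ger0_norm; last lra.
  have : (1 - l) * `|x| <= r / 2 * 1 by apply: ler_pM => //; lra.
  by lra.
by split; exact: fin.
Qed.

Lemma lerp_diameter (i : nat) p b :
  lerp (p, antipode i p) b =
  ((3 * i)%:R + (1 - 2 * b) * (p.1 - (3 * i)%:R), (1 - 2 * b) * p.2).
Proof. by rewrite /lerp /antipode /= !natrM; congr (_, _); ring. Qed.

Lemma short_segment_diameter_disjoint (r : K) (i : nat) p s : 0 < r ->
  sqdist i p = 1 -> 1 <= sqdist i s.1 ->
  `|s.2.1 - s.1.1| <= r / 4 -> `|s.2.2 - s.1.2| <= r / 4 ->
  ~ sup_close r s.1 p -> ~ sup_close r s.1 (antipode i p) ->
  disjoint_segments s (p, antipode i p).
Proof.
move=> r0 hp hs s1 s2 f1 f2 a b ha hb; rewrite lerp_diameter.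
move: hp hs f1 f2; rewrite /sqdist /sup_close /antipode /= => hp hs f1 f2.
set c : K := (3 * i)%:R in hp hs f1 f2 *.
have c2 : (6 * i)%:R = 2 * c :> K by rewrite /c !natrM; ring.
rewrite c2 in f2.
have [] := lerp_near ha s1 s2; case: (lerp s a) => z1 z2 /= h1 h2 [e1 e2].
have x1 : s.1.1 - c = (1 - 2 * b) * (p.1 - c) - (z1 - s.1.1) by lra.
have x2 : s.1.2 = (1 - 2 * b) * p.2 - (z2 - s.1.2) by lra.
have [b2|b2] := leP b (1 / 2).
  apply: f1.
  have := @near_end_of_diameter r (p.1 - c) p.2 (z1 - s.1.1) (z2 - s.1.2) (1 - 2 * b).
  rewrite -x1 -x2 => /(_ r0 hp h1 h2).
  have -> : s.1.1 - c - (p.1 - c) = s.1.1 - p.1 by ring.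
  by apply; [lra|].
apply: f2.
have := @near_end_of_diameter r (- (p.1 - c)) (- p.2) (z1 - s.1.1) (z2 - s.1.2) (2 * b - 1).
have -> : (2 * b - 1) * - (p.1 - c) - (z1 - s.1.1) = s.1.1 - c by rewrite x1; ring.
have -> : (2 * b - 1) * - p.2 - (z2 - s.1.2) = s.1.2 by rewrite {2}x2; ring.
rewrite !sqrrN => /(_ r0 hp h1 h2).
have -> : s.1.1 - c - - (p.1 - c) = s.1.1 - (2 * c - p.1) by ring.
by apply; [lra|].
Qed.

Lemma diameters_disjoint (i j : nat) p q : i != j ->
  sqdist i p = 1 -> sqdist j q = 1 ->
  disjoint_segments (p, antipode i p) (q, antipode j q).
Proof.
move=> ij hp hq a b ha hb; rewrite !lerp_diameter => -[e _].
move: hp hq; rewrite /sqdist => /unit_vector_le1[hp _] /unit_vector_le1[hq _].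
have A : `|(1 - 2 * a) * (p.1 - (3 * i)%:R)| <= 1.
  rewrite normrM -[leRHS]mul1r; apply: ler_pM => //; rewrite ler_norml; apply/andP; split; lra.
have B : `|(1 - 2 * b) * (q.1 - (3 * j)%:R)| <= 1.
  rewrite normrM -[leRHS]mul1r; apply: ler_pM => //; rewrite ler_norml; apply/andP; split; lra.
move: A B e; rewrite !ler_norml; set X := (1 - 2 * a) * _; set Y := (1 - 2 * b) * _.
move=> /andP[? ?] /andP[? ?] e.
have lt (x y : nat) (X' Y' : K) : -1 <= X' -> Y' <= 1 -> (x < y)%N ->
  (3 * x)%:R + Y' = (3 * y)%:R + X' -> False.
  move=> ? ? xy; have : (x%:R + 1 <= y%:R :> K) by rewrite natr1 ler_nat.
  by rewrite !natrM; lra.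
by case: (ltngtP i j) ij => // h _; [apply: (lt i j Y X) | apply: (lt j i X Y)].
Qed.

(** Two points of the circle that are neither equal nor antipodal span
    non-parallel diameters. *)
Lemma diameters_cross (r : K) (i : nat) p q : 0 < r ->
  sqdist i p = 1 -> sqdist i q = 1 ->
  ~ sup_close r p q -> ~ sup_close r p (antipode i q) ->
  crossing (p, antipode i p) (q, antipode i q).
Proof.
move=> r0 hp hq f1 f2; pose c : K := (3 * i)%:R.
have E x : (x, antipode i x) = ((c + (x.1 - c), 0 + x.2), (c - (x.1 - c), 0 - x.2)).
  by case: x => a b; rewrite /antipode /c !natrM /=; congr ((_, _), (_, _)); ring.
rewrite (E p) (E q).
apply: (@crossing_diameters K (c, 0) (p.1 - c, p.2) (q.1 - c, q.2)) => /=.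
apply/eqP => D0; move: hp hq f1 f2; rewrite /sqdist /sup_close /antipode /= -/c => hp hq f1 f2.
have c2 : (6 * i)%:R = 2 * c :> K by rewrite /c !natrM; ring.
rewrite c2 in f2.
set u1 := p.1 - c in D0 hp; set v1 := q.1 - c in D0 hq.
have dd : (u1 * v1 + p.2 * q.2 - 1) * (u1 * v1 + p.2 * q.2 + 1) = 0.
  have -> : (u1 * v1 + p.2 * q.2 - 1) * (u1 * v1 + p.2 * q.2 + 1)
   = (u1 ^+ 2 + p.2 ^+ 2) * (v1 ^+ 2 + q.2 ^+ 2) - (u1 * q.2 - p.2 * v1) ^+ 2 - 1 by ring.
  by rewrite hp hq D0; ring.
have z (x y : K) : x ^+ 2 + y ^+ 2 = 0 -> x = 0 /\ y = 0.
  move=> h; have := sqr_ge0 x; have := sqr_ge0 y => ? ?.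
  by split; apply/eqP; rewrite -sqrf_eq0; apply/eqP; lra.
move/eqP: dd; rewrite mulf_eq0 => /orP[/eqP d|/eqP d].
  have [] : u1 - v1 = 0 /\ p.2 - q.2 = 0.
    apply: z; have -> : (u1 - v1) ^+ 2 + (p.2 - q.2) ^+ 2 =
      (u1 ^+ 2 + p.2 ^+ 2) + (v1 ^+ 2 + q.2 ^+ 2) - 2 * (u1 * v1 + p.2 * q.2 - 1) - 2 by ring.
    by rewrite hp hq d; ring.
  move=> a b; apply: f1; have -> : p.1 - q.1 = 0 by rewrite /u1 /v1 in a; lra.
  by rewrite b normr0.
have [] : u1 + v1 = 0 /\ p.2 + q.2 = 0.
  apply: z; have -> : (u1 + v1) ^+ 2 + (p.2 + q.2) ^+ 2 =
    (u1 ^+ 2 + p.2 ^+ 2) + (v1 ^+ 2 + q.2 ^+ 2) + 2 * (u1 * v1 + p.2 * q.2 + 1) - 2 by ring.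
  by rewrite hp hq d; ring.
move=> a b; apply: f2; have -> : p.1 - (2 * c - q.1) = 0 by rewrite /u1 /v1 in a; lra.
by rewrite opprK b normr0.
Qed.

Lemma box_same_side_disjoint (B : K) s t :
  in_box B s.1 -> in_box B s.2 -> same_side B t.1 t.2 -> disjoint_segments s t.
Proof.
rewrite /in_box !ltr_norml => -[/andP[? ?] /andP[? ?]] [/andP[? ?] /andP[? ?]].
move=> side a b /andP[a0 a1] /andP[b0 b1] [].
have hi (x y c : K) : 0 <= c -> c <= 1 -> B <= x -> B <= y -> B <= x + c * (y - x).
  move=> c0 c1 hx hy; have -> : x + c * (y - x) = (1 - c) * x + c * y by ring.
  have : (1 - c) * B <= (1 - c) * x by rewrite ler_wpM2l //; lra.
  have : c * B <= c * y by rewrite ler_wpM2l //; lra.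
  by lra.
have lo (x y c : K) : 0 <= c -> c <= 1 -> x <= - B -> y <= - B -> x + c * (y - x) <= - B.
  move=> c0 c1 hx hy; have := hi (- x) (- y) c c0 c1.
  have -> : - x + c * (- y - - x) = - (x + c * (y - x)) by ring.
  by move=> h; rewrite lerNr; apply: h; lra.
have hi' (x y c : K) : 0 <= c -> c <= 1 -> x < B -> y < B -> x + c * (y - x) < B.
  move=> c0 c1 hx hy; have -> : x + c * (y - x) = (1 - c) * x + c * y by ring.
  have [->|cn] := eqVneq c 0; first by lra.
  have : (1 - c) * x <= (1 - c) * B by rewrite ler_wpM2l //; lra.
  have : c * y < c * B by rewrite ltr_pM2l //; lra.
  by lra.
have lo' (x y c : K) : 0 <= c -> c <= 1 -> - B < x -> - B < y -> - B < x + c * (y - x).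
  move=> c0 c1 hx hy; have := hi' (- x) (- y) c c0 c1.
  have -> : - x + c * (- y - - x) = - (x + c * (y - x)) by ring.
  by move=> h; rewrite ltrNl; apply: h; lra.
move=> e1 e2.
have := hi' s.1.1 s.2.1 a a0 a1; have := hi' s.1.2 s.2.2 a a0 a1.
have := lo' s.1.1 s.2.1 a a0 a1; have := lo' s.1.2 s.2.2 a a0 a1.
rewrite e1 e2 => H1 H2 H3 H4.
case: side => -[y1 y2].
- have := hi t.1.1 t.2.1 b b0 b1 y1 y2; lra.
- have := lo t.1.1 t.2.1 b b0 b1 y1 y2; lra.
- have := hi t.1.2 t.2.2 b b0 b1 y1 y2; lra.
- have := lo t.1.2 t.2.2 b b0 b1 y1 y2; lra.
Qed.

(** What is needed of two disjoint curves, given by the points of the plane that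
    represent them: at scale [r] they are apart, also across crosscaps, and at
    most one of them leaves the box. *)
Record separated (r B : K) L L' (out out' : Prop) : Prop := Separated {
  sep_pos : 0 < r;
  sep_outside : forall p, L p -> forall i : 'I_k, 1 <= sqdist i p;
  sep_outside' : forall p, L' p -> forall i : 'I_k, 1 <= sqdist i p;
  sep_far : forall p q, L p -> L' q -> ~ sup_close r p q;
  sep_box : ~ out -> forall p, L p -> in_box B p;
  sep_box' : ~ out' -> forall p, L' p -> in_box B p;
  sep_out : ~ (out /\ out') }.

Lemma sup_closeC r p q : sup_close r p q -> sup_close r q p.
Proof. by rewrite /sup_close (distrC q.1) (distrC q.2). Qed.

Lemma separatedC r B L L' out out' :
  separated r B L L' out out' -> separated r B L' L out' out.
Proof.
case=> r0 o o' far b b' no; split=> //; last by case=> ? ?; exact: no.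
by move=> p q hp hq /sup_closeC; exact: far.
Qed.

Definition same_crosscap (t t' : step) : bool :=
  if t.1 is Some i then t'.1 == Some i else false.

(** At scale [r] the only crossings of the approximations of disjoint curves are
    those of two diameters of the same disc, which replace two passages through
    the same crosscap. *)
Lemma admissible_step_crossing r B L L' out out' (t t' : step) :
  separated r B L L' out out' ->
  admissible_step r B L out t -> admissible_step r B L' out' t' ->
  crossing t.2 t'.2 = same_crosscap t t'.
Proof.
move=> S.
have outer L1 L2 o1 o2 (t1 t2 : step) : separated r B L1 L2 o1 o2 -> o2 ->
    same_side B t2.2.1 t2.2.2 -> admissible_step r B L1 o1 t1 ->
    disjoint_segments t1.2 t2.2.
  move=> S' o2T side; have no1 : ~ o1 by move=> ?; exact: sep_out S' (conj _ _).
  rewrite /admissible_step; case: (t1.1) => [i [l1 l2 _ _]|].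
    by apply: (box_same_side_disjoint _ _ side); exact: sep_box S' no1 _ _.
  case=> [[l1 l2 _ _] | [/no1 [] ] ].
  by apply: (box_same_side_disjoint _ _ side); exact: sep_box S' no1 _ _.
have r0 := sep_pos S.
case: t t' => [[i|] [p p']] [[j|] [q q']] ad ad'.
- have [/= l1 l1' d e] := ad; have [/= l2 l2' d' e'] := ad'; subst p' q'.
  rewrite /same_crosscap /=; have [ji|ne] := eqVneq (Some j) (Some i).
    case: ji d' l2' => -> d' l2'.
    by apply: (diameters_cross r0 d d'); exact: sep_far S _ _ _ _.
  apply: crossing_disjoint; apply: diameters_disjoint => //.
  by apply: contra ne => /eqP/val_inj ->.
- have [/= l1 l1' d e] := ad; subst p'.
  apply: crossing_disjoint; have := ad'; rewrite /admissible_step /= => -[[l2 l2' h1 h2] | [out_ side]].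
    apply: disjoint_segmentsC; apply: (short_segment_diameter_disjoint r0) => //=.
    + exact: sep_outside' S _ l2 i.
    + by move/sup_closeC; exact: sep_far S _ _ _ _.
    + by move/sup_closeC; exact: sep_far S _ _ _ _.
  exact: (outer _ _ _ _ _ (None, (q, q')) S out_ side ad).
- have [/= l2 l2' d e] := ad'; subst q'.
  apply: crossing_disjoint; have := ad; rewrite /admissible_step /= => -[[l1 l1' h1 h2] | [out_ side]].
    apply: (short_segment_diameter_disjoint r0) => //=.
    + exact: sep_outside S _ l1 j.
    + exact: sep_far S _ _ _ _.
    + exact: sep_far S _ _ _ _.
  apply: disjoint_segmentsC.
  exact: (outer _ _ _ _ _ (None, (p, p')) (separatedC S) out_ side ad').
- apply: crossing_disjoint.
  have := ad; rewrite /admissible_step /= => -[[l1 l1' h1 h2] | [out_ side]]; last first.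
    apply: disjoint_segmentsC.
    exact: (outer _ _ _ _ _ (None, (p, p')) (separatedC S) out_ side ad').
  have := ad'; rewrite /admissible_step /= => -[[l2 l2' h1' h2'] | [out_ side]]; last first.
    exact: (outer _ _ _ _ _ (None, (q, q')) S out_ side ad).
  by apply: (short_segments_disjoint r0) => //=; exact: sep_far S _ _ _ _.
Qed.

Fixpoint linked p (c : seq step) q : Prop :=
  if c is t :: c' then t.2.1 = p /\ linked t.2.2 c' q else p = q.

Definition admissible_line r B L out (c : seq step) :=
  forall t, List.In t c -> admissible_step r B L out t.

Lemma linked_cat p c q c' p' : linked p c q -> linked q c' p' -> linked p (c ++ c') p'.
Proof. by elim: c p => [|t c IH] p /= => [->//|[-> h] h']; split=> //; exact: IH. Qed.

Lemma admissible_line_cat r B L out c c' :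
  admissible_line r B L out c -> admissible_line r B L out c' ->
  admissible_line r B L out (c ++ c').
Proof. by move=> h h' t /(List.in_app_or c c' t)[]; [exact: h|exact: h']. Qed.

Definition line_ray p (c : seq step) : bool := \sum_(t <- c) raycross p t.2.
Definition line_wt (c : seq step) : 'rV[bool]_k :=
  \row_i \sum_(t <- c) (t.1 == Some i).

Lemma sum_same_crosscap c c' :
  \sum_(t <- c) \sum_(t' <- c') same_crosscap t t' = dot (line_wt c) (line_wt c').
Proof.
rewrite /dot; under [RHS]eq_bigr => i _ do rewrite !mxE big_distrlr /=.
rewrite [RHS]exchange_big /=; apply: eq_bigr => t _.
rewrite [RHS]exchange_big /=; apply: eq_bigr => t' _.
rewrite /same_crosscap; case: (t.1) => [i|]; last by rewrite big1 // => i _; rewrite mul0r.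
rewrite (bigD1 i) //= eqxx mul1r big1 ?addr0 // => j ji.
by have /negbTE-> : Some i != Some j by apply: contra ji => /eqP[->].
Qed.

Lemma sum_covers p c q w : linked p c q ->
  \sum_(t <- c) covers w t.2 = lexle p w + lexle q w.
Proof.
elim: c p => [|t c IH] p /= => [->|[<- h]]; first by rewrite big_nil addbb0.
rewrite big_cons (IH _ h) /covers.
by case: (lexle _ w); case: (lexle _ w); case: (lexle _ w).
Qed.

Lemma sum_ends p c q (F : K * K -> bool) : linked p c q ->
  \sum_(t <- c) (F t.2.1 + F t.2.2) = F p + F q.
Proof.
elim: c p => [|t c IH] p /= => [->|[<- h]]; first by rewrite big_nil addbb0.
by rewrite big_cons (IH _ h); case: (F _); case: (F _); case: (F _).
Qed.

(** Summing the crossings of all pairs of steps: by definition of the crossing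
    parity the left-hand side telescopes. *)
Lemma separated_lines r B L L' out out' p c q p' c' q' :
  separated r B L L' out out' ->
  linked p c q -> admissible_line r B L out c ->
  linked p' c' q' -> admissible_line r B L' out' c' ->
  line_ray p c' + line_ray q c' + line_ray p' c + line_ray q' c
  + lexle p p' + lexle q p' + lexle p q' + lexle q q'
  = dot (line_wt c) (line_wt c').
Proof.
move=> S l a l' a'.
have in_sum (d : seq step) (F G : step -> bool) :
    (forall t, List.In t d -> F t = G t) -> \sum_(t <- d) F t = \sum_(t <- d) G t.
  elim: d => [|t d IH] h; first by rewrite !big_nil.
  by rewrite !big_cons (h t) ?IH //; [move=> ? ?; apply: h; right|left].
rewrite -sum_same_crosscap.
rewrite -(@in_sum c (fun t => \sum_(t' <- c') crossing t.2 t'.2)); last first.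
  move=> t tc; apply: in_sum => t' tc'.
  exact: (admissible_step_crossing S (a _ tc) (a' _ tc')).
have E (t t' : step) : crossing t.2 t'.2 = (raycross t.2.1 t'.2 + raycross t.2.2 t'.2)
   + ((raycross t'.2.1 t.2 + covers t'.2.1 t.2) + (raycross t'.2.2 t.2 + covers t'.2.2 t.2)).
  by rewrite /crossing -addbA.
under [RHS]eq_bigr => t _.
  under eq_bigr => t' _ do rewrite E.
  rewrite big_split /= (sum_ends (fun w => raycross w t.2 + covers w t.2) l').
  rewrite big_split /=.
  over.
rewrite big_split /=.
have -> : \sum_(t <- c) (\sum_(t' <- c') raycross t.2.1 t'.2 +
   \sum_(t' <- c') raycross t.2.2 t'.2) = line_ray p c' + line_ray q c'.
  exact: (sum_ends (line_ray^~ c') l).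
have S2 w : \sum_(t <- c) (raycross w t.2 + covers w t.2) =
    line_ray w c + (lexle p w + lexle q w).
  by rewrite big_split /= (sum_covers _ l).
by rewrite big_split /= !S2; ring.
Qed.

End PolygonalLines.

(** * The sphere with crosscaps seen from the plane *)

Section Lifts.
Variables (K : realType) (k : nat).
Local Notation M := (sphere_with_crosscaps K k).
Local Notation H := (holed_sphere (K := K) k).
Implicit Types (p q : K * K) (m : M) (x y : H).

Let toM (x : H) : M := (\pi_M x)%qT.

Definition lifts m p := exists2 x : H, toM x = m & set_val x = Some p.
Definition at_infinity m := exists2 x : H, toM x = m & set_val x = None.

Let toM_eq x y : toM x = toM y <-> glued x y.
Proof.
suff : (\pi_({eq_quot (glued_equiv K k)}) x = \pi y)%qT <-> glued x y by [].
by split=> [/eqmodP/asboolP//|h]; apply/eqmodP/asboolP.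
Qed.

Lemma lifts_or_infinity m : (exists p, lifts m p) \/ at_infinity m.
Proof.
pose x : H := repr m; have mx : toM x = m by exact: reprK.
by case e : (set_val x) => [p|]; [left; exists p; exists x|right; exists x].
Qed.

Lemma lifts_outside m p : lifts m p -> forall i : 'I_k, 1 <= sqdist i p.
Proof. by move=> [x _ xp] i; exact: (set_valP x i p xp). Qed.

Lemma lifts_not_infinity m p : lifts m p -> ~ at_infinity m.
Proof.
move=> [x <- xp] [y /toM_eq[e|[i [q [_ yq _]]]] yn].
  by rewrite -e yn in xp.
by rewrite yn in yq.
Qed.

Lemma lifts_eq m p q : lifts m p -> lifts m q ->
  p = q \/ exists i : 'I_k, sqdist i p = 1 /\ q = antipode i p.
Proof.
move=> [x <- xp] [y /esym/toM_eq[e|[i [r [hr xr yr]]]] yq].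
  by left; move: yq; rewrite -e xp => -[].
by move: xr yr hr; rewrite xp yq => -[<-] [->] hr; right; exists i.
Qed.

Lemma lifts_inj m m' p : lifts m p -> lifts m' p -> m = m'.
Proof.
by move=> [x <- xp] [y <- yp]; congr toM; apply: val_inj; rewrite -!set_valE xp yp.
Qed.

Lemma lifts_antipode m p (i : 'I_k) : lifts m p -> sqdist i p = 1 ->
  lifts m (antipode i p).
Proof.
move=> [x xm xp] hp.
have A : holed_sphere k (Some (antipode i p) : sphere K).
  move=> j q [<-]; have [->|ij] := eqVneq j i; first by rewrite sqdist_antipode hp.
  have : sqdist i (antipode i p) = 1 by rewrite sqdist_antipode.
  move: (antipode i p) => [a b]; rewrite /sqdist /= => /unit_vector_le1[h _].
  move: h; rewrite ler_norml => /andP[h1 h2].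
  have D : 1 <= `|a - (3 * j)%:R|.
    have lt (u v : nat) : (u < v)%N -> (3 * u)%:R + 3 <= (3 * v)%:R :> K.
      by move=> uv; rewrite -natrD ler_nat; lia.
    rewrite ler_normr; case: (ltngtP i j) => [/lt ?|/lt ?|e].
    - by apply/orP; right; lra.
    - by apply/orP; left; lra.
    - by case/eqP: ij; apply: val_inj.
  have := sqr_ge0 b; have : 1 <= (a - (3 * j)%:R) ^+ 2.
    by rewrite -[leRHS]ger0_norm ?sqr_ge0 // normrX; exact: exprn_ege1.
  by lra.
pose y : H := exist _ (Some (antipode i p)) (mem_set A).
by exists y => //; rewrite -xm; apply/toM_eq; right; exists i, (antipode i p); rewrite sqdist_antipode antipodeK.
Qed.

Let open_toM (U : set M) (A : set (sphere K)) : open A ->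
  (forall x, U (toM x) <-> A (set_val x)) -> open U.
Proof.
move=> oA UA; suff E : toM @^-1` U = set_val @^-1` A.
  suff : open (toM @^-1` U) by [].
  by rewrite E; exists A.
by apply/seteqP; split=> x /= /UA.
Qed.

Lemma sqdist_cvg (i : nat) p : sqdist i q @[q --> p] --> sqdist i p.
Proof.
apply: cvgD; rewrite !expr2; apply: cvgM.
- by apply: cvgB; [exact: cvg_fst|exact: cvg_cst].
- by apply: cvgB; [exact: cvg_fst|exact: cvg_cst].
- exact: cvg_snd.
- exact: cvg_snd.
Qed.

Lemma sup_close_near (rho : K) p q : sup_close rho p q -> nbhs p [set p' | sup_close rho p' q].
Proof.
move=> [h1 h2]; near=> p'; split; near: p'.
  apply: (cvgr_lt (`|p.1 - q.1|)) => //; apply: cvg_norm.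
  by apply: cvgB; [exact: cvg_fst|exact: cvg_cst].
apply: (cvgr_lt (`|p.2 - q.2|)) => //; apply: cvg_norm.
by apply: cvgB; [exact: cvg_snd|exact: cvg_cst].
Unshelve. all: by end_near. Qed.

(** Only circles through a representative of [m] are met near [m], so that the
    neighbourhood is compatible with the gluing. *)
Lemma near_finite_point m (rho : K) : 0 < rho -> (exists p, lifts m p) ->
  \forall m' \near m, ~ at_infinity m' /\
    forall p', lifts m' p' -> exists2 p, lifts m p & sup_close rho p' p.
Proof.
move=> r0 [p0 mp0].
pose W : set (K * K) := [set p' | exists p, [/\ lifts m p, sup_close rho p' p &
  forall i : 'I_k, sqdist i p' = 1 -> sqdist i p = 1]].
have oW : open W.
  rewrite openE => p' [p [mp cl hi]]; rewrite /interior.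
  suff : nbhs p' [set q | sup_close rho q p /\
      forall i : 'I_k, sqdist i q = 1 -> sqdist i p = 1].
    by apply: filterS => q [? ?]; exists p.
  apply: filterI (sup_close_near cl) _.
  apply: (@filter_forall _ _ (fun (i : 'I_k) q => sqdist i q = 1 -> sqdist i p = 1)
    (nbhs p') (nbhs_filter p')).
  move=> i; have [e|/eqP ne] := eqVneq (sqdist i p) 1.
    by apply: filterE => q.
  have : sqdist i p' != 1 by apply/eqP => /hi.
  rewrite neq_lt => /orP[lt|gt].
    apply: filterS (cvgr_lt _ (@sqdist_cvg i p') _ lt) => q + e.
    by rewrite e ltxx.
  apply: filterS (cvgr_gt _ (@sqdist_cvg i p') _ gt) => q + e.
  by rewrite e ltxx.
pose U : set M := [set m' | ~ at_infinity m' /\ forall p', lifts m' p' -> W p'].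
have oU : open U.
  apply: (@open_toM U (Some @` W)) => [|x].
    exact: one_point_compactification_open_some.
  split.
    move=> [ninf h]; case e: (set_val x) => [p|]; last by case: ninf; exists x.
    by exists p => //; apply: h; exists x.
  move=> [p Wp xp]; have lp : lifts (toM x) p by exists x.
  split; first exact: lifts_not_infinity lp.
  move=> q lq; case: (lifts_eq lp lq) => [<-//|[i [hi ->]]].
  case: Wp => p1 [mp1 [c1 c2] h1].
  have e1 := h1 _ hi.
  exists (antipode i p1); split; first exact: lifts_antipode.
    have o (a b c : K) : c - a - (c - b) = - (a - b) by ring.
    by split; rewrite /antipode /= ?o -?opprD normrN.
  move=> j hj; have -> : (j = i :> nat).
    by apply: (circles_disjoint hj); rewrite sqdist_antipode.
  by rewrite sqdist_antipode.
have Um : U m.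
  split; first exact: lifts_not_infinity mp0.
  by move=> p mp; exists p; split=> //; rewrite /sup_close !subrr normr0.
have : nbhs m U by exact: open_nbhs_nbhs.
apply: filterS => m' [ninf h]; split=> // p' /h [p [? ? _]].
by exists p.
Qed.

Lemma circle_in_box (i : 'I_k) p : sqdist i p = 1 -> in_box (3 * k)%:R p.
Proof.
case: p => a b; rewrite /sqdist /in_box /= => /unit_vector_le1[].
rewrite !ler_norml !ltr_norml => /andP[? ?] /andP[? ?].
have ? : (3 * i)%:R + 3 <= (3 * k)%:R :> K by rewrite -natrD ler_nat; have := ltn_ord i; lia.
have ? : 0 <= (3 * i)%:R :> K by rewrite ler0n.
by split; apply/andP; split; lra.
Qed.

Lemma near_infinite_point m (B : K) : at_infinity m ->
  \forall m' \near m, forall p', lifts m' p' -> ~ in_box B p'.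
Proof.
move=> mi; pose B' := Num.max B (3 * k)%:R.
pose A : set (K * K) := `[- B', B'] `*` `[- B', B'].
have inA p : in_box B p \/ in_box (3 * k)%:R p -> A p.
  have le (b a : K) : b <= B' -> `|a| < b -> a \in `[- B', B'].
    rewrite ltr_norml in_itv /= => hb /andP[? ?]; apply/andP; split; lra.
  have h1 : B <= B' by rewrite le_max lexx.
  have h2 : (3 * k)%:R <= B' by rewrite le_max lexx orbT.
  by case=> -[a1 a2]; split; [exact: le h1 _|exact: le h1 _|exact: le h2 _|exact: le h2 _].
have cA : compact A by apply: compact_setX; exact: segment_compact.
have clA : closed A by apply: compact_closed => //; exact: norm_hausdorff.
pose U : set M := [set m' | forall p', lifts m' p' -> ~ A p'].
have oU : open U.
  apply: (@open_toM U (~` (Some @` A))) => [|x].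
    rewrite openE => -[p nA|_]; last first.
      by exists A => // p [[q nAq <-]|->] [r Ar] // [e]; apply: nAq; rewrite -e.
    have : nbhs p (~` A).
      apply: open_nbhs_nbhs; split; first exact: closed_openC.
      by move=> Ap; apply: nA; exists p.
    move/one_point_compactification_some_nbhs; apply: filterS => _ [q nq <-] [r Ar [e]].
    by apply: nq; rewrite -e.
  split=> [h [p Ap /esym xp]|h p lp Ap]; first by apply: (h p) => //; exists x.
  case e : (set_val x) => [q|].
    have lq : lifts (toM x) q by exists x.
    apply: h; rewrite e; case: (lifts_eq lp lq) => [<-|[i [hi ->]]]; first by exists p.
    exists (antipode i p) => //; apply: inA; right.
    by apply: (@circle_in_box i); rewrite sqdist_antipode.
  by have [] := lifts_not_infinity lp; exists x.
have Um : U m by move=> p lp; have := lifts_not_infinity lp.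
have : nbhs m U by exact: open_nbhs_nbhs.
by apply: filterS => m' h p' /h nA bx; apply: nA; apply: inA; left.
Qed.

End Lifts.

(** * From a topological embedding to a drawing *)

Section Approximation.
Variables (K : realType) (k : nat).
Local Notation M := (sphere_with_crosscaps K k).
Implicit Types (p q : K * K) (m : M).

Definition outside_box (B : K) m := forall p, lifts m p -> ~ in_box B p.

Definition far_apart (r : K) m m' :=
  (forall p q, lifts m p -> lifts m' q -> ~ sup_close r p q) /\
  ~ (outside_box r^-1 m /\ outside_box r^-1 m').

Lemma far_apartC r m m' : far_apart r m m' -> far_apart r m' m.
Proof.
by move=> [h1 h2]; split=> [p q hp hq /sup_closeC|[? ?]]; [exact: h1|exact: h2].
Qed.

Lemma in_boxW (B B' : K) p : B <= B' -> in_box B p -> in_box B' p.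
Proof. by move=> BB' [h1 h2]; split; exact: lt_le_trans BB'. Qed.

Lemma lifts_bounded m : exists2 B : K, 0 < B & forall p, lifts m p -> in_box B p.
Proof.
have [[p0 l0]|inf] := lifts_or_infinity m; last first.
  by exists 1 => // p /lifts_not_infinity.
have k0 : 0 <= (6 * k)%:R :> K by rewrite ler0n.
have n1 := normr_ge0 p0.1; have n2 := normr_ge0 p0.2.
exists ((6 * k)%:R + `|p0.1| + `|p0.2| + 1) => [|p lp]; first lra.
case: (lifts_eq l0 lp) => [<-|[i [_ ->]]]; rewrite /in_box /antipode /=; first by split; lra.
have ik : (6 * i)%:R <= (6 * k)%:R :> K by rewrite ler_nat; have := ltn_ord i; lia.
split; last by rewrite normrN; lra.
apply: le_lt_trans (ler_normB _ _) _; rewrite ger0_norm ?ler0n //; lra.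
Qed.

Lemma near0_inv_gt (B : K) : 0 < B -> \forall r \near 0^'+, B < r^-1.
Proof.
move=> B0; near=> r.
have r0 : 0 < r by near: r; exact: nbhs_right_gt.
have rB : r < B^-1 by near: r; apply: nbhs_right_lt; rewrite invr_gt0.
by rewrite -[B]invrK ltf_pV2 // posrE invr_gt0.
Unshelve. all: by end_near. Qed.

Lemma lifts_le2 m : exists p1 p2, forall p, lifts m p -> p = p1 \/ p = p2.
Proof.
have [[p0 l0]|inf] := lifts_or_infinity m; last first.
  by exists (0, 0), (0, 0) => p /lifts_not_infinity.
have [[i hi]|no] := pselect (exists i : 'I_k, sqdist i p0 = 1).
  exists p0, (antipode i p0) => p lp.
  case: (lifts_eq l0 lp) => [<-|[j [hj ->]]]; [by left|right].
  by rewrite (circles_disjoint hj hi).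
exists p0, p0 => p lp; case: (lifts_eq l0 lp) => [<-|[j [hj _]]]; first by left.
by case: no; exists j.
Qed.

Lemma distinct_points_far p q : p <> q -> \forall d \near 0^'+, ~ @sup_close K d p q.
Proof.
move=> pq; have : 0 < Num.max `|p.1 - q.1| `|p.2 - q.2|.
  rewrite lt_max !normr_gt0 !subr_eq0 -negb_and; apply/negP => /andP[/eqP e1 /eqP e2].
  by apply: pq; rewrite (surjective_pairing p) e1 e2 -surjective_pairing.
move=> d0; near=> d; move=> [h1 h2].
have : d < Num.max `|p.1 - q.1| `|p.2 - q.2| by near: d; exact: nbhs_right_lt.
by rewrite lt_max => /orP[] /lt_trans; [move/(_ _ h1)|move/(_ _ h2)]; rewrite ltxx.
Unshelve. all: by end_near. Qed.

Lemma distinct_lifts_far m m' : m <> m' -> exists2 d : K, 0 < d &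
  forall p q, lifts m p -> lifts m' q -> ~ sup_close d p q.
Proof.
move=> ne; have [p1 [p2 hp]] := lifts_le2 m; have [q1 [q2 hq]] := lifts_le2 m'.
suff : \forall d \near 0^'+, 0 < d /\
    forall p q, lifts m p -> lifts m' q -> ~ @sup_close K d p q.
  by move=> /filter_ex[d [? ?]]; exists d.
have F p q : \forall d \near 0^'+, lifts m p -> lifts m' q -> ~ @sup_close K d p q.
  have [pq|pq] := pselect (p = q); last first.
    by apply: filterS (distinct_points_far pq) => d + _ _.
  apply: filterE => d lp lq; exfalso; apply: ne; apply: (lifts_inj lp).
  by rewrite pq.
have f11 := F p1 q1; have f12 := F p1 q2; have f21 := F p2 q1; have f22 := F p2 q2.
near=> d; split; first by near: d; exact: nbhs_right_gt.
move=> p q lp lq.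
by case: (hp _ lp) (lp) => -> {}lp; case: (hq _ lq) (lq) => -> {}lq; move: lp lq; near: d.
Unshelve. all: by end_near. Qed.

(** Near the point at infinity all representatives are outside a large box;
    elsewhere points have at most two representatives, and these vary
    continuously up to the gluing. *)
Lemma far_apart_near m m' : m <> m' -> exists U U' : set M,
  [/\ nbhs m U, nbhs m' U' & \forall r \near 0^'+,
    forall m1 m1', U m1 -> U' m1' -> far_apart r m1 m1'].
Proof.
have inf_case m0 m0' : at_infinity m0 -> (exists q, lifts m0' q) ->
    exists U U' : set M, [/\ nbhs m0 U, nbhs m0' U' & \forall r \near 0^'+,
    forall m1 m1', U m1 -> U' m1' -> far_apart r m1 m1'].
  move=> i0 l0'; have [B B0 hB] := lifts_bounded m0'.
  do 2 eexists; split.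
  - exact: (near_infinite_point (B + 2) i0).
  - exact: (near_finite_point (ltr01 : 0 < 1 :> K) l0').
  near=> r => m1 m1' /= h1 [ni h2].
  have r1 : r < 1 by near: r; exact: nbhs_right_lt.
  have rB : B + 1 < r^-1 by near: r; apply: near0_inv_gt; lra.
  have bx q : lifts m1' q -> in_box (B + 1) q.
    move=> /h2 [q0 /hB [b1 b2] [c1 c2]]; move: b1 b2 c1 c2.
    rewrite /in_box !ltr_norml => /andP[? ?] /andP[? ?] /andP[? ?] /andP[? ?].
    by split; apply/andP; split; lra.
  split=> [p q /h1 np /bx [b1 b2] [c1 c2]|[_ o]].
    apply: np; move: b1 b2 c1 c2.
    rewrite /in_box !ltr_norml => /andP[? ?] /andP[? ?] /andP[? ?] /andP[? ?].
    by split; apply/andP; split; lra.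
  have [[q lq]|//] := lifts_or_infinity m1'.
  by apply: (o q lq); apply: in_boxW (bx _ lq); exact: ltW.
move=> ne; have [lm|im] := lifts_or_infinity m; have [lm'|im'] := lifts_or_infinity m'.
- have [d d0 hd] := distinct_lifts_far ne.
  have [B B0 hB] := lifts_bounded m.
  have d3 : 0 < d / 3 by rewrite divr_gt0.
  do 2 eexists; split.
  + exact: (near_finite_point d3 lm).
  + exact: (near_finite_point d3 lm').
  near=> r => m1 m1' /= [n1 h1] [n1' h1'].
  have r1 : r < d / 3 by near: r; exact: nbhs_right_lt.
  have rB : B + d / 3 < r^-1 by near: r; apply: near0_inv_gt; lra.
  split=> [p q /h1[p0 lp0 c0] /h1'[q0 lq0 c0'] c|[ob _]].
    apply: (hd _ _ lp0 lq0); case: c0 c0' c => a1 a2 [b1 b2] [c1 c2].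
    move: a1 a2 b1 b2 c1 c2; rewrite /sup_close !ltr_norml.
    move=> /andP[? ?] /andP[? ?] /andP[? ?] /andP[? ?] /andP[? ?] /andP[? ?].
    by split; apply/andP; split; lra.
  have [[p lp]|//] := lifts_or_infinity m1.
  apply: (ob p lp); have [p0 /hB[b1 b2] [c1 c2]] := h1 _ lp.
  apply: (in_boxW (ltW rB)); move: b1 b2 c1 c2.
  rewrite /in_box !ltr_norml => /andP[? ?] /andP[? ?] /andP[? ?] /andP[? ?].
  by split; apply/andP; split; lra.
- have [U [U' [h h' far]]] := inf_case _ _ im' lm; exists U', U; split=> //.
  by apply: filterS far => r far x y hx hy; apply: far_apartC; exact: far.
- exact: inf_case.
- by case: ne; case: im im' => x <- ex [y <- ey]; congr \pi%qT; apply: val_inj; rewrite -!set_valE ex ey.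
Unshelve. all: by end_near. Qed.

(** Disjoint arcs have a common scale of separation, by compactness of the
    square of parameters. *)
Lemma arcs_far_apart (c c' : K -> M) : continuous c -> continuous c' ->
  (forall s t, s \in `[0, 1] -> t \in `[0, 1] -> c s <> c' t) ->
  \forall r \near 0^'+, forall s t, s \in `[0, 1] -> t \in `[0, 1] ->
    far_apart r (c s) (c' t).
Proof.
move=> cc cc' ne; pose A : set (K * K) := `[0, 1] `*` `[0, 1].
have : compact A by apply: compact_setX; exact: segment_compact.
move/compact_near_coveringP/(_ K (0^'+)
  (fun r x => far_apart r (c x.1) (c' x.2)) _) => near_all.
have : \forall r \near 0^'+, A `<=` (fun x => far_apart r (c x.1) (c' x.2)).
  apply: near_all => -[s t] [/= hs ht].
  have [U [U' [nU nU' far]]] := far_apart_near (ne s t hs ht).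
  exists ((c @^-1` U) `*` (c' @^-1` U'), [set r | forall m m', U m -> U' m' -> far_apart r m m']).
    split=> //=; exists (c @^-1` U, c' @^-1` U') => //.
    by split; [exact: cc|exact: cc'].
  by move=> [[s1 t1] r] /= [[? ?] h]; exact: h.
by apply: filterS => r h s t hs ht; exact: (h (s, t)).
Qed.

Definition clamp (t : K) : K := Num.max 0 (Num.min 1 t).

Lemma clamp_itv t : clamp t \in `[0, 1].
Proof.
rewrite in_itv /= /clamp le_max lexx /= ge_max ler01 /=.
by rewrite ge_min lexx.
Qed.

Lemma clamp_id t : t \in `[0, 1] -> clamp t = t.
Proof. by rewrite in_itv /= => /andP[t0 t1]; rewrite /clamp (min_r t1) (max_r t0). Qed.

Lemma clamp_continuous : continuous clamp.
Proof.
move=> t.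
have h1 : {for t, continuous (cst 1 \min id : K -> K^o)}.
  by apply: continuous_min; [exact: cst_continuous|exact: cvg_id].
have : {for t, continuous (cst 0 \max (cst 1 \min id) : K -> K^o)}.
  by apply: continuous_max; [exact: cst_continuous|exact: h1].
by [].
Qed.

Lemma clamp_arc_continuous (c : K -> M) :
  {within `[0, 1], continuous c} -> continuous (c \o clamp).
Proof.
move/subspace_continuousP => h t U nU.
have W : nbhs (clamp t) [set s | `[0, 1]%classic s -> U (c s)].
  exact: (h (clamp t) (clamp_itv t) U nU).
have W' : nbhs t [set s | `[0, 1]%classic (clamp s) -> U (c (clamp s))].
  exact: clamp_continuous W.
change (nbhs t [set s | U (c (clamp s))]).
by apply: filterS W' => s /=; apply; exact: clamp_itv.
Qed.

Definition near_points (r : K) m m' :=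
  (exists p q, [/\ lifts m p, lifts m' q, `|q.1 - p.1| <= r / 4
                   & `|q.2 - p.2| <= r / 4])
  \/ (outside_box r^-1 m /\ outside_box r^-1 m').

Lemma near_points_sym r m m' : near_points r m m' -> near_points r m' m.
Proof.
case=> [[p [q [? ? h1 h2]]]|[? ?]]; [left|by right].
by exists q, p; rewrite distrC (distrC p.2).
Qed.

Lemma near_points_nbhs (r : K) m : 0 < r -> \forall m' \near m, near_points r m m'.
Proof.
move=> r0; have [lm|im] := lifts_or_infinity m; last first.
  apply: filterS (near_infinite_point r^-1 im) => m' h; right; split=> //.
  by move=> p /lifts_not_infinity.
have r4 : 0 < r / 4 by rewrite divr_gt0.
apply: filterS (near_finite_point r4 lm) => m' [ni h]; left.
have [[q lq]|//] := lifts_or_infinity m'.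
have [p lp [h1 h2]] := h _ lq.
by exists p, q; split=> //; exact: ltW.
Qed.

(** A representative in the plane; outside the box for the point at infinity. *)
Definition plane_point (B : K) m : K * K :=
  if pselect (exists p, lifts m p) is left h then projT1 (cid h) else (B, B).

Lemma plane_point_lifts B m p : lifts m p -> lifts m (plane_point B m).
Proof.
move=> lp; rewrite /plane_point; case: pselect => [h|[]]; last by exists p.
exact: projT2 (cid h).
Qed.

Lemma plane_point_infinity B m : at_infinity m -> plane_point B m = (B, B).
Proof.
move=> im; rewrite /plane_point; case: pselect => // h.
by exfalso; case: h => p /lifts_not_infinity.
Qed.

Definition curve_lifts (E : set M) : set (K * K) :=
  [set p | exists2 m, E m & lifts m p].
Definition curve_out (B : K) (E : set M) := exists2 m, E m & outside_box B m.

Local Notation admissible_curve r E :=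
  (@admissible_line K k r r^-1 (curve_lifts E) (curve_out r^-1 E)).

Lemma same_side_sym (B : K) p q : same_side B p q -> same_side B q p.
Proof.
by case=> -[? ?]; [apply: Or41|apply: Or42|apply: Or43|apply: Or44].
Qed.

Lemma outer_corner_line (r : K) (E : set M) p : 0 < r -> curve_out r^-1 E ->
  ~ in_box r^-1 p -> exists c c' : seq (step K k),
  [/\ linked p c (r^-1, r^-1), admissible_curve r E c,
      linked (r^-1, r^-1) c' p & admissible_curve r E c'].
Proof.
rewrite -invr_gt0; move: r^-1 => B B0 oE np.
have one x y : same_side B x y -> admissible_step r B (curve_lifts E)
    (curve_out B E) (None, (x, y)) by right.
have line1 x y : same_side B x y ->
    @admissible_line K k r B (curve_lifts E) (curve_out B E) [:: (None, (x, y))].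
  by move=> h t [<-|[]]; exact: one.
have line2 x y z : same_side B x y -> same_side B y z ->
    @admissible_line K k r B (curve_lifts E) (curve_out B E)
      [:: (None, (x, y)); (None, (y, z))].
  by move=> h h' t [<-|[<-|[]]]; exact: one.
have direct : B <= p.1 \/ B <= p.2 -> same_side B p (B, B).
  by case=> ?; [apply: Or41|apply: Or43]; split=> /=.
have two x : same_side B p x -> same_side B x (B, B) ->
  exists c c' : seq (step K k),
  [/\ linked p c (B, B), @admissible_line K k r B (curve_lifts E) (curve_out B E) c,
      linked (B, B) c' p & @admissible_line K k r B (curve_lifts E) (curve_out B E) c'].
  move=> h1 h2; exists [:: (None, (p, x)); (None, (x, (B, B)))],
    [:: (None, ((B, B), x)); (None, (x, p))].
  by split=> //; apply: line2 => //; exact: same_side_sym.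
have [h1|h1] := leP B p.1.
  by apply: (two (B, B)); [apply: direct; left|apply: Or41].
have [h2|h2] := leP B p.2.
  by apply: (two (B, B)); [apply: direct; right|apply: Or41].
have [h3|h3] := leP p.1 (- B).
  by apply: (two (- B, B)); [apply: Or42; split|apply: Or43].
have [h4|h4] := leP p.2 (- B).
  by apply: (two (B, - B)); [apply: Or44; split|apply: Or41].
by case: np; rewrite /in_box !ltr_norml h1 h2 h3 h4.
Qed.

Lemma near_points_line (r : K) (E : set M) m m' : 0 < r -> E m -> E m' ->
  near_points r m m' -> exists c : seq (step K k),
  linked (plane_point r^-1 m) c (plane_point r^-1 m') /\ admissible_curve r E c.
Proof.
move=> r0 Em Em' [[p [q [lp lq h1 h2]]]|[out1 out2]].
  have chord m0 p0 q0 : E m0 -> lifts m0 p0 -> lifts m0 q0 -> exists c : seq (step K k),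
      linked p0 c q0 /\ admissible_curve r E c.
    move=> E0 l0 l0'; case: (lifts_eq l0 l0') => [->|[i [hi e]]].
      by exists [::]; split=> // t [].
    exists [:: (Some i, (p0, q0))]; split=> // t [<-|[]].
    by split=> //=; exists m0.
  have [c1 [k1 a1]] := chord _ _ _ Em (plane_point_lifts r^-1 lp) lp.
  have [c2 [k2 a2]] := chord _ _ _ Em' lq (plane_point_lifts r^-1 lq).
  exists (c1 ++ (None, (p, q)) :: c2); split; first exact: (linked_cat k1).
  apply: admissible_line_cat => // t [<-|]; last exact: a2.
  by left; split=> //=; [exists m|exists m'].
have out m0 : outside_box r^-1 m0 -> ~ in_box r^-1 (plane_point r^-1 m0).
  move=> o; have [[x lx]|im] := lifts_or_infinity m0.
    by apply: o; exact: plane_point_lifts lx.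
  rewrite (plane_point_infinity _ im) => -[/= + _].
  by rewrite ger0_norm ?ltxx // invr_ge0 ltW.
have oE : curve_out r^-1 E by exists m.
have [c [_ [k1 a1 _ _]]] := outer_corner_line r0 oE (out _ out1).
have [_ [c' [_ _ k2 a2]]] := outer_corner_line r0 oE (out _ out2).
exists (c ++ c'); split; first exact: (linked_cat k1).
exact: admissible_line_cat.
Qed.

(** The parameters that can be reached from 0 form an open and closed set. *)
Lemma arc_line (r : K) (c : K -> M) : 0 < r -> continuous c ->
  exists l : seq (step K k),
  linked (plane_point r^-1 (c 0)) l (plane_point r^-1 (c 1)) /\
  admissible_curve r (range c) l.
Proof.
move=> r0 cc.
pose C : set K := [set t | exists l : seq (step K k),
  linked (plane_point r^-1 (c 0)) l (plane_point r^-1 (c t)) /\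
  admissible_curve r (range c) l].
have next s t : C s -> near_points r (c s) (c t) -> C t.
  move=> [l [k1 a1]] /(near_points_line r0 (imageT c s) (imageT c t))[l' [k2 a2]].
  by exists (l ++ l'); split; [exact: linked_cat k2|exact: admissible_line_cat].
have nb t : \forall s \near t, near_points r (c t) (c s).
  exact: (cc t _ (near_points_nbhs (c t) r0)).
have oC : open C.
  by rewrite openE => t Ct; apply: filterS (nb t) => s; exact: next.
have cC : closed C.
  rewrite -[C]setCK; apply: open_closedC; rewrite openE => t nCt.
  apply: filterS (nb t) => s /near_points_sym ns Cs; apply: nCt.
  exact: next ns.
have C0 : C 0 by exists [::]; split=> // ? [].
have i0 : (0 : K) \in `[0, 1] by rewrite in_itv /= lexx ler01.
have i1 : (1 : K) \in `[0, 1] by rewrite in_itv /= lexx ler01.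
have E : `[0, 1]%classic `&` C = `[0, 1]%classic.
  apply: segment_connected; first by exists 0.
  - by exists C.
  - by exists C.
by have [] : (`[0, 1]%classic `&` C) 1 by rewrite E.
Qed.

Lemma far_curves_separated (r : K) (E E' : set M) : 0 < r -> (3 * k)%:R < r^-1 ->
  (forall m m', E m -> E' m' -> far_apart r m m') ->
  separated k r r^-1 (curve_lifts E) (curve_lifts E') (curve_out r^-1 E) (curve_out r^-1 E').
Proof.
move=> r0 kr far.
have box (F : set M) : ~ curve_out r^-1 F -> forall p, curve_lifts F p -> in_box r^-1 p.
  move=> nF p [m Fm lp]; apply: contrapT => np; apply: nF; exists m => // q lq.
  case: (lifts_eq lp lq) => [<-//|[i [hi ->]]] _; apply: np.
  by apply: in_boxW (circle_in_box hi); exact: ltW.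
split=> //.
- by move=> p [m _ /lifts_outside].
- by move=> p [m _ /lifts_outside].
- by move=> p q [m Em lp] [m' Em' lq]; exact: (far _ _ Em Em').1.
- exact: box.
- exact: box.
- by case=> -[m Em o] [m' Em' o']; exact: (far _ _ Em Em').2.
Qed.

(** Choose a scale at which all pairs of independent edges are separated and
    approximate each edge by a polygonal line; then the crossings of two
    independent edges are exactly their common passages through crosscaps. *)
Theorem drawing_of_embedding (V : finType) (e : rel V) :
  embeds_in K e M -> exists ord ray (wt : V -> V -> 'rV[bool]_k),
  drawing e ord ray wt.
Proof.
case=> f [g [finj garc gvert gdis]].
pose c u v := g u v \o clamp.
have cE u v t : t \in `[0, 1] -> c u v t = g u v t by move=> /clamp_id; rewrite /c /= => ->.
have i0 : (0 : K) \in `[0, 1] by rewrite in_itv /= lexx ler01.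
have i1 : (1 : K) \in `[0, 1] by rewrite in_itv /= lexx ler01.
have cc u v : e u v -> continuous (c u v).
  by move=> /garc[h _ _ _]; exact: clamp_arc_continuous.
have c0 u v : e u v -> c u v 0 = f u by move=> /garc[_ h _ _]; rewrite cE.
have c1 u v : e u v -> c u v 1 = f v by move=> /garc[_ _ h _]; rewrite cE.
have ends (t : K) : t \in `[0, 1] -> [\/ t = 0, t = 1 | t \in `]0, 1[].
  rewrite !in_itv /= => /andP[]; rewrite !le_eqVlt.
  move=> /orP[/eqP<-|t0]; first by constructor 1.
  by move=> /orP[/eqP->|t1]; [constructor 2|constructor 3; rewrite t0 t1].
pose indep (x : (V * V) * (V * V)) :=
  [&& e x.1.1 x.1.2, e x.2.1 x.2.2, x.1.1 != x.2.1, x.1.1 != x.2.2,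
      x.1.2 != x.2.1 & x.1.2 != x.2.2].
have disj u v u' v' s t : indep ((u, v), (u', v')) ->
    s \in `[0, 1] -> t \in `[0, 1] -> c u v s <> c u' v' t.
  rewrite /indep /= => /and5P[uv uv' /eqP n1 /eqP n2 /andP[/eqP n3 /eqP n4]] hs ht.
  rewrite !cE //; have [_ a0 a1 _] := garc _ _ uv; have [_ b0 b1 _] := garc _ _ uv'.
  case: (ends s hs) => [->|->|s01]; case: (ends t ht) => [->|->|t01];
    rewrite ?a0 ?a1 ?b0 ?b1 => E.
  - exact: n1 (finj _ _ E).
  - exact: n2 (finj _ _ E).
  - exact: (gvert _ _ u _ uv' t01 (esym E)).
  - exact: n3 (finj _ _ E).
  - exact: n4 (finj _ _ E).
  - exact: (gvert _ _ v _ uv' t01 (esym E)).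
  - exact: (gvert _ _ u' _ uv s01 E).
  - exact: (gvert _ _ v' _ uv s01 E).
  - by case: (gdis _ _ _ _ _ _ uv uv' s01 t01 E) => -[].
have far : \forall r \near 0^'+, forall x, indep x -> forall s t,
    s \in `[0, 1] -> t \in `[0, 1] ->
    far_apart r (c x.1.1 x.1.2 s) (c x.2.1 x.2.2 t).
  apply: filter_forall => -[[u v] [u' v']].
  have [ix|nx] := boolP (indep (u, v, (u', v'))); last by apply: filterE.
  have /andP[uv /andP[uv' _]] := ix.
  apply: filterS (arcs_far_apart (cc _ _ uv) (cc _ _ uv') _) => [r h _|s t]; first exact: h.
  exact: disj.
have bounded : \forall r \near 0^'+, forall v p, lifts (f v) p -> in_box (K:=K) r^-1 p.
  apply: filter_forall => v; have [B B0 hB] := lifts_bounded (f v).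
  apply: filterS (near0_inv_gt B0) => r Br p /hB; apply: in_boxW; exact: ltW.
have [r [r0 kr {}far {}bounded]] : exists r : K, [/\ 0 < r, (3 * k)%:R < r^-1,
    forall x, indep x -> forall s t, s \in `[0, 1] -> t \in `[0, 1] ->
    far_apart r (c x.1.1 x.1.2 s) (c x.2.1 x.2.2 t)
    & forall v p, lifts (f v) p -> in_box r^-1 p].
  suff /filter_ex[r [? ? ? ?]] : \forall r \near 0^'+, [/\ 0 < r, (3 * k)%:R < r^-1,
    forall x, indep x -> forall s t, s \in `[0, 1] -> t \in `[0, 1] ->
    far_apart r (c x.1.1 x.1.2 s) (c x.2.1 x.2.2 t)
    & forall v p, lifts (f v) p -> in_box (K:=K) r^-1 p] by exists r.
  have k1 : 0 < (3 * k)%:R + 1 :> K by rewrite ltr_wpDl ?ler0n.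
  have big : \forall r \near 0^'+, (3 * k)%:R < r^-1 :> K.
    by apply: filterS (near0_inv_gt k1) => r; lra.
  near=> r; split; near: r; [exact: nbhs_right_gt|exact: big|exact: far|exact: bounded].
have line u v : exists l : seq (step K k), e u v ->
   linked (plane_point r^-1 (f u)) l (plane_point r^-1 (f v)) /\
   admissible_curve r (range (c u v)) l.
  have [uv|_] := boolP (e u v); last by exists [::].
  have [l [k1 a1]] := arc_line r0 (cc _ _ uv).
  by exists l => _; rewrite -(c0 _ _ uv) -(c1 _ _ uv).
pose l u v : seq (step K k) := projT1 (cid (line u v)).
have lP u v : e u v -> linked (plane_point r^-1 (f u)) (l u v) (plane_point r^-1 (f v)) /\
   admissible_curve r (range (c u v)) (l u v) by exact: projT2 (cid (line u v)).
exists (fun u v => lexle (plane_point r^-1 (f v)) (plane_point r^-1 (f u))).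
exists (fun w u v => line_ray (plane_point r^-1 (f w)) (l u v)).
exists (fun u v => line_wt (l u v)).
split=> [u v /eqP uv|u v u' v' uv uv' n1 n2 n3 n4].
  apply: lexle_tournament => E; apply: uv.
  have corner : ~ in_box (K:=K) r^-1 (r^-1, r^-1).
    by case=> /= + _; rewrite ger0_norm ?ltxx // invr_ge0 ltW.
  have [[p lp]|ip] := lifts_or_infinity (f u); have [[q lq]|iq] := lifts_or_infinity (f v).
  - apply: finj; apply: (lifts_inj (plane_point_lifts r^-1 lp)); rewrite -E.
    exact: plane_point_lifts lq.
  - case: corner; rewrite -(plane_point_infinity _ iq) E; apply: (bounded u).
    exact: plane_point_lifts lp.
  - case: corner; rewrite -(plane_point_infinity _ ip) -E; apply: (bounded v).
    exact: plane_point_lifts lq.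
  - apply: finj; case: ip iq => x <- ex [y <- ey]; congr \pi%qT.
    by apply: val_inj; rewrite -!set_valE ex ey.
have [k1 a1] := lP _ _ uv; have [k2 a2] := lP _ _ uv'.
have S : separated k r r^-1 (curve_lifts (range (c u v))) (curve_lifts (range (c u' v')))
    (curve_out r^-1 (range (c u v))) (curve_out r^-1 (range (c u' v'))).
  apply: far_curves_separated => // _ _ [s _ <-] [t _ <-].
  have := far ((u, v), (u', v')); rewrite /indep /= uv uv' n1 n2 n3 n4.
  move=> /(_ isT _ _ (clamp_itv s) (clamp_itv t)).
  by rewrite /c /= !(clamp_id (clamp_itv _)).
exact: separated_lines S k1 a1 k2 a2.
Unshelve. all: by end_near. Qed.

End Approximation.

(** * Packing bipartite cores *)

(** Vertices are natural numbers, the right ones being shifted by [m], so that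
    subdivisions can be checked by computation. *)
Definition bipartite (m : nat) (r : rel nat) : rel nat := fun a b =>
  if (a < m)%N then (m <= b)%N && r a (b - m)%N else (b < m)%N && r b (a - m)%N.

Definition checked_k33 (e : rel nat) (n : nat) (xs ys : seq nat)
    (ps : seq (seq (seq nat))) : bool :=
  let p i j := nth [::] (nth [::] ps i) j in
  let x i := nth 0%N xs i in
  all (fun i => all (fun j =>
    [&& path e (x i) (p i j), last (x i) (p i j) == nth 0%N ys j,
        all (fun a => a < n)%N (x i :: p i j)
      & all (fun i' => all (fun j' => (i != i') && (j != j') ==>
          ~~ has (mem (x i' :: p i' j')) (x i :: p i j)) (iota 0 3)) (iota 0 3)])
    (iota 0 3)) (iota 0 3).

Definition nonplanar_core (m : nat) (r : rel nat) :=
  exists xs ys ps, checked_k33 (bipartite m r) (m + m) xs ys ps.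

Definition pattern_all : rel nat := fun _ _ => true.
Definition pattern_ne : rel nat := fun a b => a != b.
Definition pattern_grid : rel nat := fun a b => ((a %/ 3 != b %/ 3) && (a %% 3 != b %% 3))%N.
Definition pattern_double : rel nat := fun a b => (a %/ 2 != b %/ 2)%N.

Lemma core_all : nonplanar_core 3 pattern_all.
Proof.
exists [:: 0; 1; 2]%N, [:: 3; 4; 5]%N.
by exists (nseq 3 [:: [:: 3]; [:: 4]; [:: 5]]%N).
Qed.

(** The complete bipartite graph on five and five vertices minus a perfect
    matching: only the missing edge from 0 to its partner needs a detour. *)
Lemma core_ne : nonplanar_core 5 pattern_ne.
Proof.
exists [:: 0; 1; 2]%N, [:: 8; 9; 5]%N.
exists ([:: [:: [:: 8]; [:: 9]; [:: 6; 3; 5]]; [:: [:: 8]; [:: 9]; [:: 5]];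
  [:: [:: 8]; [:: 9]; [:: 5]]]%N).
by vm_compute.
Qed.

(** A hexagon with every vertex doubled. *)
Lemma core_double : nonplanar_core 6 pattern_double.
Proof.
exists [:: 0; 1; 4]%N, [:: 8; 9; 10]%N.
exists ([:: [:: [:: 8]; [:: 9]; [:: 10]]; [:: [:: 8]; [:: 9]; [:: 10]];
  [:: [:: 8]; [:: 9]; [:: 6; 2; 10]]]%N).
by vm_compute.
Qed.

(** The tensor square of a hexagon, seen as a complete bipartite graph minus a
    perfect matching. *)
Lemma core_grid : nonplanar_core 9 pattern_grid.
Proof.
exists [:: 1; 9; 10]%N, [:: 17; 8; 5]%N.
exists ([:: [:: [:: 17]; [:: 12; 8]; [:: 15; 5]]; [:: [:: 4; 17]; [:: 8]; [:: 5]];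
  [:: [:: 3; 17]; [:: 8]; [:: 5]]]%N).
by vm_compute.
Qed.

Lemma checked_k33_packing (V : eqType) (e : rel V) (I : finType)
    (F : I -> nat -> V) e0 n xs ys ps :
  checked_k33 e0 n xs ys ps ->
  (forall i a b, (a < n)%N -> (b < n)%N -> e0 a b -> e (F i a) (F i b)) ->
  (forall i j a b, (a < n)%N -> (b < n)%N -> F i a = F j b -> i = j /\ a = b) ->
  exists (x y : I -> 'I_3 -> V) pt, k33_packing e x y pt.
Proof.
move=> ok hom inj.
pose p (i j : 'I_3) := nth [::] (nth [::] ps i) j.
pose x0 (i : 'I_3) := nth 0%N xs i; pose y0 (j : 'I_3) := nth 0%N ys j.
have in3 (i : 'I_3) : (i : nat) \in iota 0 3 by rewrite mem_iota; exact: ltn_ord.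
have okP (i j : 'I_3) : [/\ path e0 (x0 i) (p i j), last (x0 i) (p i j) = y0 j,
    all (fun a => a < n)%N (x0 i :: p i j) & forall i' j' : 'I_3,
    (i != i') && (j != j') -> ~~ has (mem (x0 i' :: p i' j')) (x0 i :: p i j)].
  have /allP/(_ _ (in3 i))/allP/(_ _ (in3 j))/and4P[h1 /eqP h2 h3 h4] := ok.
  split=> // i' j' ne.
  have /allP/(_ _ (in3 i'))/allP/(_ _ (in3 j'))/implyP := h4; apply.
  exact: ne.
exists (fun a i => F a (x0 i)), (fun a j => F a (y0 j)), (fun a i j => map (F a) (p i j)).
split=> [a i j|a i j b i' j' ne].
  have [h1 h2 h3 _] := okP i j; rewrite last_map h2; split=> //.
  move: (x0 i) (p i j) h1 h3 => u q; elim: q u => //= v q IH u /andP[uv h1] /and3P[un vn qn].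
  by rewrite hom //= IH // vn.
have [_ _ ha hd] := okP i j; have [_ _ hb _] := okP i' j'.
apply/hasPn => z; rewrite -map_cons => /mapP[u hu ->].
apply/negP => /=; rewrite -[_ :: _]/(map _ (_ :: _)) => /mapP[w hw E].
have [ab uw] := inj _ _ _ _ (allP ha _ hu) (allP hb _ hw) E; subst w.
move: ne; rewrite ab eqxx /= => /hd/hasPn/(_ _ hu).
by rewrite [mem _ _]/= hw.
Qed.

(** Disjoint copies of a core contain disjoint subdivided complete bipartite
    graphs, each of which uses up one crosscap. *)
Theorem bipartite_cores_le (K : realType) (V : finType) (e : rel V) (k m : nat)
    (r : rel nat) (I : finType) (L R : I -> nat -> V) :
  embeds_in K e (sphere_with_crosscaps K k) -> symmetric e -> nonplanar_core m r ->
  (forall i a b, (a < m)%N -> (b < m)%N -> r a b -> e (L i a) (R i b)) ->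
  (forall i j a b, (a < m)%N -> (b < m)%N -> L i a = L j b -> i = j /\ a = b) ->
  (forall i j a b, (a < m)%N -> (b < m)%N -> R i a = R j b -> i = j /\ a = b) ->
  (forall i j a b, (a < m)%N -> (b < m)%N -> L i a <> R j b) ->
  (#|I| <= k)%N.
Proof.
move=> emb sym [xs [ys [ps ok]]] hom injL injR neLR.
have [ord [ray [wt D]]] := drawing_of_embedding emb.
pose F i a := if (a < m)%N then L i a else R i (a - m)%N.
have sub a : (a < m + m)%N -> (a < m)%N = false -> (a - m < m)%N by lia.
have [|| x [y [pt P]]] := checked_k33_packing (e := e) (F := F) ok.
- move=> i a b an bn; rewrite /bipartite /F.
  case: (ltnP a m) => am; case: (ltnP b m) => bm //=.
    by apply: hom => //; lia.
  by move=> h; rewrite sym; apply: hom => //; lia.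
- move=> i j a b an bn; rewrite /F.
  case: ifP => am; case: ifP => bm.
  + exact: injL.
  + by move=> E; case: (neLR i j a (b - m)%N am (sub _ bn bm) E).
  + by move=> E; case: (neLR j i b (a - m)%N bm (sub _ an am) (esym E)).
  + move=> E; have [-> h] := injR _ _ _ _ (sub _ an am) (sub _ bn bm) E.
    by split=> //; lia.
exact: (k33_packing_le D P).
Qed.

(** * Planar graphs *)

Section StraightLineDrawing.
Variable K : realType.
Local Notation M0 := (sphere_with_crosscaps K 0).
Local Notation H0 := (holed_sphere (K := K) 0).

Lemma holed_sphere0 (p : K * K) : holed_sphere 0 (Some p : sphere K).
Proof. by move=> []. Qed.

Definition plane_in_holed_sphere (p : K * K) : H0 :=
  exist _ (Some p) (mem_set (@holed_sphere0 p)).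

Definition plane_in_sphere (p : K * K) : M0 :=
  (\pi_M0 (plane_in_holed_sphere p))%qT.

Lemma plane_in_sphere_inj : injective plane_in_sphere.
Proof.
move=> p q E; have : glued (plane_in_holed_sphere p) (plane_in_holed_sphere q).
  suff : (\pi_({eq_quot (glued_equiv K 0)}) (plane_in_holed_sphere p)
    = \pi_({eq_quot (glued_equiv K 0)}) (plane_in_holed_sphere q))%qT by move=> /eqmodP/asboolP.
  exact: E.
by case=> [/(congr1 val) /= [->]//|[[]]].
Qed.

Lemma plane_in_sphere_continuous : continuous plane_in_sphere.
Proof.
apply/continuousP => U oU.
have [A oA AU] : open (\pi_M0 @^-1` U : set H0)%qT by exact: oU.
have -> : plane_in_sphere @^-1` U = (Some : K * K -> sphere K) @^-1` A.
  rewrite -[LHS]/(plane_in_holed_sphere @^-1` (\pi_M0 @^-1` U)%qT) -AU.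
  by apply/seteqP; split.
by have /continuousP := @one_point_compactification_some_continuous (K * K)%type; apply.
Qed.

Lemma lerp_continuous (s : (K * K) * (K * K)) : continuous (lerp s).
Proof.
move=> t; apply: (@cvg_pair _ _ _ _ (nbhs (lerp s t).1) (nbhs (lerp s t).2)).
  by apply: cvgD; [exact: cvg_cst|apply: cvgM; [exact: cvg_id|exact: cvg_cst]].
by apply: cvgD; [exact: cvg_cst|apply: cvgM; [exact: cvg_id|exact: cvg_cst]].
Qed.

Lemma embeds_in_of_plane (V : finType) (e : rel V) (pos : V -> K * K) :
  injective pos ->
  (forall u v w t, e u v -> t \in `]0, 1[ -> lerp (pos u, pos v) t <> pos w) ->
  (forall u v u' v' t t', e u v -> e u' v' -> t \in `]0, 1[ -> t' \in `]0, 1[ ->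
     lerp (pos u, pos v) t = lerp (pos u', pos v') t' ->
     [/\ u = u', v = v' & t = t'] \/ [/\ u = v', v = u' & t = 1 - t']) ->
  embeds_in K e M0.
Proof.
move=> pinj pvert pedge.
exists (fun v => plane_in_sphere (pos v)),
  (fun u v t => plane_in_sphere (lerp (pos u, pos v) t)); split.
- by move=> u v /plane_in_sphere_inj/pinj.
- move=> u v uv; split.
  + apply: continuous_subspaceT => t.
    apply: continuous_comp; first exact: lerp_continuous.
    exact: plane_in_sphere_continuous.
  + by rewrite lerp0.
  + by rewrite lerp1.
  + by move=> t _; rewrite -lerp_flip.
- by move=> u v w t uv t01 /plane_in_sphere_inj; exact: pvert.
- by move=> u v u' v' t t' uv uv' t01 t01' /plane_in_sphere_inj; exact: pedge.
Qed.

End StraightLineDrawing.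

Definition orient_int (p q r : int * int) : int :=
  (q.1 - p.1) * (r.2 - p.2) - (q.2 - p.2) * (r.1 - p.1).

(** A straight-line drawing in general position of a graph on [0 .. n - 1],
    checkable by computation: of two edges without common end, one has both
    ends strictly on one side of the line of the other. *)
Definition checked_drawing (adj : rel nat) (ps : seq (int * int)) : bool :=
  let n := size ps in
  let p i := nth (0, 0) ps i in
  [&& uniq ps, all (fun q : int * int => (-9 <= q.1) && (q.1 <= 9)) ps &
  all (fun a => all (fun b => adj a b ==>
    [&& a != b, all (fun c => (c != a) ==> (c != b) ==>
          (orient_int (p a) (p b) (p c) != 0)) (iota 0 n) &
      all (fun c => all (fun d => adj c d ==>
        [|| c == a, c == b, d == a, d == b,
          0 < orient_int (p a) (p b) (p c) * orient_int (p a) (p b) (p d) |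
          0 < orient_int (p c) (p d) (p a) * orient_int (p c) (p d) (p b)])
       (iota 0 n)) (iota 0 n)]) (iota 0 n)) (iota 0 n)].

Definition cube_adj : rel nat := fun a b =>
  ((a %/ 4 != b %/ 4) && (a %% 4 != b %% 4))%N.
Definition k33_minus_adj : rel nat := fun a b =>
  [&& (a %/ 4 != b %/ 4)%N, (a %% 4 != 3)%N, (b %% 4 != 3)%N &
      ((a %% 4 != 0) || (b %% 4 != 0))%N].

Definition cube_points : seq (int * int) :=
  [:: (-3, -3); (0, 1); (3, 3); (0, -1); (1, 0); (3, -3); (-1, 0); (-3, 3)].
Definition k33_minus_points : seq (int * int) :=
  [:: (1, 1); (0, 3); (0, -3); (8, 8); (9, 4); (-3, 0); (3, 0)].

Lemma cube_drawing : checked_drawing cube_adj cube_points.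
Proof. by vm_compute. Qed.

Lemma k33_minus_drawing : checked_drawing k33_minus_adj k33_minus_points.
Proof. by vm_compute. Qed.

Section DisjointCopies.
Variables (K : realType) (V : finType) (e : rel V) (idx loc : V -> nat).
Variables (adj : rel nat) (ps : seq (int * int)).
Hypothesis ok : checked_drawing adj ps.
Hypothesis loc_lt : forall v, (loc v < size ps)%N.
Hypothesis inj : forall u v, idx u = idx v -> loc u = loc v -> u = v.
Hypothesis edge : forall u v, e u v -> idx u = idx v /\ adj (loc u) (loc v).

Let p i := nth (0, 0) ps i.
Let pos v : K * K := ((20 * idx v)%:R + (p (loc v)).1%:~R, (p (loc v)).2%:~R).

Let in_iota v : loc v \in iota 0 (size ps).
Proof. by rewrite mem_iota; exact: loc_lt. Qed.

Let bound v : -9 <= (p (loc v)).1%:~R :> K /\ (p (loc v)).1%:~R <= 9 :> K.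
Proof.
have /and3P[_ /allP/(_ (p (loc v)) (mem_nth _ (loc_lt v)))/andP[h1 h2] _] := ok.
by split; [rewrite -[-9]/((-9)%:~R) ler_int|rewrite -[9]/(9%:~R) ler_int].
Qed.

Let orient_pos u v w : idx u = idx v -> idx u = idx w ->
  orient (pos u) (pos v) (pos w) =
  (orient_int (p (loc u)) (p (loc v)) (p (loc w)))%:~R.
Proof.
move=> uv uw; rewrite /orient /orient_int /pos /= -uv -uw.
by rewrite !(intrD, intrM, intrB, rmorphB, rmorphM, rmorphN) /=; ring.
Qed.

Let strip u v t : idx u = idx v -> 0 <= t <= 1 ->
  (20 * idx u)%:R - 9 <= (lerp (pos u, pos v) t).1 <= (20 * idx u)%:R + 9.
Proof.
move=> uv /andP[t0 t1]; rewrite /lerp /pos /= -uv.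
have [a1 a2] := bound u; have [b1 b2] := bound v.
move: (p (loc u)).1%:~R (p (loc v)).1%:~R a1 a2 b1 b2 => x y a1 a2 b1 b2.
have -> : (20 * idx u)%:R + x + t * ((20 * idx u)%:R + y - ((20 * idx u)%:R + x)) =
  (20 * idx u)%:R + ((1 - t) * x + t * y) by ring.
have t1' : 0 <= 1 - t by rewrite subr_ge0.
have m1 := ler_wpM2l t1' a1; have m2 := ler_wpM2l t1' a2.
have m3 := ler_wpM2l t0 b1; have m4 := ler_wpM2l t0 b2.
by apply/andP; split; lra.
Qed.

Let strip_inj i j (x : K) : (20 * i)%:R - 9 <= x <= (20 * i)%:R + 9 ->
  (20 * j)%:R - 9 <= x <= (20 * j)%:R + 9 -> i = j.
Proof.
have lt (a b : nat) : (a < b)%N -> (20 * a)%:R + 20 <= (20 * b)%:R :> K.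
  by move=> ab; rewrite -natrD ler_nat; lia.
move=> /andP[h1 h2] /andP[h3 h4].
by case: (ltngtP i j) => // /lt h; exfalso; lra.
Qed.

Let edge_ok u v : e u v -> [/\ loc u != loc v,
  forall w, loc w != loc u -> loc w != loc v ->
     orient_int (p (loc u)) (p (loc v)) (p (loc w)) != 0 &
  forall u' v', e u' v' ->
     [|| loc u' == loc u, loc u' == loc v, loc v' == loc u, loc v' == loc v,
       0 < orient_int (p (loc u)) (p (loc v)) (p (loc u'))
           * orient_int (p (loc u)) (p (loc v)) (p (loc v')) |
       0 < orient_int (p (loc u')) (p (loc v')) (p (loc u))
           * orient_int (p (loc u')) (p (loc v')) (p (loc v))]].
Proof.
move=> /edge[_ uv]; have /and3P[_ _ /allP/(_ _ (in_iota u))/allP/(_ _ (in_iota v))] := ok.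
rewrite uv /= => /and3P[ne /allP hv /allP he]; split=> //.
  by move=> w w1 w2; have := hv _ (in_iota w); rewrite w1 w2.
move=> u' v' /edge[_ uv']; have /allP/(_ _ (in_iota v')) := he _ (in_iota u').
by rewrite uv'.
Qed.

Let pos_inj : injective pos.
Proof.
move=> u v E.
have uu : (20 * idx u)%:R - 9 <= (pos u).1 <= (20 * idx u)%:R + 9.
  by have := @strip u u 0 erefl; rewrite lerp0 lexx ler01 => /(_ isT).
have vv : (20 * idx v)%:R - 9 <= (pos u).1 <= (20 * idx v)%:R + 9.
  by have := @strip v v 0 erefl; rewrite lerp0 lexx ler01 E => /(_ isT).
have ij := strip_inj uu vv; apply: inj => //; apply/eqP.
have /and3P[un _ _] := ok.
rewrite -(nth_uniq (0, 0) (loc_lt u) (loc_lt v) un) -/(p _) -/(p _).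
move: E; rewrite /pos ij => -[/addrI/intr_inj e1 /intr_inj e2].
by apply/eqP; rewrite (surjective_pairing (p (loc u))) e1 e2 -surjective_pairing.
Qed.

Let orient_lerp (s t : (K * K) * (K * K)) x : orient s.1 s.2 (lerp t x) =
  (1 - x) * orient s.1 s.2 t.1 + x * orient s.1 s.2 t.2.
Proof. by rewrite /orient /lerp /=; ring. Qed.

Let orient_end1 (x y : K * K) : orient x y x = 0. Proof. by rewrite /orient; ring. Qed.
Let orient_end2 (x y : K * K) : orient x y y = 0. Proof. by rewrite /orient; ring. Qed.

Let open01 (t : K) : t \in `]0, 1[ -> [/\ 0 < t, t < 1 & 0 <= t <= 1].
Proof. by rewrite in_itv /= => /andP[h1 h2]; split=> //; rewrite !ltW. Qed.

Let pos_vert u v w t : e u v -> t \in `]0, 1[ -> lerp (pos u, pos v) t <> pos w.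
Proof.
move=> uv /open01[t0 t1 t01] E; have [iuv _] := edge uv.
have ww : (20 * idx w)%:R - 9 <= (pos w).1 <= (20 * idx w)%:R + 9.
  by have := @strip w w 0 erefl; rewrite lerp0 lexx ler01 => /(_ isT).
have := strip iuv t01; rewrite E => uu; have iuw := strip_inj uu ww.
have [ne hv _] := edge_ok uv.
have puv : pos u <> pos v by move/pos_inj => h; rewrite h eqxx in ne.
have nz (x y : K) : x + t * (y - x) = x -> y = x.
  move=> h; have : t * (y - x) = 0 by lra.
  by move/eqP; rewrite mulf_eq0 gt_eqF //= => /eqP; lra.
have nz' (x y : K) : x + t * (y - x) = y -> y = x.
  move=> h; have : (1 - t) * (y - x) = 0 by lra.
  by move/eqP; rewrite mulf_eq0 gt_eqF ?subr_gt0 //= => /eqP; lra.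
have [wu|wu] := eqVneq (loc w) (loc u).
  apply: puv; move: E; rewrite (inj (esym iuw) wu) /lerp.
  by case: (pos u) (pos v) => a b [c d] /= [/nz -> /nz ->].
have [wv|wv] := eqVneq (loc w) (loc v).
  apply: puv; move: E; rewrite (inj (etrans (esym iuw) iuv) wv) /lerp.
  by case: (pos u) (pos v) => a b [c d] /= [/nz' -> /nz' ->].
have := hv w wu wv; rewrite -(intr_eq0 K) -orient_pos // -E.
by rewrite (orient_lerp (pos u, pos v)) orient_end1 orient_end2 !mulr0 addr0 eqxx.
Qed.

(** In general position the other end of one edge is off the line of the other
    edge. *)
Let fan u v v' t t' : e u v -> e u v' -> t \in `]0, 1[ -> t' \in `]0, 1[ ->
  lerp (pos u, pos v) t = lerp (pos u, pos v') t' -> v = v' /\ t = t'.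
Proof.
move=> uv uv' /open01[t0 t1 t01] /open01[s0 s1 s01] E.
have [iuv _] := edge uv; have [iuv' _] := edge uv'.
have [ne hv _] := edge_ok uv; have [ne' _ _] := edge_ok uv'.
have [vv|vv] := eqVneq (loc v') (loc v).
  have ev : v' = v by apply: inj => //; rewrite -iuv -iuv'.
  split=> //; move: E; rewrite ev /lerp.
  have puv : pos u <> pos v by move/pos_inj => h; rewrite h eqxx in ne.
  case: (pos u) (pos v) puv => a b [c d] /= puv [/addrI e1 /addrI e2].
  have [ca|ca] := eqVneq (c - a) 0; last exact: (mulIf ca).
  have [db|db] := eqVneq (d - b) 0; last exact: (mulIf db).
  by case: puv; congr (_, _); lra.
have := hv v'; rewrite vv eq_sym ne' => /(_ isT isT).
rewrite -(intr_eq0 K) -orient_pos //.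
have := congr1 (orient (pos u) (pos v)) E.
rewrite !(orient_lerp (pos u, pos v)) orient_end1 orient_end2 !mulr0 !addr0 add0r.
by move/esym/eqP; rewrite mulf_eq0 gt_eqF //= => ->.
Qed.

Let same_sign (a b c : K) : 0 < a * b -> 0 <= c <= 1 -> (1 - c) * a + c * b <> 0.
Proof.
move=> ab /andP[c0 c1] E.
have h : 0 = (1 - c) * (a * a) + c * (a * b).
  have -> : (1 - c) * (a * a) + c * (a * b) = a * ((1 - c) * a + c * b) by ring.
  by rewrite E mulr0.
have a0 : 0 < a * a by rewrite -expr2 exprn_even_gt0 //=; apply/eqP => a0; rewrite a0 mul0r ltxx in ab.
have h1 : 0 <= (1 - c) * (a * a) by rewrite mulr_ge0 ?subr_ge0 // ltW.
have h2 : 0 <= c * (a * b) by rewrite mulr_ge0 // ltW.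
have [c0'|c0'] := eqVneq c 0; first by move: h; rewrite c0' subr0 mul1r mul0r addr0; lra.
have : 0 < c * (a * b) by rewrite mulr_gt0 // lt_neqAle eq_sym c0'.
by lra.
Qed.

Theorem embeds_in_of_drawing : symmetric e ->
  embeds_in K e (sphere_with_crosscaps K 0).
Proof.
move=> sym; apply: (embeds_in_of_plane pos_inj pos_vert).
move=> u v u' v' t t' uv uv' t01 t01' E.
have [t0 t1 tc] := open01 t01; have [s0 s1 sc] := open01 t01'.
have [iuv _] := edge uv; have [iuv' _] := edge uv'.
have := strip iuv tc; rewrite E => h; have iuu := strip_inj h (strip iuv' sc).
have vu : e v u by rewrite sym. have vu' : e v' u' by rewrite sym.
have r01 (x : K) : x \in `]0, 1[ -> 1 - x \in `]0, 1[.
  by rewrite !in_itv /= => /andP[? ?]; apply/andP; split; lra.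
have flip_eq a b x : lerp (pos a, pos b) x = lerp (pos b, pos a) (1 - x).
  exact: (lerp_flip (pos b, pos a)).
have [_ _ /(_ _ _ uv')] := edge_ok uv.
case/orP => [/eqP c|].
  have eu : u' = u by apply: inj.
  subst u'; have [-> ->] := fan uv uv' t01 t01' E; by left.
case/orP => [/eqP c|].
  have eu : u' = v by apply: inj => //; rewrite -iuu.
  subst u'; rewrite flip_eq in E.
  have [-> h'] := fan vu uv' (r01 _ t01) t01' E; right; split=> //; lra.
case/orP => [/eqP c|].
  have eu : v' = u by apply: inj => //; rewrite -iuv'.
  subst v'; rewrite [RHS]flip_eq in E.
  have [-> ->] := fan uv vu' t01 (r01 _ t01') E; by right.
case/orP => [/eqP c|].
  have eu : v' = v by apply: inj => //; rewrite -iuv' -iuu.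
  subst v'; rewrite flip_eq [RHS]flip_eq in E.
  have [-> h'] := fan vu vu' (r01 _ t01) (r01 _ t01') E; left; split=> //; lra.
case/orP; rewrite -(ltr0z K) rmorphM /= -!orient_pos -?iuv' -?iuu //.
- move/same_sign/(_ sc); rewrite -(orient_lerp (pos u, pos v) (pos u', pos v')) -E.
  by rewrite (orient_lerp (pos u, pos v)) orient_end1 orient_end2 !mulr0 addr0.
- move/same_sign/(_ tc); rewrite -(orient_lerp (pos u', pos v') (pos u, pos v)) E.
  by rewrite (orient_lerp (pos u', pos v')) orient_end1 orient_end2 !mulr0 addr0.
Qed.

End DisjointCopies.

Local Close Scope classical_set_scope.

(** * Finite commutative rings *)

Section Places.
Variable R : finComUnitRingType.
Implicit Types x y z e f g : R.

(** Raising to this power sends every element to an idempotent. *)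
Definition idem_exp : nat := (#|R|)`!.

Definition is_nilpotent x := x ^+ idem_exp == 0.

Lemma idem_exp_gt0 : (0 < idem_exp)%N. Proof. exact: fact_gt0. Qed.

(** The powers of [x] are eventually periodic, and the exponent is a multiple of
    the period that lies beyond the preperiod. *)
Lemma expr_idem_exp x : x ^+ idem_exp * x ^+ idem_exp = x ^+ idem_exp.
Proof.
have [i [j [ij jR eij]]] : exists i j, [/\ (i < j)%N, (j <= #|R|)%N & x ^+ i = x ^+ j].
  pose F (i : 'I_(#|R|.+1)) := x ^+ i.
  have /injectivePn[a [b ab eab]] : ~~ injectiveb F.
    apply/injectiveP => /leq_card; rewrite card_ord ltnn; exact: notF.
  have [lt|gt] := ltnP a b; first by exists a, b; split=> //; rewrite -ltnS.
  exists b, a; split; [|by rewrite -ltnS|by []].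
  by rewrite ltn_neqAle gt andbT eq_sym; apply: contra ab => /eqP/val_inj->.
pose p := (j - i)%N.
have step n : (i <= n)%N -> x ^+ (n + p) = x ^+ n.
  move=> le; have -> : (n + p = (n - i) + j)%N by rewrite /p; lia.
  by rewrite exprD -eij -exprD subnK.
have steps n m : (i <= n)%N -> x ^+ (n + m * p) = x ^+ n.
  move=> le; elim: m => [|m IH]; first by rewrite mul0n addn0.
  by rewrite mulSnr addnA step ?IH // (leq_trans le) // leq_addr.
have pE : (p %| idem_exp)%N.
  by apply: dvdn_fact; rewrite /p subn_gt0 ij (leq_trans (leq_subr _ _)).
have iE : (i <= idem_exp)%N.
  rewrite (leq_trans (ltnW ij)) // (leq_trans jR) // /idem_exp.
  have : (0 < #|R|)%N by apply/card_gt0P; exists 0.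
  by case: #|R| => // n _; rewrite factS leq_pmulr // fact_gt0.
by rewrite -exprD -{2}(divnK pE) steps.
Qed.

Lemma expr_of_idem e n : e * e = e -> (0 < n)%N -> e ^+ n = e.
Proof. by move=> ee; elim: n => // -[|n] IH _; rewrite ?expr1 // exprS IH. Qed.

Lemma nilpotent0 : is_nilpotent 0.
Proof. by rewrite /is_nilpotent expr0n eqn0Ngt idem_exp_gt0. Qed.

Lemma nilpotent_mulr x y : is_nilpotent x -> is_nilpotent (x * y).
Proof. by rewrite /is_nilpotent exprMn => /eqP->; rewrite mul0r. Qed.

Lemma nilpotentN x : is_nilpotent (- x) = is_nilpotent x.
Proof.
by apply/idP/idP => h; [rewrite -[x]opprK|]; rewrite -mulrN1 nilpotent_mulr.
Qed.

(** The primitive idempotents; they correspond to the local factors of the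
    ring, hence to its maximal ideals. *)
Definition places : {set R} := [set e | [&& e * e == e, e != 0 &
  [forall f, (f * f == f) ==> ((e * f == e) || (e * f == 0))]]].

Lemma place_idem e : e \in places -> e * e = e.
Proof. by rewrite inE => /and3P[/eqP]. Qed.

Lemma place_neq0 e : e \in places -> e != 0.
Proof. by rewrite inE => /and3P[]. Qed.

Lemma place_minimal e f : e \in places -> f * f = f -> e * f = e \/ e * f = 0.
Proof.
rewrite inE => /and3P[_ _ /forallP/(_ f)] /[swap] ff; rewrite ff eqxx /=.
by case/orP => /eqP; [left|right].
Qed.

Lemma place_orth e f : e \in places -> f \in places -> e != f -> e * f = 0.
Proof.
move=> Pe Pf ne; case: (place_minimal Pe (place_idem Pf)) => // ef.
case: (place_minimal Pf (place_idem Pe)) => fe; last by rewrite mulrC.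
by case/eqP: ne; rewrite -ef mulrC.
Qed.

Lemma place_below f : f * f = f -> f != 0 -> exists2 e, e \in places & e * f = e.
Proof.
have [n] := ubnP #|[set x * f | x : R]|; elim: n f => // n IH f lt ff f0.
have [Pf|nPf] := boolP (f \in places); first by exists f.
move: nPf; rewrite inE ff eqxx f0 /= => /forallPn[g].
rewrite negb_imply negb_or => /and3P[/eqP gg fgf fg0].
have [] := IH (f * g).
- move: lt; rewrite ltnS; apply: leq_trans; apply: proper_card; apply/properP; split.
    by apply/fintype.subsetP => _ /imsetP[x _ ->]; apply/imsetP; exists (x * g) => //; rewrite -mulrA (mulrC g).
  exists f; first by apply/imsetP; exists 1 => //; rewrite mul1r.
  apply/negP => /imsetP[x _ e]; move/eqP: fgf; apply.
  by rewrite [in LHS]e -mulrA -(mulrA f) gg -e.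
- by rewrite mulrACA ff gg.
- by [].
move=> e Pe efg; exists e => //; rewrite -efg -mulrA (mulrC f) -!mulrA ff.
by rewrite (mulrC g).
Qed.

(** The difference to one is an idempotent below which there is no place. *)
Lemma sum_places : \sum_(e in places) e = 1.
Proof.
pose s := \sum_(e in places) e; rewrite -/s.
have es e : e \in places -> e * s = e.
  move=> Pe; rewrite /s (bigD1 e) //= mulrDr (place_idem Pe) mulr_sumr big1 ?addr0 //.
  by move=> f /andP[Pf fe]; rewrite place_orth // eq_sym.
have ss : s * s = s by rewrite {1}/s mulr_suml; apply: eq_bigr => e /es.
apply/eqP; rewrite eq_sym -subr_eq0; apply/negPn/negP => n0.
have [|e Pe] := @place_below (1 - s) _ n0.
  by rewrite mulrBr mulr1 mulrBl mul1r ss subrr subr0.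
rewrite mulrBr mulr1 es // subrr => e0.
by have := place_neq0 Pe; rewrite -e0 eqxx.
Qed.

Lemma place_split x : x = \sum_(e in places) e * x.
Proof. by rewrite -mulr_suml sum_places mul1r. Qed.

Lemma eq_places x y : (forall e, e \in places -> e * x = e * y) -> x = y.
Proof. by move=> h; rewrite (place_split x) (place_split y); apply: eq_bigr. Qed.

Lemma places_neq0 : exists e, e \in places.
Proof. by have [e Pe _] := place_below (mulr1 1) (oner_neq0 R); exists e. Qed.

(** In the local factor of [e] an element is either nilpotent or invertible, so
    this is the maximal ideal of that factor, pulled back to the ring. *)
Definition maxid e : {set R} := [set x | is_nilpotent (e * x)].

Lemma maxidP e x : e \in places -> reflect (exists z, e * x * z = e) (x \notin maxid e).
Proof.
move=> Pe; have ee := place_idem Pe; rewrite inE.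
have eE : (e * x) ^+ idem_exp = e * x ^+ idem_exp.
  by rewrite exprMn (expr_of_idem ee idem_exp_gt0).
apply: (iffP idP) => [|[z ez]].
  rewrite /is_nilpotent eE; case: (place_minimal Pe (expr_idem_exp x)) => [h _|->]; last by rewrite eqxx.
  exists (x ^+ idem_exp.-1); rewrite -mulrA -exprS prednK ?idem_exp_gt0 //.
rewrite /is_nilpotent; apply/eqP => h; have := place_neq0 Pe.
by rewrite -(expr_of_idem ee idem_exp_gt0) -ez exprMn h mul0r eqxx.
Qed.

Lemma maxid0 e : 0 \in maxid e.
Proof. by rewrite inE mulr0 nilpotent0. Qed.

Lemma maxidM e x y : x \in maxid e -> x * y \in maxid e.
Proof. by rewrite !inE mulrA; exact: nilpotent_mulr. Qed.

Lemma maxidN e x : (- x \in maxid e) = (x \in maxid e).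
Proof. by rewrite !inE mulrN nilpotentN. Qed.

(** If [e] is a sum of a nilpotent [t] and of [e - t], the latter is invertible
    by the geometric series. *)
Lemma maxidD e x y : e \in places -> x \in maxid e -> y \in maxid e -> x + y \in maxid e.
Proof.
move=> Pe xM yM; apply/negPn/negP => /(maxidP _ Pe)[z ez].
have ee := place_idem Pe.
pose t := e * x * z; pose n := idem_exp.
have tn : t ^+ n = 0 by move: xM; rewrite inE => /(nilpotent_mulr z)/eqP.
have et : e * t = t by rewrite /t !mulrA ee.
have yt : e * y * z = e - t by rewrite /t -[X in X - _]ez mulrDr mulrDl addrAC subrr add0r.
suff /negP : y \notin maxid e by []; apply/(maxidP _ Pe).
exists (z * (\sum_(i < n) e ^+ (n.-1 - i) * t ^+ i)); rewrite mulrA yt -subrXX tn subr0.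
by rewrite (expr_of_idem ee idem_exp_gt0).
Qed.

Lemma maxidB e x y : e \in places -> x \in maxid e -> y \in maxid e -> x - y \in maxid e.
Proof. by move=> Pe xM yM; apply: maxidD; rewrite ?maxidN. Qed.

Lemma maxid_prime e x y : e \in places ->
  x \notin maxid e -> y \notin maxid e -> x * y \notin maxid e.
Proof.
move=> Pe /(maxidP _ Pe)[z ez] /(maxidP _ Pe)[w ew]; apply/(maxidP _ Pe).
exists (z * w); have -> : e * (x * y) * (z * w) = (e * x * z) * (y * w) by ring.
by rewrite ez mulrA.
Qed.

Lemma maxid1 e : e \in places -> 1 \notin maxid e.
Proof. by move=> Pe; apply/(maxidP _ Pe); exists 1; rewrite !mulr1. Qed.

Lemma maxid_local e x y : e * x = e * y -> (x \in maxid e) = (y \in maxid e).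
Proof. by rewrite !inE => ->. Qed.

Lemma unit_places x : (x \is a GRing.unit) = [forall e in places, x \notin maxid e].
Proof.
apply/idP/forallP => [ux e|h].
  by apply/implyP => Pe; apply/(maxidP _ Pe); exists x^-1; rewrite mulrK.
have Z e : exists z, e \in places -> e * x * z = e.
  have /implyP := h e; case: (boolP (e \in places)) => [Pe /(_ isT)|_ _]; last by exists 0.
  by case/(maxidP _ Pe) => z ez; exists z.
pose z := \sum_(e in places) e * projT1 (cid (Z e)).
have xz : x * z = 1.
  rewrite /z mulr_sumr -sum_places; apply: eq_bigr => e Pe.
  by rewrite mulrCA mulrA; exact: (projT2 (cid (Z e)) Pe).
by apply/unitrPr; exists z.
Qed.

Lemma nilpotent_places x : is_nilpotent x = [forall e in places, x \in maxid e].
Proof.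
apply/idP/forallP => [nx e|h].
  by apply/implyP => _; rewrite inE mulrC nilpotent_mulr.
rewrite /is_nilpotent -[_ ^+ _]mul1r -sum_places mulr_suml big1 // => e Pe.
have /implyP/(_ Pe) := h e; rewrite inE /is_nilpotent exprMn.
by rewrite (expr_of_idem (place_idem Pe) idem_exp_gt0) => /eqP.
Qed.

Definition nilradical : {set R} := [set x | is_nilpotent x].

End Places.

Section Cosets.
Variables (R : finComUnitRingType) (H : {set R}).
Hypotheses (H0 : 0 \in H) (HB : forall x y, x \in H -> y \in H -> x - y \in H).

Definition coset_rep (x : R) : R := odflt 0 [pick y | x - y \in H].

Lemma coset_rep_sub x : x - coset_rep x \in H.
Proof.
rewrite /coset_rep; case: pickP => [y //|/(_ x)].
by rewrite subrr H0.
Qed.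

Lemma subgroupN x : x \in H -> - x \in H.
Proof. by move=> hx; rewrite -sub0r HB. Qed.

Lemma subgroupD x y : x \in H -> y \in H -> x + y \in H.
Proof. by move=> hx hy; rewrite -[y]opprK HB // subgroupN. Qed.

Lemma coset_rep_eq x y : (coset_rep x == coset_rep y) = (x - y \in H).
Proof.
apply/eqP/idP => [e|h].
  have := HB (coset_rep_sub x) (coset_rep_sub y); rewrite e.
  by rewrite opprB addrA subrK.
rewrite /coset_rep; congr (odflt _ _); apply: eq_pick => z /=.
apply/idP/idP => h'.
  by have := HB h' h; have -> : x - z - (x - y) = y - z by ring.
by have := subgroupD h' h; have -> : y - z + (x - y) = x - z by ring.
Qed.

Lemma coset_repK x : coset_rep (coset_rep x) = coset_rep x.
Proof.
apply/eqP; rewrite coset_rep_eq -opprB subgroupN //.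
exact: coset_rep_sub.
Qed.

Definition transversal_of (L : {set R}) : {set R} := coset_rep @: L.

Lemma card_le_transversal (L : {set R}) : (#|L| <= #|transversal_of L| * #|H|)%N.
Proof.
rewrite -cardsX; apply: leq_trans (leq_imset_card (fun x => x.1 + x.2) _).
apply: subset_leq_card; apply/fintype.subsetP => x xL; apply/imsetP.
exists (coset_rep x, x - coset_rep x); last by rewrite /= addrC subrK.
by rewrite finset.in_setX /= coset_rep_sub andbT imset_f.
Qed.

Lemma card_cosets_le (A : seq R) (L : {set R}) : uniq (map coset_rep A) ->
  (forall x, coset_rep x \in map coset_rep A -> x \in L) -> (size A * #|H| <= #|L|)%N.
Proof.
move=> uA AL; pose F (x : R * R) := x.1 + x.2.
pose AH := finset.setX [set x in A] H.
have inj : {in AH &, injective F}.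
  move=> [a h] [b g] /=; rewrite !finset.in_setX !inE /= => /andP[aA hH] /andP[bA gH] E.
  have ab : a = b.
    have /eqP : coset_rep a == coset_rep b.
      rewrite coset_rep_eq; have -> : a - b = g - h by rewrite -(addrK h a) -[a + h]/(F (a, h)) E /F /=; ring.
      exact: HB.
    have nthA x : x \in A -> nth 0 (map coset_rep A) (index x A) = coset_rep x.
      by move=> xA; rewrite (nth_map 0) ?index_mem // nth_index.
    rewrite -(nthA a) // -(nthA b) // => /eqP.
    rewrite nth_uniq ?size_map ?index_mem // => /eqP e.
    by rewrite -(nth_index 0 aA) e nth_index.
  by move: E; rewrite /F /= ab => /addrI->.
have -> : size A = #|[set x in A]|.
  by rewrite cardsE; apply/esym/card_uniqP; apply: map_uniq uA.
rewrite -cardsX -(card_in_imset inj); apply: subset_leq_card.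
apply/fintype.subsetP => _ /imsetP[[a h] + ->]; rewrite finset.in_setX inE /= => /andP[aA hH].
apply: AL; apply/mapP; exists a => //; apply/eqP.
by rewrite coset_rep_eq /F /= addrAC subrr add0r.
Qed.

End Cosets.

(** * Packing cores in the graph of a ring *)

(** At a place with [q] residues, the relation [x + s * y] being invertible has a
    matching that leaves out at most one residue class.  Matched classes keep
    the two sides of the cores disjoint. *)
Section Matching.
Variable R : finComUnitRingType.
Implicit Types (e f s x y : R) (ps : seq (R * R)).

Local Notation cls f := (coset_rep (maxid f)).

Lemma cls_eq f x y : f \in places R -> (cls f x == cls f y) = (x - y \in maxid f).
Proof. by move=> Pf; apply: coset_rep_eq; [exact: maxid0|move=> ? ?; exact: maxidB]. Qed.

Definition residues f : {set R} := transversal_of (maxid f) [set: R].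

Lemma residues_gt1 f : f \in places R -> (1 < #|residues f|)%N.
Proof.
move=> Pf; apply/card_gt1P; exists (cls f 0), (cls f 1); split.
- exact: imset_f.
- exact: imset_f.
by rewrite cls_eq // sub0r maxidN maxid1.
Qed.

Definition pair_entries ps := unzip1 ps ++ unzip2 ps.

Definition matching_at f s ps :=
  uniq (map (cls f) (pair_entries ps)) /\
  forall p, p \in ps -> p.1 + s * p.2 \notin maxid f.

(** A class is unrelated to at most one class, and [0] only to itself; so of
    any three non-zero classes the first can be matched with one of the others,
    while [0] is kept as a partner for the last one. *)
Lemma matching_in f s (W : seq R) : f \in places R -> s \is a GRing.unit ->
  uniq (map (cls f) (0 :: W)) ->
  exists ps, [/\ matching_at f s ps, {subset pair_entries ps <= 0 :: W}
               & (size W <= 2 * size ps)%N].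
Proof.
move=> Pf us; have sM : s \notin maxid f.
  by move: us; rewrite unit_places => /forallP/(_ f)/implyP; apply.
have [n] := ubnP (size W); elim: n W => // n IH [|a W] lt uW.
  by exists [::]; split.
have nz w : w \in a :: W -> w \notin maxid f.
  move=> wW; apply/negP => wM; move: uW; rewrite map_cons cons_uniq => /andP[/negP h _].
  by apply: h; apply/mapP; exists w => //; apply/eqP; rewrite cls_eq // sub0r maxidN.
have pair0 : exists ps, [/\ matching_at f s ps, {subset pair_entries ps <= 0 :: a :: W}
    & size ps = 1].
  exists [:: (0, a)]; split=> //; first split.
  - apply: (subseq_uniq _ uW); rewrite /pair_entries /= !eqxx sub0seq //.
  - move=> p; rewrite inE => /eqP-> /=; rewrite add0r.
    by apply: maxid_prime => //; apply: nz; rewrite mem_head.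
  - by move=> x; rewrite !inE => /orP[/eqP->|/eqP->]; rewrite eqxx ?orbT.
case: W lt uW nz pair0 => [|b [|c W]] lt uW nz [ps [m1 m2 m3]].
- by exists ps; rewrite m3.
- by exists ps; rewrite m3.
have [b' [c' [pm ab]]] : exists b' c', perm_eq (b :: c :: W) (b' :: c' :: W) /\
    a + s * b' \notin maxid f.
  have [h|h] := boolP (a + s * b \in maxid f); last by exists b, c.
  exists c, b; split; first by rewrite (perm_catCA [:: b] [:: c] W).
  apply/negP => h'; move: uW; rewrite !map_cons !cons_uniq !inE !negb_or.
  move=> /and5P[_ _ /andP[/negP bc _] _ _]; apply: bc; rewrite cls_eq //.
  have := maxidB Pf h h'; have -> : a + s * b - (a + s * c) = s * (b - c) by ring.
  apply: contraLR; exact: maxid_prime.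
have pm2 : perm_eq [:: 0, a, b, c & W] [:: a, b', 0, c' & W].
  apply: (@perm_trans _ [:: 0, a, b', c' & W]); first by rewrite !perm_cons.
  by rewrite (perm_catCA [:: 0] [:: a; b'] (c' :: W)).
have uW2 : uniq (map (cls f) [:: a, b', 0, c' & W]).
  by rewrite -(perm_uniq (perm_map (cls f) pm2)).
have [|| qs [[q1 q2] q3 q4]] := IH (c' :: W).
- by move: lt => /=; rewrite !ltnS => /ltnW.
- by move: uW2; rewrite 2!map_cons 2!cons_uniq => /and3P[].
have pe : perm_eq (pair_entries ((a, b') :: qs)) [:: a, b' & pair_entries qs].
  by rewrite /pair_entries /= perm_cons -cat1s perm_catCA.
exists ((a, b') :: qs); split; first split.
- rewrite (perm_uniq (perm_map (cls f) pe)) 2!map_cons 2!cons_uniq.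
  have U := uW2; rewrite 2!map_cons 2!cons_uniq in_cons negb_or in U.
  have /and3P[/andP[n1 n2] n3 _] := U.
  rewrite in_cons negb_or n1 q1 andbT /=; apply/andP; split.
    by apply: contra n2 => /mapP[x /q3 xW ->]; exact: map_f.
  by apply: contra n3 => /mapP[x /q3 xW ->]; exact: map_f.
- by move=> p; rewrite inE => /orP[/eqP->//|]; exact: q2.
- move=> x; rewrite (perm_mem pm2) (perm_mem pe) !in_cons.
  by case/or3P => [->|->|/q3]; rewrite ?orbT // in_cons => ->; rewrite !orbT.
- by move: q4 => /=; rewrite mulnS; lia.
Qed.

Lemma matching_exists f s : f \in places R -> s \is a GRing.unit ->
  exists2 ps, matching_at f s ps & (#|residues f| <= 2 * size ps + 1)%N.
Proof.
move=> Pf us; pose W := rem (cls f 0) (enum (residues f)).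
have idem x : cls f (cls f x) = cls f x.
  by apply: coset_repK; [exact: maxid0|move=> ? ?; exact: maxidB].
have r0 : cls f 0 \in enum (residues f) by rewrite mem_enum imset_f.
have pm := perm_to_rem r0.
have clsr x : x \in enum (residues f) -> cls f x = x.
  by rewrite mem_enum => /imsetP[y _ ->].
have uW : uniq (map (cls f) (0 :: W)).
  have -> : map (cls f) (0 :: W) = cls f 0 :: W.
    rewrite map_cons; congr (_ :: _); rewrite -[RHS]map_id.
    by apply/eq_in_map => x /mem_rem; exact: clsr.
  by rewrite -(perm_uniq pm) enum_uniq.
have [ps [m _ sz]] := matching_in Pf us uW; exists ps => //.
move: sz; rewrite size_rem // -cardE.
by have := residues_gt1 Pf; lia.
Qed.

Lemma card_residues f : (#|R| <= #|residues f| * #|maxid f|)%N.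
Proof. by rewrite -cardsT; apply: card_le_transversal; exact: maxid0. Qed.

End Matching.

Section CoreCount.
Variables (R : finComUnitRingType) (S : {set R}) (K : realType) (k : nat).
Hypothesis admS : admissible S.
Hypothesis emb : embeds_in K (Gamma S) (sphere_with_crosscaps K k).
Variables (s f : R) (E : {set R}) (ps : seq (R * R)).
Hypotheses (sS : s \in S) (Pf : f \in places R) (EP : {subset E <= places R}).
Hypotheses (fE : f \notin E) (psM : matching_at f s ps).

Local Notation cls := (coset_rep (maxid f)).

(** The elements that are nilpotent outside the local factors of [E].  In a
    coset of this subgroup and its image under the map [partner] below,
    adjacency depends on the residues at [E] only. *)
Definition core_block : {set R} :=
  [set h | [forall g in places R, (g \notin E) ==> (h \in maxid g)]].

Lemma core_blockP h : reflect
  (forall g, g \in places R -> g \notin E -> h \in maxid g) (h \in core_block).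
Proof.
rewrite inE; apply: (iffP forallP) => [H g Pg gE|H g].
  by have /implyP/(_ Pg)/implyP/(_ gE) := H g.
by apply/implyP => Pg; apply/implyP; exact: H.
Qed.

Let us : s \is a GRing.unit. Proof. by case: admS => _ h _; exact: h. Qed.
Let H0 : 0 \in core_block. Proof. by apply/core_blockP => g _ _; exact: maxid0. Qed.
Let HB x y : x \in core_block -> y \in core_block -> x - y \in core_block.
Proof.
move=> /core_blockP hx /core_blockP hy; apply/core_blockP => g Pg gE.
by apply: maxidB; [|exact: hx|exact: hy].
Qed.

Let left : {set R} := [set x | cls x \in map cls (unzip1 ps)].
Let pos x := index (cls x) (map cls (unzip1 ps)).
Let p1 x := nth 0 (unzip1 ps) (pos x).
Let p2 x := nth 0 (unzip2 ps) (pos x).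
Let shift x := p2 x - p1 x.
Let eps := \sum_(e in E) e.

(** The partner of a left vertex: its opposite, up to [s], at the places of
    [E], in the matched class at [f], and such that the sum with it is one at
    all other places. *)
Let partner x := - eps * s^-1 * x + f * (x + shift x)
  + (1 - eps - f) * s^-1 * (1 - x).

Let eps_in e : e \in E -> e * eps = e.
Proof.
move=> eE; rewrite /eps (bigD1 e) //= mulrDr (place_idem (EP eE)) mulr_sumr big1 ?addr0 //.
by move=> g /andP[gE ge]; rewrite place_orth ?EP // eq_sym.
Qed.

Let eps_out g : g \in places R -> g \notin E -> g * eps = 0.
Proof.
move=> Pg gE; rewrite /eps mulr_sumr big1 // => e eE.
by rewrite (place_orth Pg (EP eE)) //; apply: contra gE => /eqP->.
Qed.

Let fE_mul e : e \in E -> e * f = 0.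
Proof. by move=> eE; rewrite (place_orth (EP eE) Pf) //; apply: contra fE => /eqP<-. Qed.

Let partner_core e x : e \in E -> e * partner x = e * (- s^-1 * x).
Proof.
move=> eE; rewrite /partner.
have -> : e * (- eps * s^-1 * x + f * (x + shift x) + (1 - eps - f) * s^-1 * (1 - x))
  = (e * eps) * (- s^-1 * x) + (e * f) * (x + shift x)
    + (e - e * eps - e * f) * (s^-1 * (1 - x)) by ring.
by rewrite eps_in // fE_mul // subrr subr0 !mul0r !addr0.
Qed.

Let partner_match x : f * partner x = f * (x + shift x).
Proof.
rewrite /partner.
have -> : f * (- eps * s^-1 * x + f * (x + shift x) + (1 - eps - f) * s^-1 * (1 - x))
  = (f * eps) * (- s^-1 * x) + (f * f) * (x + shift x)
    + (f - f * eps - f * f) * (s^-1 * (1 - x)) by ring.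
by rewrite eps_out // place_idem // subr0 subrr !mul0r addr0 add0r.
Qed.

Let partner_other g x : g \in places R -> g \notin E -> g != f ->
  g * partner x = g * (s^-1 * (1 - x)).
Proof.
move=> Pg gE gf; rewrite /partner.
have -> : g * (- eps * s^-1 * x + f * (x + shift x) + (1 - eps - f) * s^-1 * (1 - x))
  = (g * eps) * (- s^-1 * x) + (g * f) * (x + shift x)
    + (g - g * eps - g * f) * (s^-1 * (1 - x)) by ring.
by rewrite eps_out // (place_orth Pg Pf gf) !subr0 !mul0r !add0r.
Qed.

Let pos_lt x : x \in left -> (pos x < size ps)%N.
Proof. by rewrite inE -index_mem !size_map. Qed.

Let cls_p1 x : x \in left -> cls x = cls (p1 x).
Proof.
move=> xL; rewrite /p1 -(nth_map 0 (cls 0)) ?size_map ?pos_lt //.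
by rewrite nth_index //; move: xL; rewrite inE.
Qed.

Let entries_uniq : uniq (map cls (pair_entries ps)). Proof. by case: psM. Qed.

Let cls_partner x : x \in left -> cls (partner x) = cls (p2 x).
Proof.
move=> xL; apply/eqP; rewrite cls_eq //.
rewrite (@maxid_local _ f _ (x - p1 x)) //; last first.
  by rewrite !mulrBr partner_match /shift; ring.
by rewrite -cls_eq // (cls_p1 xL).
Qed.

Let p1_p2 x y : x \in left -> y \in left -> cls (p1 x) != cls (p2 y).
Proof.
move=> xL yL; move: entries_uniq; rewrite map_cat cat_uniq => /and3P[_ /hasPn h _].
apply/negP => /eqP E'; have := h (cls (p2 y)).
rewrite map_f ?mem_nth ?size_map ?pos_lt // => /(_ isT) /negP; apply.
by rewrite /= -E' map_f // mem_nth ?size_map ?pos_lt.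
Qed.

Let p2_inj x y : x \in left -> y \in left -> cls (p2 x) = cls (p2 y) -> pos x = pos y.
Proof.
move=> xL yL; move: entries_uniq; rewrite map_cat cat_uniq => /and3P[_ _ u].
rewrite /p2 -!(nth_map 0 (cls 0) cls) ?size_map ?pos_lt // => /eqP.
by rewrite nth_uniq ?size_map ?pos_lt // => /eqP.
Qed.

Let partner_notin x y : x \in left -> y \in left -> x <> partner y.
Proof.
move=> xL yL E'; have := p1_p2 xL yL.
by rewrite -(cls_p1 xL) E' cls_partner // eqxx.
Qed.

Let unit_inj g x y : g * (s^-1 * x) = g * (s^-1 * y) -> g * x = g * y.
Proof.
move=> E'; have := congr1 ( *%R s) E'.
by rewrite !(mulrCA g) !mulVKr.
Qed.

Let partner_inj x y : x \in left -> y \in left -> partner x = partner y -> x = y.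
Proof.
move=> xL yL E'; apply: eq_places => g Pg.
have [gE|gE] := boolP (g \in E).
  have := partner_core x gE; rewrite E' partner_core // !mulNr !mulrN => /oppr_inj.
  by move/esym; exact: unit_inj.
have [->|gf] := eqVneq g f.
  have := partner_match x; rewrite E' partner_match.
  have -> : shift y = shift x.
    by rewrite /shift /p1 /p2 (p2_inj xL yL) // -!cls_partner // E'.
  by rewrite !mulrDr => /addIr.
have := partner_other x Pg gE gf; rewrite E' partner_other //.
by move/unit_inj; rewrite !mulrBr => /addrI/oppr_inj.
Qed.

Let left_shift x h : x \in left -> h \in core_block -> x + h \in left.
Proof.
move=> xL hH; move: xL; rewrite !inE; suff -> : cls (x + h) = cls x by [].
apply/eqP; rewrite cls_eq // addrAC subrr add0r.
exact: (core_blockP _ hH).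
Qed.

Let adjacent x y : x \in left -> y \in left -> x - y \in core_block ->
  (forall e, e \in E -> x - y \notin maxid e) -> Gamma S x (partner y).
Proof.
move=> xL yL /core_blockP xyH xyE; rewrite /Gamma.
apply/andP; split; first by apply/eqP; exact: partner_notin.
apply/existsP; exists s; rewrite sS unit_places; apply/forallP => g; apply/implyP => Pg.
have [gE|gE] := boolP (g \in E).
  have sy : s * (- s^-1 * y) = - y by rewrite mulNr mulrN mulVKr.
  rewrite (@maxid_local _ g _ (x - y)) ?xyE //.
  by rewrite mulrDr mulrCA partner_core // mulrCA sy -mulrDr.
have [->|gf] := eqVneq g f.
  have pr : p1 y + s * p2 y \notin maxid f.
    have := (psM.2 (nth (0, 0) ps (pos y))); rewrite mem_nth ?pos_lt // => /(_ isT).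
    by rewrite /p1 /p2 -!(nth_map (0, 0) 0) ?pos_lt.
  have py : y - p1 y \in maxid f by rewrite -cls_eq // (cls_p1 yL).
  have xy : x - y \in maxid f by apply: xyH.
  apply: contra pr.
  rewrite (@maxid_local _ f _ (x + s * (y + shift y))) //; last first.
    by rewrite mulrDr mulrCA partner_match mulrCA -mulrDr.
  move=> h; have h2 : x - y + (1 + s) * (y - p1 y) \in maxid f.
    by apply: maxidD => //; rewrite mulrC; exact: maxidM.
  have := maxidB Pf h h2.
  suff -> : x + s * (y + shift y) - (x - y + (1 + s) * (y - p1 y)) =
    p1 y + s * p2 y by [].
  by rewrite /shift; ring.
have xy : x - y \in maxid g by apply: xyH.
rewrite (@maxid_local _ g _ (1 + (x - y))) //; last first.
  by rewrite mulrDr mulrCA partner_other // (mulrCA s) mulVKr // -mulrDr; congr (_ * _); ring.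
apply/negP => h; have := maxidB Pg h xy; rewrite addrK; apply/negP.
exact: maxid1.
Qed.

(** Each coset of the block that lies in the matched left classes at [f] carries
    [#|J|] disjoint cores.  The matched left classes contain the proportion
    [size ps] to [#|residues f|] of the ring, so the numerical hypothesis says
    that there is at least one core for every 32 elements. *)
Theorem core_count (m : nat) (r : rel nat) (J : finType) (eta : J -> nat -> R) :
  nonplanar_core m r ->
  (forall j a, (a < m)%N -> eta j a \in core_block) ->
  (forall j j' a a', (a < m)%N -> (a' < m)%N -> eta j a = eta j' a' -> j = j' /\ a = a') ->
  (forall j a a' e, (a < m)%N -> (a' < m)%N -> r a a' -> e \in E ->
     eta j a - eta j a' \notin maxid e) ->
  (#|residues f| * #|core_block| <= 32 * size ps * #|J|)%N -> (0 < size ps)%N ->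
  (#|R| <= 32 * k)%N.
Proof.
move=> core etaH etaI etaE bound ps0.
pose T := transversal_of core_block left.
have Tleft t : t \in T -> t \in left.
  move=> /imsetP[x xL ->].
  have -> : coset_rep core_block x = x + - (x - coset_rep core_block x) by ring.
  apply: left_shift => //; apply: (subgroupN H0 HB).
  exact: (coset_rep_sub H0).
pose I : finType := ({t | t \in T} * J)%type.
have TI (i i' : I) a a' : (a < m)%N -> (a' < m)%N ->
    val i.1 + eta i.2 a = val i'.1 + eta i'.2 a' -> i = i' /\ a = a'.
  case: i i' => [t j] [t' j'] /= am am' E'.
  have tt : val t = val t'.
    have rep (u : {t | t \in T}) : coset_rep core_block (val u) = val u.
      by case: u => u /= /imsetP[x _ ->]; exact: coset_repK.
    rewrite -rep -[RHS]rep; apply/eqP; rewrite coset_rep_eq //.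
    have -> : val t - val t' = eta j' a' - eta j a.
      move: (E' : val t + eta j a = val t' + eta j' a').
      move: (val t) (val t') (eta j a) (eta j' a') => u u' v v' E''.
      by rewrite -(addrK v u) E''; ring.
    by apply: HB; exact: etaH.
  move: E'; rewrite tt => /addrI /(etaI _ _ _ _ am am')[-> ->].
  by split=> //; congr (_, _); exact: val_inj.
pose F (i : I) a := val i.1 + eta i.2 a.
have Fleft i a : (a < m)%N -> F i a \in left.
  by move=> am; apply: left_shift; [apply: Tleft; exact: valP|exact: etaH].
have cardI : (#|I| <= k)%N.
  apply: (@bipartite_cores_le K R (Gamma S) k m r I F (fun i a => partner (F i a))) => //.
  - exact: Gamma_symmetric.
  - move=> i a b am bm rab; have E' : F i a - F i b = eta i.2 a - eta i.2 b.
      by rewrite /F; ring.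
    apply: adjacent; rewrite ?Fleft // E'; first by apply: HB; exact: etaH.
    by move=> e eE; exact: etaE.
  - by move=> i j a b am bm /partner_inj h; apply: TI => //; apply: h; exact: Fleft.
  - by move=> i j a b am bm; apply: partner_notin; exact: Fleft.
have cI : #|I| = (#|T| * #|J|)%N by rewrite card_prod card_sig.
rewrite cI in cardI.
have c1 : (size ps * #|maxid f| <= #|left|)%N.
  rewrite -(size_map fst ps).
  apply: card_cosets_le; first exact: maxid0.
  - by move=> ? ?; exact: maxidB.
  - by move: entries_uniq; rewrite map_cat cat_uniq => /and3P[].
  - by move=> x; rewrite inE.
have c2 : (#|left| <= #|T| * #|core_block|)%N by exact: (card_le_transversal H0).
have c3 := card_residues f.
rewrite -(leq_pmul2l ps0).
apply: (@leq_trans (#|residues f| * (size ps * #|maxid f|))).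
  by rewrite mulnCA leq_mul2l c3 orbT.
apply: (@leq_trans (#|residues f| * (#|T| * #|core_block|))).
  by rewrite leq_mul2l (leq_trans c1 c2) orbT.
rewrite mulnCA; apply: (@leq_trans (#|T| * (32 * size ps * #|J|))).
  by rewrite leq_mul2l bound orbT.
have -> : (#|T| * (32 * size ps * #|J|) = 32 * size ps * (#|T| * #|J|))%N.
  by rewrite mulnCA.
have -> : (size ps * (32 * k) = 32 * size ps * k)%N by rewrite mulnCA mulnA.
by rewrite leq_mul2l cardI orbT.
Qed.

End CoreCount.

(** * Rings with many disjoint non-planar subgraphs *)

Section NonplanarCases.
Variables (R : finComUnitRingType) (S : {set R}) (K : realType) (k : nat).
Hypothesis admS : admissible S.
Hypothesis emb : embeds_in K (Gamma S) (sphere_with_crosscaps K k).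
Implicit Types (e f g s x y : R).

Local Notation N := (nilradical R).

Let S_unit s : s \in S -> s \is a GRing.unit.
Proof. by case: admS => _ h _; exact: h. Qed.

Let S_elt : exists s, s \in S.
Proof. by case: admS => /set0Pn. Qed.

Lemma nilradicalP x : reflect (forall g, g \in places R -> x \in maxid g) (x \in N).
Proof.
rewrite inE nilpotent_places; apply: (iffP forallP) => [h g Pg|h g].
  by have /implyP := h g; apply.
by apply/implyP; exact: h.
Qed.

Lemma core_block_empty : core_block (finset.set0 : {set R}) = N.
Proof.
apply/setP => x; apply/core_blockP/nilradicalP => h g Pg; last by move=> _; exact: h.
by apply: h => //; rewrite finset.in_set0.
Qed.

Lemma matching_size f (ps : seq (R * R)) : f \in places R ->
  (#|residues f| <= 2 * size ps + 1)%N ->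
  (0 < size ps)%N /\ (#|residues f| <= 3 * size ps)%N.
Proof. by move=> /residues_gt1; lia. Qed.

Lemma chunk_in (X : {set R}) m j a : (a < m)%N -> (j < #|X| %/ m)%N ->
  nth 0 (enum X) (m * j + a) \in X.
Proof.
move=> am jX; rewrite -mem_enum mem_nth // -cardE.
apply: (@leq_trans (m * j.+1)); first by rewrite mulnS addnC ltn_add2r.
by apply: leq_trans (leq_divM #|X| m); rewrite mulnC leq_mul2r jX orbT.
Qed.

Lemma chunk_inj (X : {set R}) m j j' a a' : (a < m)%N -> (a' < m)%N ->
  (j < #|X| %/ m)%N -> (j' < #|X| %/ m)%N ->
  nth 0 (enum X) (m * j + a) = nth 0 (enum X) (m * j' + a') -> j = j' /\ a = a'.
Proof.
have lt b i : (b < m)%N -> (i < #|X| %/ m)%N -> (m * i + b < size (enum X))%N.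
  move=> bm iX; rewrite -cardE; apply: (@leq_trans (m * i.+1)).
    by rewrite mulnS addnC ltn_add2r.
  by apply: leq_trans (leq_divM #|X| m); rewrite mulnC leq_mul2r iX orbT.
move=> am am' jX jX' /eqP; rewrite nth_uniq ?enum_uniq ?lt // => /eqP E.
have m0 : (0 < m)%N by apply: leq_trans am.
have := congr1 (divn^~ m) E; rewrite /= !(mulnC m) !divnMDl // !divn_small // !addn0.
by move=> jj; split=> //; move: E; rewrite jj => /addnI.
Qed.

Lemma leq_chunks m n c : (0 < m)%N -> (m <= n)%N -> (m + m.-1 <= c)%N ->
  (n <= c * (n %/ m))%N.
Proof.
move=> m0 mn mc; have q0 : (0 < n %/ m)%N by rewrite divn_gt0.
have lt : (n %% m <= m.-1)%N by rewrite -ltnS prednK // ltn_pmod.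
rewrite {1}(divn_eq n m); apply: leq_trans (leq_mul mc (leqnn _)).
by rewrite mulnDl (mulnC m) leq_add2l (leq_trans lt) // leq_pmulr.
Qed.

(** Adjacency is blind to nilpotents, so any three elements of a coset of the
    nilradical and any three of an adjacent coset form a core. *)
Lemma card_large_nilradical : (2 < #|N|)%N -> (#|R| <= 32 * k)%N.
Proof.
move=> N3; have [s sS] := S_elt; have [f Pf] := places_neq0 R.
have [ps psM psq] := matching_exists Pf (S_unit sS).
have [ps0 psq3] := matching_size Pf psq.
pose eta (j : 'I_(#|N| %/ 3)) a := nth 0 (enum N) (3 * j + a).
apply: (@core_count R S K k admS emb s f finset.set0 ps sS Pf _ _ psM 3 pattern_all _ eta) => //.
- by move=> x; rewrite finset.in_set0.
- by rewrite finset.in_set0.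
- exact: core_all.
- by move=> j a am; rewrite core_block_empty; apply: chunk_in.
- move=> j j' a a' am am' /chunk_inj[] // jj ->; split=> //; exact: val_inj.
- by move=> j a a' e _ _ _; rewrite finset.in_set0.
- rewrite core_block_empty card_ord.
  have h := @leq_chunks 3 #|N| 5 isT N3 isT.
  apply: leq_trans (leq_mul psq3 h) _.
  by move: (size ps) (#|N| %/ 3)%N => a b; nia.
Qed.

Lemma residue_inj g x y : g \in places R -> x \in residues g -> y \in residues g ->
  x - y \in maxid g -> x = y.
Proof.
move=> Pg /imsetP[x' _ ->] /imsetP[y' _ ->].
have idem z : coset_rep (maxid g) (coset_rep (maxid g) z) = coset_rep (maxid g) z.
  by apply: coset_repK; [exact: maxid0|move=> ? ?; exact: maxidB].
by rewrite -cls_eq // !idem => /eqP.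
Qed.

Lemma local_maxid e g x : e \in places R -> g \in places R -> g != e -> e * x \in maxid g.
Proof.
by move=> Pe Pg ge; rewrite (@maxid_local _ g _ 0) ?maxid0 // mulr0 mulrA (place_orth Pg Pe ge) mul0r.
Qed.

Lemma local_maxid_self e x : e \in places R -> (e * x \in maxid e) = (x \in maxid e).
Proof. by move=> Pe; apply: maxid_local => //; rewrite mulrA place_idem. Qed.

(** Passing to the residues at [E], a block is a product of residue fields and
    of the nilradical. *)
Lemma card_core_block1 e : e \in places R ->
  (#|core_block [set e]| <= #|residues e| * #|N|)%N.
Proof.
move=> Pe; rewrite -cardsX.
pose F (h : R) := (coset_rep (maxid e) h, h - e * coset_rep (maxid e) h).
have inj : injective F by move=> h h' [-> /addIr].
rewrite -(card_imset _ inj); apply: subset_leq_card.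
apply/fintype.subsetP => _ /imsetP[h /core_blockP hH ->].
rewrite finset.in_setX /= imset_f //=; apply/nilradicalP => g Pg.
have [->|ge] := eqVneq g e.
  rewrite (@maxid_local _ e _ (h - coset_rep (maxid e) h)) //.
    by rewrite (coset_rep_sub (maxid0 e)).
  by rewrite !mulrBr mulrA place_idem.
by apply: maxidB => //; [apply: hH => //; rewrite finset.in_set1|exact: local_maxid].
Qed.

Lemma card_core_block2 e1 e2 : e1 \in places R -> e2 \in places R ->
  #|N| = 1%N ->
  (#|core_block [set e1; e2]| <= #|residues e1| * #|residues e2|)%N.
Proof.
move=> P1 P2 N1; rewrite -cardsX.
pose F (h : R) := (coset_rep (maxid e1) h, coset_rep (maxid e2) h).
have inj : {in core_block [set e1; e2] &, injective F}.
  move=> h h' /core_blockP hH /core_blockP hH' [/eqP c1 /eqP c2].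
  rewrite cls_eq // in c1; rewrite cls_eq // in c2.
  have n0 : 0 \in N by rewrite inE nilpotent0.
  have /cards1P[z Nz] : #|N| == 1%N by rewrite N1.
  have hN : h - h' \in N.
    apply/nilradicalP => g Pg; have [->//|n1] := eqVneq g e1.
    have [->//|n2] := eqVneq g e2.
    have gn : g \notin [set e1; e2] by rewrite finset.in_set2 negb_or n1.
    by apply: maxidB => //; [exact: hH|exact: hH'].
  move: n0 hN; rewrite Nz !finset.in_set1 => /eqP<- /eqP.
  exact: subr0_eq.
rewrite -(card_in_imset inj); apply: subset_leq_card.
by apply/fintype.subsetP => _ /imsetP[h _ ->]; rewrite finset.in_setX !imset_f.
Qed.

Lemma nilradical_trivial x : #|N| = 1%N -> (forall g, g \in places R -> x \in maxid g) -> x = 0.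
Proof.
move=> N1 /nilradicalP; have n0 : 0 \in N by rewrite inE nilpotent0.
have /cards1P[z Nz] : #|N| == 1%N by rewrite N1.
by move: n0; rewrite Nz !finset.in_set1 => /eqP<- /eqP.
Qed.

(** Vertices with different residues at [e] are joined, up to the partner map. *)
Lemma card_large_residue e f : #|N| = 1%N -> e \in places R -> f \in places R ->
  f != e -> (4 < #|residues e|)%N -> (#|R| <= 32 * k)%N.
Proof.
move=> N1 Pe Pf fe q5; have [s sS] := S_elt.
have [ps psM psq] := matching_exists Pf (S_unit sS).
have [ps0 psq3] := matching_size Pf psq.
set H := core_block [set e].
have H5 : (4 < #|H|)%N.
  apply: leq_trans q5 _; rewrite -(card_in_imset (f := fun x => e * x) (D := residues e)).
    apply: subset_leq_card; apply/fintype.subsetP => _ /imsetP[x _ ->].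
    by apply/core_blockP => g Pg; rewrite finset.in_set1 => ge; exact: local_maxid.
  move=> x y xr yr E; apply: (residue_inj Pe xr yr).
  by rewrite -(local_maxid_self _ Pe) mulrBr E subrr maxid0.
pose eta (j : 'I_(#|H| %/ 5)) a := nth 0 (enum H) (5 * j + a).
have etaH (j : 'I_(#|H| %/ 5)) a : (a < 5)%N -> eta j a \in H by move=> am; exact: chunk_in am (ltn_ord j).
apply: (@core_count R S K k admS emb s f [set e] ps sS Pf _ _ psM 5 pattern_ne _ eta) => //.
- by move=> x; rewrite finset.in_set1 => /eqP->.
- by rewrite finset.in_set1.
- exact: core_ne.
- move=> j j' a a' am am' /chunk_inj[] // jj ->; split=> //; exact: val_inj.
- move=> j a a' g am am' aa'; rewrite finset.in_set1 => /eqP->; apply/negP => h.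
  suff /subr0_eq E0 : eta j a - eta j a' = 0.
    have [_ E] := chunk_inj am am' (ltn_ord j) (ltn_ord j) E0.
    by rewrite /pattern_ne E eqxx in aa'.
  apply: nilradical_trivial => // g' Pg'; have [->//|ge] := eqVneq g' e.
  have gn : g' \notin [set e] by rewrite finset.in_set1.
  by apply: maxidB => //; [have /core_blockP := etaH j a am|have /core_blockP := etaH j a' am']; apply.
- rewrite card_ord.
  have h := @leq_chunks 5 #|H| 9 isT H5 isT.
  apply: leq_trans (leq_mul psq3 h) _.
  by move: (size ps) (#|H| %/ 5)%N => a b; nia.
Qed.

Lemma residues_nth_inj e i j : e \in places R -> (i < #|residues e|)%N ->
  (j < #|residues e|)%N ->
  nth 0 (enum (residues e)) i - nth 0 (enum (residues e)) j \in maxid e -> i = j.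
Proof.
move=> Pe iq jq h; apply/eqP.
rewrite -(nth_uniq 0 _ _ (enum_uniq (residues e))) -?cardE //; apply/eqP.
by apply: residue_inj h => //; rewrite -mem_enum mem_nth // -cardE.
Qed.

(** Three residues at each of two places form the grid pattern; the numerical
    hypothesis is satisfied by residue fields with at most four elements if
    those of [e1], [e2] and [f] are distributed well. *)
Lemma card_two_residues e1 e2 f : #|N| = 1%N ->
  e1 \in places R -> e2 \in places R -> f \in places R ->
  e1 != e2 -> f != e1 -> f != e2 ->
  (2 < #|residues e1|)%N -> (2 < #|residues e2|)%N ->
  (forall mu, (#|residues f| <= 2 * mu + 1)%N ->
     (#|residues f| * (#|residues e1| * #|residues e2|) <= 32 * mu)%N) ->
  (#|R| <= 32 * k)%N.
Proof.
move=> N1 P1 P2 Pf e12 f1 f2 q1 q2 bound; have [s sS] := S_elt.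
have [ps psM psq] := matching_exists Pf (S_unit sS).
have [ps0 _] := matching_size Pf psq.
set H := core_block [set e1; e2].
pose r1 a := nth 0 (enum (residues e1)) (a %/ 3)%N.
pose r2 a := nth 0 (enum (residues e2)) (a %% 3)%N.
pose eta (j : unit) a := e1 * r1 a + e2 * r2 a.
have lt9 a : (a < 9)%N -> (a %/ 3 < 3)%N /\ (a %% 3 < 3)%N by lia.
have d1 a b : (a < 9)%N -> (b < 9)%N -> eta tt a - eta tt b \in maxid e1 -> (a %/ 3 = b %/ 3)%N.
  move=> /lt9[a1 _] /lt9[b1 _] h; apply: (residues_nth_inj P1).
  - exact: leq_trans q1.
  - exact: leq_trans q1.
  have := maxidB P1 h (local_maxid (r2 a - r2 b) P2 P1 e12).
  rewrite -(local_maxid_self (r1 a - r1 b) P1).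
  suff -> : eta tt a - eta tt b - e2 * (r2 a - r2 b) = e1 * (r1 a - r1 b) by [].
  by rewrite /eta; ring.
have d2 a b : (a < 9)%N -> (b < 9)%N -> eta tt a - eta tt b \in maxid e2 -> (a %% 3 = b %% 3)%N.
  move=> /lt9[_ a1] /lt9[_ b1] h; apply: (residues_nth_inj P2).
  - exact: leq_trans q2.
  - exact: leq_trans q2.
  rewrite eq_sym in e12.
  have := maxidB P2 h (local_maxid (r1 a - r1 b) P1 P2 e12).
  rewrite -(local_maxid_self (r2 a - r2 b) P2).
  suff -> : eta tt a - eta tt b - e1 * (r1 a - r1 b) = e2 * (r2 a - r2 b) by [].
  by rewrite /eta; ring.
apply: (@core_count R S K k admS emb s f [set e1; e2] ps sS Pf _ _ psM 9 pattern_grid _ eta) => //.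
- by move=> x; rewrite finset.in_set2 => /orP[] /eqP->.
- by rewrite finset.in_set2 negb_or f1.
- exact: core_grid.
- move=> j a _; apply/core_blockP => g Pg; rewrite finset.in_set2 negb_or => /andP[g1 g2].
  by apply: maxidD => //; exact: local_maxid.
- move=> [] [] a a' am am' E; split=> //.
  rewrite (divn_eq a 3) (divn_eq a' 3).
  by rewrite (d1 a a') ?(d2 a a') // E subrr maxid0.
- move=> [] a a' g am am' /andP[n1 n2]; rewrite finset.in_set2 => /orP[] /eqP->.
    by apply: contra n1 => h; apply/eqP; exact: d1.
  by apply: contra n2 => h; apply/eqP; exact: d2.
- rewrite card_unit muln1; apply: leq_trans (bound _ psq).
  by rewrite leq_mul2l card_core_block2 ?orbT.
Qed.

(** Three residues at [e], each doubled by the nilradical. *)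
Lemma card_nilradical2 e f : #|N| = 2%N -> e \in places R -> f \in places R ->
  f != e -> (2 < #|residues e|)%N -> (#|R| <= 32 * k)%N.
Proof.
move=> N2 Pe Pf fe q3; have [s sS] := S_elt.
have [ps psM psq] := matching_exists Pf (S_unit sS).
have [ps0 psq3] := matching_size Pf psq.
set H := core_block [set e].
pose q := #|residues e|.
pose r (j : 'I_(q %/ 3)) a := nth 0 (enum (residues e)) (3 * j + a %/ 2).
pose n a := nth 0 (enum N) (a %% 2)%N.
pose eta (j : 'I_(q %/ 3)) a := e * r j a + n a.
have lt6 a : (a < 6)%N -> (a %/ 2 < 3)%N by lia.
have nN a : n a \in N by rewrite /n -mem_enum mem_nth // -cardE N2 ltn_pmod.
have d j j' a b : eta j a - eta j' b \in maxid e -> r j a - r j' b \in maxid e.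
  move=> h; rewrite -(local_maxid_self _ Pe).
  have nn : n a - n b \in maxid e.
    by apply: maxidB => //; have /nilradicalP := nN a; have /nilradicalP := nN b; auto.
  have := maxidB Pe h nn.
  suff -> : eta j a - eta j' b - (n a - n b) = e * (r j a - r j' b) by [].
  by rewrite /eta; ring.
have dr (j j' : 'I_(q %/ 3)) a b : (a < 6)%N -> (b < 6)%N ->
    r j a - r j' b \in maxid e -> j = j' /\ (a %/ 2 = b %/ 2)%N.
  move=> /lt6 a3 /lt6 b3 h.
  have E : r j a = r j' b by apply: residue_inj h => //; apply: chunk_in => //; exact: ltn_ord.
  by have [] := chunk_inj a3 b3 (ltn_ord j) (ltn_ord j') E; split=> //; exact: val_inj.
apply: (@core_count R S K k admS emb s f [set e] ps sS Pf _ _ psM 6 pattern_double _ eta) => //.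
- by move=> x; rewrite finset.in_set1 => /eqP->.
- by rewrite finset.in_set1.
- exact: core_double.
- move=> j a _; apply/core_blockP => g Pg; rewrite finset.in_set1 => ge.
  by apply: maxidD => //; [exact: local_maxid|have /nilradicalP := nN a; apply].
- move=> j j' a a' am am' E.
  have [] := dr j j' a a' am am'; first by apply: d; rewrite E subrr maxid0.
  move=> jj aa; split=> //; move: E; rewrite /eta /r jj aa => /addrI.
  move=> /eqP; rewrite nth_uniq ?enum_uniq -?cardE ?N2 ?ltn_pmod // => /eqP mm.
  by rewrite (divn_eq a 2) (divn_eq a' 2) aa mm.
- move=> j a a' g am am' aa'; rewrite finset.in_set1 => /eqP->; apply/negP => /d/dr[] // _ E.
  by rewrite /pattern_double E eqxx in aa'.
- rewrite card_ord; have h := @leq_chunks 3 q 5 isT q3 isT.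
  have cH := card_core_block1 Pe; rewrite N2 in cH.
  apply: leq_trans (leq_mul psq3 (leq_trans cH (leq_mul h (leqnn 2)))) _.
  by rewrite -/q; move: (size ps) (q %/ 3)%N => a b; nia.
Qed.

(** In a field any nine elements contain two disjoint triples joined by all
    nine edges. *)
Lemma field_triples s n (W : {set R}) : s \is a GRing.unit ->
  (forall x, x != 0 -> x \is a GRing.unit) -> (6 * n + 3 <= #|W|)%N ->
  exists w : seq R, [/\ uniq w, {subset w <= W}, size w = (6 * n)%N &
    forall i a b, (i < n)%N -> (a < 3)%N -> (b < 3)%N ->
      nth 0 w (6 * i + a) + s * nth 0 w (6 * i + 3 + b) != 0].
Proof.
move=> us field; elim: n W => [|n IH] W cW; first by exists [::]; split.
pose X := take 3 (enum W).
have sX : size X = 3%N by rewrite size_take -cardE; case: ltngtP => //; lia.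
have XW : {subset X <= W} by move=> x /mem_take; rewrite mem_enum.
have uX : uniq X by rewrite take_uniq ?enum_uniq.
pose A := [set x in X]; pose A' := [set - s^-1 * x | x in A].
have cA : #|A| = 3%N by rewrite cardsE; move/card_uniqP: uX => ->.
have cA' : (#|A'| <= 3)%N by rewrite -cA leq_imset_card.
pose Y := take 3 (enum (W :\: A :\: A')).
have cY : (3 <= #|W :\: A :\: A'|)%N.
  have c1 := cardsD (W :\: A) A'; have c2 := cardsD W A.
  have c3 : (#|(W :\: A) :&: A'| <= 3)%N.
    exact: leq_trans (subset_leq_card (finset.subsetIr (W :\: A) A')) cA'.
  have c4 : (#|W :&: A| <= 3)%N.
    by rewrite -cA; exact: subset_leq_card (finset.subsetIr W A).
  by rewrite c1 c2; move: c3 c4 cW; lia.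
have sY : size Y = 3%N by rewrite size_take -cardE; case: ltngtP => //; lia.
have YW y : y \in Y -> [/\ y \in W, y \notin A & y \notin A'].
  by move=> /mem_take; rewrite mem_enum !finset.in_setD => /and3P[? ? ?].
have uXY : uniq (X ++ Y).
  rewrite cat_uniq uX take_uniq ?enum_uniq // andbT /=; apply/hasPn => y /YW[_ yA _].
  by move: yA; rewrite inE.
pose B := [set x in X ++ Y].
have cB : #|B| = 6%N by rewrite cardsE; move/card_uniqP: uXY => ->; rewrite size_cat sX sY.
have [|w [uw wW sw hw]] := IH (W :\: B).
  have c1 := cardsD W B.
  have c2 : (#|W :&: B| <= 6)%N.
    by rewrite -cB; exact: subset_leq_card (finset.subsetIr W B).
  by rewrite c1; move: c2 cW; lia.
exists ((X ++ Y) ++ w); split.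
- rewrite cat_uniq uXY uw andbT; apply/hasPn => x /wW; rewrite finset.in_setD inE.
  by case/andP.
- move=> x; rewrite !mem_cat => /orP[/orP[/XW//|/YW[]//]|/wW].
  by rewrite finset.in_setD => /andP[].
- by rewrite !size_cat sX sY sw; lia.
case=> [|i] a b iN a3 b3.
  rewrite muln0 !add0n nth_cat size_cat sX sY nth_cat sX a3 (leq_trans a3) //.
  rewrite nth_cat size_cat sX sY ltn_add2l b3 nth_cat sX ltnNge leq_addr /= addKn.
  have xA : nth 0 X a \in A by rewrite inE mem_nth // sX.
  have /YW[_ _ yA'] : nth 0 Y b \in Y by rewrite mem_nth // sY.
  apply: contra yA' => /eqP E; apply/imsetP; exists (nth 0 X a) => //.
  by rewrite -[LHS](mulKr us) mulNr -mulrN; congr (_ * _); move/eqP: E; rewrite addrC addr_eq0 => /eqP.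
have sz : size (X ++ Y) = 6%N by rewrite size_cat sX sY.
rewrite !(nth_cat _ (X ++ Y)) sz.
have -> : (6 * i.+1 + a < 6)%N = false by lia.
have -> : (6 * i.+1 + 3 + b < 6)%N = false by lia.
have -> : (6 * i.+1 + a - 6 = 6 * i + a)%N by lia.
have -> : (6 * i.+1 + 3 + b - 6 = 6 * i + 3 + b)%N by lia.
exact: hw.
Qed.

(** A field has no second place to keep the sides of the cores disjoint, but
    there is room enough to choose them greedily. *)
Lemma card_field : (32 < #|R|)%N -> (forall x, x != 0 -> x \is a GRing.unit) ->
  (#|R| <= 32 * k)%N.
Proof.
move=> R33 field; have [s sS] := S_elt.
pose n := ((#|R| - 3) %/ 6)%N.
have [|w [uw _ sw hw]] := @field_triples s n [set: R] (S_unit sS) field.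
  by rewrite cardsT /n; move: #|R| R33 => q; lia.
have lt (i : 'I_n) a : (a < 6)%N -> (6 * i + a < size w)%N.
  by rewrite sw; have := ltn_ord i; lia.
have inj (i j : 'I_n) a b : (a < 6)%N -> (b < 6)%N ->
    nth 0 w (6 * i + a) = nth 0 w (6 * j + b) -> i = j /\ a = b.
  move=> a6 b6 /eqP; rewrite nth_uniq ?lt // => /eqP E.
  have ij : (i = j :> nat)%N by lia.
  by split; [exact: val_inj|lia].
have : (#|'I_n| <= k)%N.
  apply: (@bipartite_cores_le K R (Gamma S) k 3 pattern_all 'I_n
    (fun i a => nth 0 w (6 * i + a)) (fun i a => nth 0 w (6 * i + (3 + a)))) => //.
  - exact: Gamma_symmetric.
  - exact: core_all.
  - move=> i a b a3 b3 _; apply/andP; split.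
      by apply/eqP => /inj[||_ E]; lia.
    by apply/existsP; exists s; rewrite sS field // addnA hw.
  - by move=> i j a b a3 b3; apply: inj; lia.
  - by move=> i j a b a3 b3 /inj[||-> E]; [lia|lia|split=> //; lia].
  - by move=> i j a b a3 b3 /inj[||_ E]; lia.
by rewrite card_ord /n; move: #|R| R33 => q; lia.
Qed.

End NonplanarCases.

(** * Small residue fields *)

Section SmallResidues.
Variable R : finComUnitRingType.
Implicit Types (e f g s x y : R).

Local Notation cls g := (coset_rep (maxid g)).

Lemma residues_uniq_le g (w : seq R) : uniq (map (cls g) w) -> (size w <= #|residues g|)%N.
Proof.
move=> u; rewrite -(size_map (cls g)) cardE; apply: uniq_leq_size => // x /mapP[y _ ->].
by rewrite mem_enum imset_f.
Qed.

Lemma residue2 g x : g \in places R -> (#|residues g| <= 2)%N ->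
  (x \in maxid g) || (x - 1 \in maxid g).
Proof.
move=> Pg q2; rewrite -[x in x \in _]subr0 -!cls_eq //.
apply/negPn/negP; rewrite negb_or => /andP[n1 n2].
have := @residues_uniq_le g [:: x; 0; 1]; rewrite /= !inE negb_or n1 n2 /=.
rewrite cls_eq // sub0r maxidN (negbTE (maxid1 Pg)) => /(_ isT).
by move/leq_trans/(_ q2).
Qed.

Lemma residue2_char g : g \in places R -> (#|residues g| <= 2)%N -> 1 + 1 \in maxid g.
Proof.
move=> Pg q2; have := residue2 (1 + 1) Pg q2; rewrite addrK => /orP[//|].
by rewrite (negbTE (maxid1 Pg)).
Qed.

(** Otherwise 0, 1, -1 and a pair of opposite classes would be distinct. *)
Lemma residue4_char g : g \in places R -> #|residues g| = 4%N -> 1 + 1 \in maxid g.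
Proof.
move=> Pg q4; apply/negPn/negP => n2.
have u3 : uniq (map (cls g) [:: 0; 1; -1]).
  rewrite /= !inE negb_or !cls_eq // !sub0r opprK !maxidN (negbTE (maxid1 Pg)) /=.
  by rewrite n2.
have [x xr nx] : exists2 x, x \in residues g & x \notin map (cls g) [:: 0; 1; -1].
  have : ~~ (residues g \subset map (cls g) [:: 0; 1; -1]).
    apply/negP => /subset_leq_card; rewrite q4 => /leq_trans/(_ (card_size _)).
    by rewrite size_map.
  by case/subsetPn => x; exists x.
have cx : cls g x = x.
  by case/imsetP: xr => y _ ->; apply: coset_repK; [exact: maxid0|move=> ? ?; exact: maxidB].
move: nx; rewrite -{1}cx /= !inE !negb_or !cls_eq // subr0 opprK => /and3P[x0 x1 x1'].
have := @residues_uniq_le g [:: x; - x; 0; 1; -1].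
rewrite q4 map_cons cons_uniq map_cons cons_uniq u3 /= !inE !negb_or !cls_eq //.
have -> : x - - x = x * (1 + 1) by ring.
have -> : - x - 1 = - (x + 1) by ring.
have -> : - x - -1 = - (x - 1) by ring.
rewrite !subr0 !opprK !maxidN x0 x1 x1' (maxid_prime Pg x0 n2) /=.
by move=> /(_ isT).
Qed.

Lemma residue_char2_sqr g s : g \in places R -> 1 + 1 \in maxid g ->
  s * s - 1 \in maxid g -> s - 1 \in maxid g.
Proof.
move=> Pg c2 h; apply/negPn/negP => n.
have := maxid_prime Pg n n; have -> : (s - 1) * (s - 1) = (s * s - 1) - (1 + 1) * (s - 1) by ring.
by rewrite maxidB // maxidM.
Qed.

Lemma unit_notin_maxid g s : g \in places R -> s \is a GRing.unit -> s \notin maxid g.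
Proof. by move=> Pg; rewrite unit_places => /forallP/(_ g)/implyP; apply. Qed.

(** The field with four elements and a multiplier other than one: the
    multipliers [s] and its inverse together join all non-zero elements. *)
Lemma card_residue4 (S : {set R}) (K : realType) (k : nat) e f s :
  admissible S -> embeds_in K (Gamma S) (sphere_with_crosscaps K k) ->
  #|nilradical R| = 1%N -> e \in places R -> f \in places R -> f != e ->
  #|residues e| = 4%N ->
  (forall g, g \in places R -> g != e -> (#|residues g| <= 2)%N) ->
  s \in S -> s - 1 \notin maxid e -> (#|R| <= 32 * k)%N.
Proof.
move=> admS emb N1 Pe Pf fe q4 q2 sS s1.
have Su t : t \in S -> t \is a GRing.unit by case: admS => _ h _; exact: h.
have SV : s^-1 \in S by case: admS => _ _ h; exact: h.
have ef0 : e * f = 0 by rewrite (place_orth Pe Pf) // eq_sym.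
have c2 := residue4_char Pe q4.
pose I : finType := {x : R | (e * x == 0) && (f * x == 0)}.
pose W := rem (cls e 0) (enum (residues e)).
have W0 : cls e 0 \in enum (residues e) by rewrite mem_enum imset_f.
have sW : size W = 3%N by rewrite size_rem // -cardE q4.
have uW : uniq W by rewrite rem_uniq // enum_uniq.
pose r a := nth 0 W a.
have rW a : (a < 3)%N -> r a \in W by move=> a3; rewrite mem_nth // sW.
have rres a : (a < 3)%N -> r a \in residues e.
  by move=> /rW; rewrite mem_rem_uniq ?enum_uniq // inE mem_enum => /andP[].
have rnz a : (a < 3)%N -> r a \notin maxid e.
  move=> a3; have := rW a a3; rewrite mem_rem_uniq ?enum_uniq // inE => /andP[+ _].
  apply: contra => h; apply/eqP.
  apply: (residue_inj Pe (rres a a3)); first by rewrite -mem_enum.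
  by rewrite -[X in X \in _]opprK maxidN opprB -cls_eq //
    coset_repK ?cls_eq ?sub0r ?maxidN //; [exact: maxid0|move=> ? ?; exact: maxidB].
pose L (i : I) a := val i + e * r a.
pose Rr (i : I) a := (1 - e) * (1 + val i) + e * r a.
have ei (i : I) : e * val i = 0 by case: i => x /= /andP[/eqP].
have fi (i : I) : f * val i = 0 by case: i => x /= /andP[_ /eqP].
have eL i a : e * L i a = e * r a by rewrite mulrDr ei add0r mulrA place_idem.
have eR i a : e * Rr i a = e * r a.
  rewrite mulrDr !mulrA mulrBr mulr1 (place_idem Pe) subrr mul0r add0r.
  by [].
have LR i j a b : L i a <> Rr j b.
  move=> /(congr1 ( *%R f)).
  have -> : f * L i a = f * val i + e * f * r a by rewrite /L; ring.
  have -> : f * Rr j b = f + f * val j - e * f * (1 + val j) + e * f * r b by rewrite /Rr; ring.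
  rewrite !fi ef0 !mul0r !addr0 subr0 => /esym/eqP.
  by rewrite (negbTE (place_neq0 Pf)).
have rinj a b : (a < 3)%N -> (b < 3)%N -> e * r a = e * r b -> a = b.
  move=> a3 b3 E; apply/eqP; rewrite -(nth_uniq 0 _ _ uW) ?sW //; apply/eqP.
  apply: (residue_inj Pe (rres a a3) (rres b b3)).
  by rewrite -(local_maxid_self _ Pe) mulrBr E subrr maxid0.
have cardI : (#|I| <= k)%N.
  apply: (@bipartite_cores_le K R (Gamma S) k 3 pattern_all I L Rr) => //.
  - exact: Gamma_symmetric.
  - exact: core_all.
  - move=> i a b a3 b3 _; have ne : L i a != Rr i b by apply/eqP; exact: LR.
    have adj t : t \in S -> r a + t * r b \notin maxid e -> Gamma S (L i a) (Rr i b).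
      move=> tS rt; rewrite /Gamma ne /=; apply/existsP; exists t; rewrite tS unit_places.
      apply/forallP => g; apply/implyP => Pg; have [->|ge] := eqVneq g e.
        rewrite (@maxid_local _ e _ (r a + t * r b)) //.
        by rewrite mulrDr eL mulrCA eR mulrCA -mulrDr.
      have ge0 : g * e = 0 by rewrite place_orth.
      have gt := residue2 t Pg (q2 g Pg ge); rewrite (negbTE (unit_notin_maxid Pg (Su t tS))) /= in gt.
      rewrite (@maxid_local _ g _ (1 + ((1 + 1) * val i + (t - 1) * (1 + val i)))) //; last first.
        rewrite /L /Rr.
        have -> : g * (val i + e * r a + t * ((1 - e) * (1 + val i) + e * r b)) =
          g * (val i + t * (1 + val i)) + g * e * (r a - t * (1 + val i) + t * r b) by ring.
        by rewrite ge0 mul0r addr0; congr (_ * _); ring.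
      apply/negP => h.
      have h2 : (1 + 1) * val i + (t - 1) * (1 + val i) \in maxid g.
        by apply: maxidD => //; apply: maxidM => //; apply: residue2_char => //; exact: q2.
      by have := maxidB Pg h h2; rewrite addrK; apply/negP; exact: maxid1.
    have [h|h] := boolP (r a + s * r b \in maxid e); last exact: (adj s).
    apply: (adj s^-1) => //; apply/negP => h'; move/negP: s1; apply.
    apply: (residue_char2_sqr Pe c2); apply/negPn/negP => ns.
    have h3 := maxidB Pe h h'.
    have n3 := maxid_prime Pe ns (rnz b b3).
    have := maxidM s h3; have -> : (r a + s * r b - (r a + s^-1 * r b)) * s
      = (s * s - s^-1 * s) * r b by ring.
    by rewrite mulVr ?Su // (negbTE n3).
  - move=> i j a b a3 b3 E; have ab : a = b.
      by apply: rinj => //; rewrite -(eL i) -(eL j) E.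
    by split=> //; move: E; rewrite /L ab => /addIr/val_inj.
  - move=> i j a b a3 b3 E; have ab : a = b.
      by apply: rinj => //; rewrite -(eR i) -(eR j) E.
    split=> //; apply: val_inj; move: E; rewrite /Rr ab => /addIr.
    rewrite !mulrBl !mul1r !mulrDr !ei !addr0 => /addIr/addrI.
    by [].
apply: (@leq_trans (8 * #|I|)); last by lia.
pose B := [set x : R | (e * x == 0) && (f * x == 0)].
have -> : #|I| = #|B| by rewrite card_sig; apply: eq_card => x; rewrite !inE.
pose F x := ((cls e x, cls f x), (1 - e - f) * x).
have injF : injective F.
  move=> x y [/eqP c1 /eqP c3 c4]; rewrite cls_eq // in c1; rewrite cls_eq // in c3.
  apply: subr0_eq; apply: nilradical_trivial => // g Pg.
  have [->//|ge] := eqVneq g e; have [->//|gf] := eqVneq g f.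
  rewrite (@maxid_local _ g _ 0) ?maxid0 // mulr0.
  have -> : g * (x - y) = g * ((1 - e - f) * x) - g * ((1 - e - f) * y)
    + (g * e + g * f) * (x - y) by ring.
  by rewrite c4 subrr (place_orth Pg Pe ge) (place_orth Pg Pf gf) addr0 mul0r addr0.
rewrite -cardsT -(card_imset _ injF).
have sub : F @: [set: R] \subset finset.setX (finset.setX (residues e) (residues f)) B.
  apply/fintype.subsetP => _ /imsetP[x _ ->]; rewrite !finset.in_setX !imset_f //= inE.
  have -> : e * ((1 - e - f) * x) = (e - e * e - e * f) * x by ring.
  have -> : f * ((1 - e - f) * x) = (f - e * f - f * f) * x by ring.
  by rewrite !place_idem // ef0 !subr0 !subrr mul0r eqxx.
apply: leq_trans (subset_leq_card sub) _; rewrite !cardsX q4.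
by apply: leq_mul => //; rewrite (leq_mul2l 4 _ 2) q2.
Qed.

End SmallResidues.

(** * Rings with a planar graph *)

Section PlanarRings.
Variables (R : finComUnitRingType) (S : {set R}) (K : realType).
Hypothesis admS : admissible S.
Implicit Types (e f g s x y : R).

Local Notation N := (nilradical R).

Section Parity.
Variable f : R.
Hypotheses (Pf : f \in places R) (qf : (#|residues f| <= 2)%N).

Definition odd_at x : bool := x \notin maxid f.

Lemma odd_atP x : x - (odd_at x)%:R \in maxid f.
Proof.
rewrite /odd_at; case: (boolP (x \in maxid f)) => [h|n]; first by rewrite subr0.
by have := residue2 x Pf qf; rewrite (negbTE n).
Qed.

Lemma unit_sum_residue2 g s x y : g \in places R -> (#|residues g| <= 2)%N ->
  s \is a GRing.unit -> x + s * y \is a GRing.unit -> x + y - 1 \in maxid g.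
Proof.
move=> Pg qg us uxy.
have := residue2 s Pg qg; rewrite (negbTE (unit_notin_maxid Pg us)) /= => h1.
have := residue2 (x + s * y) Pg qg; rewrite (negbTE (unit_notin_maxid Pg uxy)) /= => h2.
have := maxidB Pg h2 (maxidM y h1).
by have -> : x + s * y - 1 - (s - 1) * y = x + y - 1 by ring.
Qed.

Lemma odd_at_edge x y : x + y - 1 \in maxid f -> odd_at x != odd_at y.
Proof.
move=> h; apply/negP => /eqP E.
have h2 := maxidB Pf (maxidB Pf h (odd_atP x)) (odd_atP y).
have c2 := residue2_char Pf qf.
have : 1 \in maxid f.
  rewrite -maxidN; move: h2; rewrite E; case: (odd_at y) => h2.
    have := maxidB Pf h2 c2; rewrite /=.
    by have -> : x + y - 1 - (x - 1) - (y - 1) - (1 + 1) = - 1 by ring.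
  by move: h2; have -> : x + y - 1 - (x - 0) - (y - 0) = - 1 by ring.
by rewrite (negbTE (maxid1 Pf)).
Qed.

Lemma odd_at_invariant g x y : g \in places R -> (#|residues g| <= 2)%N ->
  x + y - 1 \in maxid g -> odd_at x != odd_at y ->
  (x + (odd_at x)%:R) - (y + (odd_at y)%:R) \in maxid g.
Proof.
move=> Pg qg h; have c2 := maxidM y (residue2_char Pg qg).
case: (odd_at x) (odd_at y) => [] [] // _.
  have := maxidD Pg (maxidB Pg h c2) (residue2_char Pg qg).
  by have -> : x + y - 1 - (1 + 1) * y + (1 + 1) = x + 1 - (y + 0) by ring.
have := maxidB Pg h c2.
by have -> : x + y - 1 - (1 + 1) * y = x + 0 - (y + 1) by ring.
Qed.

End Parity.

Lemma GammaP x y : reflect (x <> y /\ exists2 s, s \in S & x + s * y \is a GRing.unit)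
  (Gamma S x y).
Proof.
apply: (iffP andP) => -[/eqP n].
  by move=> /existsP[s /andP[? ?]]; split=> //; exists s.
by move=> [s sS u]; split=> //; apply/existsP; exists s; rewrite sS.
Qed.

Let S_unit s : s \in S -> s \is a GRing.unit.
Proof. by case: admS => _ h _; exact: h. Qed.

(** Adding one outside the place [e] to the vertices that are odd at [f] gives
    a quantity that is constant on components; within a component a vertex is
    determined by its residue at [e] and its parity. *)
Lemma planar_reduced (adj : rel nat) (ps : seq (int * int)) e f (c : R -> nat) :
  checked_drawing adj ps -> #|N| = 1%N -> e \in places R -> f \in places R -> f != e ->
  (forall g, g \in places R -> g != e -> (#|residues g| <= 2)%N) ->
  (forall x, (c x < 4)%N) -> (forall x (b : bool), (c x + 4 * b < size ps)%N) ->
  (forall x y, c x = c y -> x - y \in maxid e) ->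
  (forall x y (b b' : bool), Gamma S x y -> b != b' -> adj (c x + 4 * b)%N (c y + 4 * b')%N) ->
  embeds_in K (Gamma S) (sphere_with_crosscaps K 0).
Proof.
move=> ok N1 Pe Pf fe q2 c4 csz cinj cadj; have qf := q2 f Pf fe.
pose z x := (1 - e) * (x + (odd_at f x)%:R).
apply: (@embeds_in_of_drawing K R (Gamma S) (fun x => enum_rank (z x))
  (fun x => c x + 4 * odd_at f x)%N adj ps ok).
- by move=> x; exact: csz.
- move=> x y /val_inj/enum_rank_inj zz ll.
  have cc : c x = c y by have := c4 x; have := c4 y; lia.
  have ch : odd_at f x = odd_at f y.
    by move: ll; rewrite cc => /addnI; case: (odd_at f x) (odd_at f y) => [] [].
  apply: subr0_eq; apply: nilradical_trivial => // g Pg.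
  have [->|ge] := eqVneq g e; first exact: cinj.
  move: zz; rewrite /z ch => zz.
  rewrite (@maxid_local _ g _ 0) ?maxid0 // mulr0.
  have -> : g * (x - y) = g * ((1 - e) * (x + (odd_at f y)%:R) - (1 - e) * (y + (odd_at f y)%:R))
    + g * e * (x - y) by ring.
  by rewrite zz subrr mulr0 (place_orth Pg Pe ge) mul0r addr0.
- move=> x y xy; have /GammaP[_ [s sS u]] := xy.
  have h g : g \in places R -> g != e -> x + y - 1 \in maxid g.
    by move=> Pg ge; apply: unit_sum_residue2 u => //; [exact: q2|exact: S_unit].
  have od : odd_at f x != odd_at f y by apply: odd_at_edge => //; exact: h.
  split; last exact: cadj.
  congr (nat_of_ord (enum_rank _)); apply: subr0_eq.
  apply: nilradical_trivial => // g Pg; rewrite /z -mulrBr.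
  have [->|ge] := eqVneq g e.
    rewrite (@maxid_local _ e _ 0) ?maxid0 // mulr0 mulrA (_ : e * (1 - e) = 0) ?mul0r //.
    by rewrite mulrBr mulr1 place_idem // subrr.
  rewrite mulrC; apply: maxidM; apply: odd_at_invariant => //; [exact: q2|exact: h].
- exact: Gamma_symmetric.
Qed.

Let residue_index e x := index (coset_rep (maxid e) x) (enum (residues e)).

Let residue_mem e x : coset_rep (maxid e) x \in enum (residues e).
Proof. by rewrite mem_enum imset_f. Qed.

(** Here adjacency requires different residues at [e] and different parities at
    [f]; with at most four residues this gives subgraphs of the cube. *)
Lemma planar_cube e f : #|N| = 1%N -> e \in places R -> f \in places R -> f != e ->
  (forall g, g \in places R -> g != e -> (#|residues g| <= 2)%N) ->
  (#|residues e| <= 4)%N -> 1 + 1 \in maxid e ->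
  (forall s, s \in S -> s - 1 \in maxid e) ->
  embeds_in K (Gamma S) (sphere_with_crosscaps K 0).
Proof.
move=> N1 Pe Pf fe q2 q4 c2 s1.
have lt x : (residue_index e x < 4)%N.
  by apply: leq_trans q4; rewrite cardE index_mem.
have rinj x y : residue_index e x = residue_index e y -> x - y \in maxid e.
  move=> E; rewrite -cls_eq //; apply/eqP.
  by rewrite -(nth_index 0 (residue_mem e x)) -/(residue_index e x) E nth_index.
apply: (planar_reduced (c := residue_index e) cube_drawing N1 Pe Pf fe q2) => //.
  by move=> x b; have := lt x; case: b => /=; lia.
move=> x y b b' /GammaP[_ [s sS u]] bb.
have ne : residue_index e x != residue_index e y.
  apply/negP => /eqP/rinj h; have := unit_notin_maxid Pe u; apply/negP; rewrite negbK.
  have -> : x + s * y = (x - y) + (1 + 1) * y + (s - 1) * y by ring.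
  by apply: maxidD => //; [apply: maxidD => //|]; apply: maxidM => //; exact: s1.
rewrite /cube_adj; have := lt x; have := lt y; move/eqP: ne.
by case: b b' bb => [] [] //= _; move: (residue_index e x) (residue_index e y); lia.
Qed.

(** The residues at [e] of adjacent vertices are not both zero, which is the
    missing edge of the complete bipartite graph. *)
Lemma planar_three e f : #|N| = 1%N -> e \in places R -> f \in places R -> f != e ->
  (forall g, g \in places R -> g != e -> (#|residues g| <= 2)%N) ->
  #|residues e| = 3%N ->
  embeds_in K (Gamma S) (sphere_with_crosscaps K 0).
Proof.
move=> N1 Pe Pf fe q2 q3.
pose W := coset_rep (maxid e) 0 :: rem (coset_rep (maxid e) 0) (enum (residues e)).
have pW : perm_eq (enum (residues e)) W by apply: perm_to_rem; exact: residue_mem.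
have WP x : coset_rep (maxid e) x \in W by rewrite -(perm_mem pW); exact: residue_mem.
pose c x := index (coset_rep (maxid e) x) W.
have lt x : (c x < 3)%N by rewrite -q3 cardE (perm_size pW) index_mem.
have c0 x : c x = 0%N -> x \in maxid e.
  move=> E; rewrite -[x]subr0 -cls_eq //; apply/eqP.
  by rewrite -(nth_index 0 (WP x)) -/(c x) E.
apply: (planar_reduced (c := c) k33_minus_drawing N1 Pe Pf fe q2).
- by move=> x; apply: leq_trans (lt x) _.
- by move=> x b; have := lt x; case: b => /=; lia.
- move=> x y E; rewrite -cls_eq //; apply/eqP.
  by rewrite -(nth_index 0 (WP x)) -/(c x) E nth_index.
move=> x y b b' /GammaP[_ [s sS u]] bb.
have ne : c x <> 0%N \/ c y <> 0%N.
  have [/c0 hx|/eqP] := eqVneq (c x) 0%N; last by left.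
  have [/c0 hy|/eqP] := eqVneq (c y) 0%N; last by right.
  exfalso; have := unit_notin_maxid Pe u; apply/negP; rewrite negbK.
  by apply: maxidD => //; rewrite mulrC; exact: maxidM.
rewrite /k33_minus_adj; have := lt x; have := lt y.
by case: b b' bb => [] [] //= _; move: (c x) (c y) ne; lia.
Qed.

(** Components are 4-cycles, drawn here inside a cube: adjacent vertices differ
    in parity, and each has a twin that differs by the non-zero nilpotent. *)
Lemma planar_nilradical2 : #|N| = 2%N ->
  (forall g, g \in places R -> (#|residues g| <= 2)%N) ->
  embeds_in K (Gamma S) (sphere_with_crosscaps K 0).
Proof.
move=> N2 q2; have [f Pf] := places_neq0 R; have qf := q2 f Pf.
have N0 : 0 \in N by rewrite inE nilpotent0.
have NB x y : x \in N -> y \in N -> x - y \in N.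
  move=> /nilradicalP hx /nilradicalP hy; apply/nilradicalP => g Pg.
  by apply: maxidB => //; [exact: hx|exact: hy].
pose z x := coset_rep N (x + (odd_at f x)%:R).
pose d x : bool := x == coset_rep N x.
apply: (@embeds_in_of_drawing K R (Gamma S) (fun x => enum_rank (z x))
  (fun x => d x + 6 * odd_at f x)%N cube_adj cube_points cube_drawing).
- by move=> x; case: (d x); case: (odd_at f x).
- move=> x y /val_inj/enum_rank_inj/eqP; rewrite /z coset_rep_eq // => zz ll.
  have [dd ch] : d x = d y /\ odd_at f x = odd_at f y.
    by move: ll; case: (d x); case: (d y); case: (odd_at f x); case: (odd_at f y).
  have xyN : x - y \in N by move: zz; rewrite ch; have -> : x + (odd_at f y)%:R - (y + (odd_at f y)%:R) = x - y by ring.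
  have /eqP rr : coset_rep N x == coset_rep N y by rewrite coset_rep_eq.
  have [dx|ndx] := boolP (d x).
    have dy : d y by rewrite -dd.
    by rewrite (eqP dx) rr -(eqP dy).
  have ndy : ~~ d y by rewrite -dd.
  have nx : x - coset_rep N y != 0 by rewrite subr_eq0 -rr.
  have ny : y - coset_rep N y != 0 by rewrite subr_eq0.
  have hx : x - coset_rep N y \in N by rewrite -rr; exact: coset_rep_sub.
  have hy : y - coset_rep N y \in N by exact: coset_rep_sub.
  apply: (addIr (- coset_rep N y)); apply/eqP; apply/negPn/negP => nxy.
  have un : uniq [:: 0; x - coset_rep N y; y - coset_rep N y].
    by rewrite /= !inE negb_or eq_sym nx eq_sym ny nxy.
  have sub : {subset [:: 0; x - coset_rep N y; y - coset_rep N y] <= enum N}.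
    by move=> w; rewrite mem_enum !in_cons in_nil orbF => /or3P[] /eqP->.
  by have := uniq_leq_size un sub; rewrite -cardE N2.
- move=> x y xy; have /GammaP[_ [s sS u]] := xy.
  have h g : g \in places R -> x + y - 1 \in maxid g.
    by move=> Pg; apply: unit_sum_residue2 u => //; [exact: q2|exact: S_unit].
  have od : odd_at f x != odd_at f y by apply: odd_at_edge => //; exact: h.
  split.
    congr (nat_of_ord (enum_rank _)); apply/eqP; rewrite coset_rep_eq //.
    by apply/nilradicalP => g Pg; apply: odd_at_invariant => //; [exact: q2|exact: h].
  by move: od; case: (d x); case: (d y); case: (odd_at f x); case: (odd_at f y).
- exact: Gamma_symmetric.
Qed.

End PlanarRings.

(** * The bound for rings with a non-planar graph *)

Section Bound.
Variables (R : finComUnitRingType) (S : {set R}) (K : realType) (k : nat).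
Hypothesis admS : admissible S.
Hypothesis emb : embeds_in K (Gamma S) (sphere_with_crosscaps K k).
Hypothesis nonplanar : ~ embeds_in K (Gamma S) (sphere_with_crosscaps K 0).
Hypothesis R33 : (32 < #|R|)%N.

Local Notation N := (nilradical R).

Let only_place e : e \in places R ->
  ~ (exists2 f, f \in places R & f != e) -> core_block [set e] = [set: R].
Proof.
move=> Pe no; apply/setP => x; rewrite [RHS]inE; apply/core_blockP => g Pg.
by rewrite finset.in_set1 => ge; case: no; exists g.
Qed.

(** A residue field with more than two elements leads to the doubled hexagon;
    otherwise the graph is planar. *)
Lemma card_le_nilradical2 : #|N| = 2%N -> (#|R| <= 32 * k)%N.
Proof.
move=> N2; have [[e [Pe q3]]|no] :=
  pselect (exists e, e \in places R /\ (2 < #|residues e|)%N); last first.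
  case: nonplanar; apply: planar_nilradical2 => // g Pg.
  by rewrite leqNgt; apply/negP => h; apply: no; exists g.
have [[f Pf fe]|nf] := pselect (exists2 f, f \in places R & f != e).
  exact: (card_nilradical2 admS emb N2 Pe Pf fe q3).
(* in a local ring, a unit [u] fixes the only non-zero nilpotent [n], so
   [u - 1] annihilates [n] and is not a unit *)
exfalso; have onlyP g : g \in places R -> g = e.
  by move=> Pg; apply/eqP/negPn/negP => ge; apply: nf; exists g.
have MN x : x \in maxid e -> x \in N.
  by move=> h; apply/nilradicalP => g /onlyP->.
have [n nN n0] : exists2 n, n \in N & n != 0.
  have : ~~ (N \subset [set 0]).
    by apply/negP => /subset_leq_card; rewrite N2 cards1.
  by case/subsetPn => n nN; rewrite finset.in_set1 => ?; exists n.
have Nn x : x \in N -> x != 0 -> x = n.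
  move=> xN x0; apply/eqP/negPn/negP => xn.
  have un : uniq [:: 0; x; n] by rewrite /= !inE negb_or eq_sym x0 eq_sym n0 xn.
  have sub : {subset [:: 0; x; n] <= enum N}.
    move=> w; rewrite mem_enum !in_cons in_nil orbF => /or3P[] /eqP-> //.
    by rewrite inE nilpotent0.
  by have := uniq_leq_size un sub; rewrite -cardE N2.
have unitP x : x \notin maxid e -> x \is a GRing.unit.
  by move=> h; rewrite unit_places; apply/forallP => g; apply/implyP => /onlyP->.
have one x : x \notin maxid e -> x - 1 \in maxid e.
  move=> /unitP ux; apply/negPn/negP => /unitP u1.
  have xn : x * n = n.
    apply: Nn; last by rewrite mulrI_eq0 //; exact: mulrI.
    by move: nN; rewrite !inE mulrC; exact: nilpotent_mulr.
  have : (x - 1) * n = 0 by rewrite mulrBl xn mul1r subrr.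
  by move/eqP; rewrite mulrI_eq0 ?(negbTE n0) //; exact: mulrI.
move: q3; rewrite ltnNge => /negP; apply.
have sub : residues e \subset [set coset_rep (maxid e) 0; coset_rep (maxid e) 1].
  apply/fintype.subsetP => _ /imsetP[x _ ->]; rewrite finset.in_set2 !cls_eq // subr0.
  by case: (boolP (x \in maxid e)) => //= /one.
apply: leq_trans (subset_leq_card sub) _.
by rewrite cards2; case: eqP.
Qed.

(** The ring is a product of fields.  It has many cores unless all factors have
    at most four elements and at most one of them has more than two; then the
    graph is planar, except when a field with four elements is met with a
    multiplier other than one. *)
Lemma card_le_reduced : #|N| = 1%N -> (#|R| <= 32 * k)%N.
Proof.
move=> N1.
have [[e [Pe q5]]|no5] :=
  pselect (exists e, e \in places R /\ (4 < #|residues e|)%N).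
  have [[f Pf fe]|nf] := pselect (exists2 f, f \in places R & f != e).
    exact: (card_large_residue admS emb N1 Pe Pf fe q5).
  apply: (card_field admS emb R33) => x x0; rewrite unit_places; apply/forallP => g.
  apply/implyP => Pg; apply: contra x0 => h; apply/eqP; apply: nilradical_trivial => // g' Pg'.
  have onlyP h' : h' \in places R -> h' = e.
    by move=> Ph; apply/eqP/negPn/negP => ge; apply: nf; exists h'.
  by rewrite (onlyP _ Pg') -(onlyP _ Pg).
have q4 g : g \in places R -> (#|residues g| <= 4)%N.
  by move=> Pg; rewrite leqNgt; apply/negP => h; apply: no5; exists g.
have [[e1 [e2 [P1 P2 e12 q1 q2]]]|no2] := pselect (exists e1 e2, [/\ e1 \in places R,
    e2 \in places R, e1 != e2, (2 < #|residues e1|)%N & (2 < #|residues e2|)%N]).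
  have [[f [Pf f1 f2]]|nf] := pselect (exists f, [/\ f \in places R, f != e1 & f != e2]); last first.
    exfalso; have E : core_block [set e1; e2] = [set: R].
      apply/setP => x; rewrite [RHS]inE; apply/core_blockP => g Pg.
      by rewrite finset.in_set2 negb_or => /andP[? ?]; case: nf; exists g.
    have := card_core_block2 P1 P2 N1; rewrite E cardsT => h.
    by have := leq_trans R33 (leq_trans h (leq_mul (q4 _ P1) (q4 _ P2))).
  have r1 := q4 _ P1; have r2 := q4 _ P2; have rf := q4 _ Pf; have gf := residues_gt1 Pf.
  (* an even residue field has a perfect matching, so it is left for the
     matching whenever there is one *)
  have [f3|f3] := eqVneq #|residues f| 3%N; last first.
    apply: (card_two_residues admS emb N1 P1 P2 Pf e12 f1 f2 q1 q2) => mu.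
    have : #|residues f| = 2%N \/ #|residues f| = 4%N by lia.
    by case=> ->; move: #|residues e1| #|residues e2| r1 r2 => a b; nia.
  have [e13|e13] := eqVneq #|residues e1| 3%N; last first.
    have fe : e1 != f by rewrite eq_sym.
    apply: (card_two_residues admS emb N1 Pf P2 P1 f2 fe e12 _ q2); rewrite f3 // => mu.
    have -> : #|residues e1| = 4%N by lia.
    by move: #|residues e2| r2 => a; lia.
  have [e23|e23] := eqVneq #|residues e2| 3%N; last first.
    have fe : e2 != f by rewrite eq_sym.
    have e21 : e2 != e1 by rewrite eq_sym.
    have fe1 : e1 != f by rewrite eq_sym.
    apply: (card_two_residues admS emb N1 P1 Pf P2 fe1 e21 fe q1 _); rewrite f3 // => mu.
    have -> : #|residues e2| = 4%N by lia.
    by rewrite e13; lia.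
  apply: (card_two_residues admS emb N1 P1 P2 Pf e12 f1 f2 q1 q2) => mu.
  by rewrite f3 e13 e23; lia.
have [e [Pe q2]] : exists e, e \in places R /\
    forall g, g \in places R -> g != e -> (#|residues g| <= 2)%N.
  have [[e [Pe q3]]|no3] := pselect (exists e, e \in places R /\ (2 < #|residues e|)%N).
    exists e; split=> // g Pg ge; rewrite leqNgt; apply/negP => h.
    by apply: no2; exists g, e.
  have [e Pe] := places_neq0 R; exists e; split=> // g Pg _.
  by rewrite leqNgt; apply/negP => h; apply: no3; exists g.
have [[f Pf fe]|nf] := pselect (exists2 f, f \in places R & f != e); last first.
  have := card_core_block1 Pe; rewrite (only_place Pe nf) cardsT N1 muln1 => h.
  by have := leq_trans R33 (leq_trans h (q4 _ Pe)).
have [e3|e3] := eqVneq #|residues e| 3%N.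
  by case: nonplanar; exact: (planar_three K admS N1 Pe Pf fe q2 e3).
have ge := residues_gt1 Pe; have le := q4 _ Pe.
have c2 : 1 + 1 \in maxid e.
  have [h|h] : #|residues e| = 2%N \/ #|residues e| = 4%N by lia.
    by apply: residue2_char; rewrite ?h.
  exact: residue4_char.
have [[s [sS s1]]|no1] := pselect (exists s, s \in S /\ s - 1 \notin maxid e); last first.
  case: nonplanar; apply: (planar_cube K admS N1 Pe Pf fe q2 le c2) => s sS.
  by apply/negPn/negP => h; apply: no1; exists s.
have e4 : #|residues e| = 4%N.
  have [h|//] : #|residues e| = 2%N \/ #|residues e| = 4%N by lia.
  have := residue2 s Pe; rewrite h (negbTE s1) orbF => /(_ isT) sM.
  have us : s \is a GRing.unit by case: admS => _ hu _; exact: hu.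
  by have := unit_notin_maxid Pe us; rewrite sM.
exact: (card_residue4 admS emb N1 Pe Pf fe e4 q2 sS s1).
Qed.

End Bound.

Theorem card_ring_le (R : finComUnitRingType) (S : {set R}) (K : realType) (k : nat) :
  admissible S -> (0 < k)%N -> crosscap_number_is K (Gamma S) k -> (#|R| <= 32 * k)%N.
Proof.
move=> admS k0 [emb min].
have [le|gt] := leqP #|R| 32; first by apply: leq_trans le _; rewrite leq_pmulr.
have np : ~ embeds_in K (Gamma S) (sphere_with_crosscaps K 0).
  by move=> /min; rewrite leqNgt k0.
have [lt|] := ltnP 2 #|nilradical R|; first exact: (card_large_nilradical admS emb).
have : (0 < #|nilradical R|)%N by apply/card_gt0P; exists 0; rewrite inE nilpotent0.
case E : #|nilradical R| => [|[|[|n]]] // _ _.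
- exact: (card_le_reduced admS emb np gt).
- exact: (card_le_nilradical2 admS emb np).
Qed.

(** * Finitely many rings of bounded cardinality *)

Section RingTables.
Variable b : nat.

Definition ring_table : finType :=
  ('I_b.+1 * {ffun 'I_b.+1 * 'I_b.+1 -> 'I_b.+1} * {ffun 'I_b.+1 * 'I_b.+1 -> 'I_b.+1})%type.

Definition decode (R : finComUnitRingType) (i : 'I_b.+1) : R := nth 0 (enum R) i.
Definition encode (R : finComUnitRingType) (x : R) : 'I_b.+1 := inord (index x (enum R)).

Definition table_of (R : finComUnitRingType) : ring_table :=
  (inord #|R|,
   [ffun ij => encode (decode R ij.1 + decode R ij.2)],
   [ffun ij => encode (decode R ij.1 * decode R ij.2)]).

Lemma encodeE (R : finComUnitRingType) (x : R) : (#|R| <= b)%N ->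
  encode x = index x (enum R) :> nat.
Proof.
move=> Rb; rewrite /encode inordK // ltnS; apply: leq_trans Rb.
by rewrite cardE index_size.
Qed.

Lemma encodeK (R : finComUnitRingType) (x : R) : (#|R| <= b)%N -> decode R (encode x) = x.
Proof. by move=> Rb; rewrite /decode encodeE // nth_index // mem_enum. Qed.

Lemma encode_lt (R : finComUnitRingType) (x : R) : (#|R| <= b)%N ->
  (encode x < #|R|)%N.
Proof. by move=> Rb; rewrite encodeE // cardE index_mem mem_enum. Qed.

Lemma decodeK (R : finComUnitRingType) (i : 'I_b.+1) : (#|R| <= b)%N ->
  (i < #|R|)%N -> encode (decode R i) = i.
Proof.
move=> Rb iR; apply: val_inj; rewrite /= encodeE // /decode index_uniq ?enum_uniq //.
by rewrite -cardE.
Qed.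

Lemma table_of_isomorphic (R R' : finComUnitRingType) :
  (#|R| <= b)%N -> (#|R'| <= b)%N -> table_of R = table_of R' -> ring_isomorphic R R'.
Proof.
move=> Rb Rb' [/(congr1 val) /= cRR tadd tmul].
have {}cRR : #|R| = #|R'| by move: cRR; rewrite !inordK.
pose phi (x : R) : R' := decode R' (encode x).
pose psi (y : R') : R := decode R (encode y).
have phiE x : encode (phi x) = encode x.
  by apply: decodeK => //; rewrite -cRR encode_lt.
have psiE y : encode (psi y) = encode y.
  by apply: decodeK => //; rewrite cRR encode_lt.
have phiK : cancel phi psi by move=> x; rewrite /psi phiE encodeK.
have psiK : cancel psi phi by move=> y; rewrite /phi psiE encodeK.
have phiD x y : phi (x + y) = phi x + phi y.
  have := congr1 (fun t : {ffun _ -> _} => t (encode x, encode y)) tadd.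
  rewrite /= !ffunE /= !encodeK // -/(phi x) -/(phi y) => E.
  by rewrite -[LHS]/(decode R' (encode (x + y))) E encodeK.
have phiM x y : phi (x * y) = phi x * phi y.
  have := congr1 (fun t : {ffun _ -> _} => t (encode x, encode y)) tmul.
  rewrite /= !ffunE /= !encodeK // -/(phi x) -/(phi y) => E.
  by rewrite -[LHS]/(decode R' (encode (x * y))) E encodeK.
have phi0 : phi 0 = 0 by apply: (addrI (phi 0)); rewrite -phiD !addr0.
have phi1 : phi 1 = 1 by have := phiM 1 (psi 1); rewrite mul1r psiK mulr1.
pose phiA := GRing.isNmodMorphism.Build _ _ phi (conj phi0 phiD).
pose phiMM := GRing.isMonoidMorphism.Build _ _ phi (conj phi1 phiM).
pose phiRM : {rmorphism R -> R'} := HB.pack phi phiA phiMM.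
by exists phiRM; exists psi.
Qed.

(** One ring for each realized table represents all isomorphism classes. *)
Lemma finitely_many_rings : exists (n : nat) (L : 'I_n -> finComUnitRingType),
  forall R : finComUnitRingType, (#|R| <= b)%N -> exists i, ring_isomorphic R (L i).
Proof.
pose realized (t : ring_table) (R : finComUnitRingType) := (#|R| <= b)%N /\ table_of R = t.
pose ring_of (t : ring_table) : finComUnitRingType :=
  if pselect (exists R, realized t R) is left h then projT1 (cid h) else 'F_2.
exists #|ring_table|, (fun i => ring_of (enum_val i)) => R Rb.
exists (enum_rank (table_of R)); rewrite enum_rankK /ring_of.
case: pselect => [h|[]]; last by exists R.
have [Lb tE] := projT2 (cid h).
exact: table_of_isomorphic.
Qed.

End RingTables.

Theorem corollary3p9 (K : realType) :
  (forall (R : finComUnitRingType) (S : {set R}) (k : nat),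
     admissible S -> (0 < k)%N -> crosscap_number_is K (Gamma S) k ->
     (#|R| <= 32 * k)%N) /\
  (forall k : nat, (0 < k)%N ->
     exists (n : nat) (L : 'I_n -> finComUnitRingType),
     forall R : finComUnitRingType,
       (exists S : {set R}, admissible S /\ crosscap_number_is K (Gamma S) k) ->
       exists i : 'I_n, ring_isomorphic R (L i)).
Proof.
split=> [R S k admS k0 cc|k k0]; first exact: (card_ring_le admS k0 cc).
have [n [L hL]] := finitely_many_rings (32 * k).
by exists n, L => R [S [admS cc]]; apply: hL; exact: (card_ring_le admS k0 cc).
Qed.
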